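(* Let $r\ge0$ be an integer, let $\delta_r=(r,r-1,\dots,1)$ (with $\delta_0=(0)$), let $\lambda$ be a partition with $D_{\delta_r}\subseteq D_\lambda\subseteq D_{((r+1)^{r+1})}$, and let $\nu$ be a strict partition. Let $a_{\lambda/\delta_r\,\nu}$ be the coefficients in the expansion of the skew Schur function into Schur $P$-functions $$s_{\lambda/\delta_r}=\sum_{\nu}a_{\lambda/\delta_r\,\nu}\,P_\nu \qquad(\nu\text{ strict partitions}).$$ Then $$a_{\lambda/\delta_r\,\nu}=\left|\mathtt{A}_{\lambda/\delta_r\,\nu}\right|,$$ where $\mathtt{A}_{\lambda/\delta_r\,\nu}$ is the set of tableaux $Q$ such that (1) $Q\in SST^+_{[r+1]}(\nu)$ with $c_k(Q)=\lambda_{r-k+2}-k+1$ for $1\le k\le r+1$; (2) for $1\le k\le r$ and $1\le i\le N$ one has $m_k(i)\le m_{k+1}(i)+1$, where $w_{\rm rev}(Q)=w_1\cdots w_N$ and $m_k(i)=c_k(w_1\cdots w_i)$.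
   Context: **Diagrams.** For a partition $\lambda$, $D_\lambda=\{(i,j):1\le j\le\lambda_i,\ 1\le i\le\ell(\lambda)\}$ is its usual (unshifted) diagram; $((r+1)^{r+1})$ is the partition with $r+1$ parts equal to $r+1$. A strict partition is a partition whose nonzero parts are distinct; its shifted diagram is $D^+_\nu=\{(i,j): i\le j\le\nu_i+i-1,\ 1\le i\le\ell(\nu)\}$. Row $i$ is counted from the top and column $j$ from the left. **Tableaux.** $[m]=\{1<2<\dots<m\}$. $SST^+_{[r+1]}(\nu)$ is the set of fillings of $D^+_\nu$ with entries in $[r+1]$ that are weakly increasing along rows from left to right and strictly increasing down columns. $c_a(\cdot)$ is the number of occurrences of $a$. $w_{\rm rev}(Q)$ is the word obtained by reading the rows of $Q$ from bottom to top, each row from left to right; $N=|\nu|$ is its length. **Schur $P$-functions.** Let $\mathcal N=\{1'<1<2'<2<\cdots\}$. $P_\nu=\sum_T x^T$, where $T$ runs over fillings of $D^+_\nu$ by $\mathcal N$ with rows and columns weakly increasing, unprimed letters strictly increasing in each column, primed letters strictly increasing in each row, and no primed entry on the main diagonal, and $x^T=\prod_i x_i^{c_i(T)+c_{i'}(T)}$. The $P_\nu$ are linearly independent, and for $\lambda$ as in the claim $s_{\lambda/\delta_r}$ lies in their span. *)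

(* Defs.v *)
From HB Require Import structures.
From mathcomp Require Import all_boot all_order all_algebra.
From mathcomp Require Import finmap mpoly.

Set Implicit Arguments.
Unset Strict Implicit.
Unset Printing Implicit Defensive.

Import GRing.Theory.

Definition is_partition (la : seq nat) := sorted geq la && (0 \notin la).

Definition is_strict_partition (nu : seq nat) := sorted gtn nu && (0 \notin nu).

Record strict_partition := StrictPartition {
  strict_parts :> seq nat;
  _ : is_strict_partition strict_parts
}.
HB.instance Definition _ := [isSub for strict_parts].
HB.instance Definition _ := [Choice of strict_partition by <:].

(* Parts, rows and columns are numbered from 1; parts beyond the length are 0. *)
Definition part (la : seq nat) (i : nat) : nat := nth 0 la i.-1.

Definition staircase (r : nat) : seq nat := rev (iota 1 r).

Definition diagram (la : seq nat) : seq (nat * nat) :=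
  [seq (i, j) | i <- iota 1 (size la), j <- iota 1 (part la i)].

Definition skew_diagram (la mu : seq nat) : seq (nat * nat) :=
  [seq c <- diagram la | c \notin diagram mu].

(* [iota i m] is i, ..., i + m - 1. *)
Definition shifted_diagram (nu : seq nat) : seq (nat * nat) :=
  [seq (i, j) | i <- iota 1 (size nu), j <- iota i (part nu i)].

Section Fillings.

Variables (D : seq (nat * nat)) (L : finType).

Definition filling := {ffun seq_sub D -> L}.

Definition left_of (c d : seq_sub D) :=
  ((val c).1 == (val d).1) && ((val c).2 < (val d).2).

Definition above (c d : seq_sub D) :=
  ((val c).2 == (val d).2) && ((val c).1 < (val d).1).

End Fillings.

Definition semistandard (D : seq (nat * nat)) (n : nat) (T : filling D 'I_n) :=
  [forall c, forall d,
     (left_of c d ==> (T c <= T d)) && (above c d ==> (T c < T d))].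

(* The alphabet 1' < 1 < 2' < 2 < ... < n' < n: the letter k (resp. k') is
   the pair (k - 1, false) (resp. (k - 1, true)). *)
Definition letter (n : nat) : finType := ('I_n * bool)%type.

Definition primed (n : nat) (x : letter n) : bool := x.2.

Definition letter_rank (n : nat) (x : letter n) : nat :=
  x.1.*2 + ~~ primed x.

Definition letter_le n (x y : letter n) := letter_rank x <= letter_rank y.
Definition letter_lt n (x y : letter n) := letter_rank x < letter_rank y.

Definition marked_shifted_tableau (nu : seq nat) (n : nat)
    (T : filling (shifted_diagram nu) (letter n)) :=
  [forall c, forall d,
     [&& left_of c d || above c d ==> letter_le (T c) (T d),
         [&& above c d, ~~ primed (T c) & ~~ primed (T d)]
           ==> letter_lt (T c) (T d)
       & [&& left_of c d, primed (T c) & primed (T d)]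
           ==> letter_lt (T c) (T d)]]
  && [forall c, ((val c).1 == (val c).2) ==> ~~ primed (T c)].

Local Open Scope ring_scope.

(* A symmetric function f(x_1, x_2, ...) is given by the family of its
   restrictions f(x_1, ..., x_n), for all n. *)
Definition skew_schur (n : nat) (la mu : seq nat) : {mpoly rat[n]} :=
  \sum_(T : filling (skew_diagram la mu) 'I_n | semistandard T)
     \prod_(c : seq_sub (skew_diagram la mu)) 'X_(T c).

Definition schurP (n : nat) (nu : seq nat) : {mpoly rat[n]} :=
  \sum_(T : filling (shifted_diagram nu) (letter n) | marked_shifted_tableau T)
     \prod_(c : seq_sub (shifted_diagram nu)) 'X_((T c).1).

Local Close Scope ring_scope.

(* The ordinal k : 'I_m stands for the letter k + 1 of [m]; cells outside D
   have entry 0. *)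
Definition entry (D : seq (nat * nat)) (m : nat) (Q : filling D 'I_m)
    (c : nat * nat) : nat :=
  if insub c is Some c' then (Q c').+1 else 0.

Definition w_rev (nu : seq nat) (m : nat)
    (Q : filling (shifted_diagram nu) 'I_m) : seq nat :=
  [seq entry Q (i, j) | i <- rev (iota 1 (size nu)), j <- iota i (part nu i)].

Definition letter_count (D : seq (nat * nat)) (m : nat) (Q : filling D 'I_m)
    (k : nat) : nat :=
  #|[set c : seq_sub D | (Q c).+1 == k]|.

(* The truncated subtractions are exact when staircase r is contained in la,
   since then part la (r + 2 - k) >= k - 1 for 1 <= k <= r + 1. *)
Definition tableaux_A (r : nat) (la nu : seq nat) :
    {set filling (shifted_diagram nu) 'I_r.+1} :=
  [set Q | [&& semistandard Q,
     all (fun k => letter_count Q k == part la (r + 2 - k) + 1 - k)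
         (iota 1 r.+1)
   & all (fun k => all (fun i =>
            count_mem k (take i (w_rev Q))
              <= count_mem k.+1 (take i (w_rev Q)) + 1)
          (iota 1 (sumn nu)))
         (iota 1 r)]].

(* Main.v *)
(* The proof is an insertion algorithm of Sagan and Worley. Number the letters so that the letter
   [r + 2 - i] stands for row [i] of [la]. Recording the rows of the cells of a filling of
   [la / delta_r] in the order of its standardization gives a word, and the filling is semistandard
   exactly when every prefix [w] satisfies [c_k w <= c_(k+1) w + 1]; the square containing [la]
   takes care of the last letter. Shifted insertion of such a word gives a semistandard shifted
   tableau [Q], together with a marked shifted tableau of the same shape recording the growth of
   the shape, the marks telling which insertions ended in a column. It carries the prefix condition
   of the word to the one of the reading word of [Q], compares successive letters as the recording
   tableau compares successive steps, and is injective; the prefix condition makes it invertible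
   from every corner with either mark. So [skew_schur la] is the sum of the [schurP mu] weighted by
   the number of tableaux [Q] of shape [mu].

   The [schurP mu] are independent: in a marked tableau the entries of row [i] are at least [i],
   so if the shape is [mu] and the content is [nu], then the sum of [(i - 1) mu_i] is at most the
   sum of [(i - 1) nu_i], with equality only if [mu = nu]. *)
Require Import Defs.
From mathcomp Require Import all_boot all_order all_algebra.
From mathcomp Require Import finmap mpoly.
From mathcomp Require Import zify.

Set Implicit Arguments.
Unset Strict Implicit.
Unset Printing Implicit Defensive.

(** * Shifted insertion of a letter *)

(** The slack 1 in the prefix condition comes from the staircase: each row of [la / delta_r] starts
    one column to the left of the row above it, so a row may be one cell ahead of the row above, and
    no more. The same slack makes the displacement of a diagonal entry harmless, since the first
    occurrence of a letter never breaks the condition. The delicate point is the inverse. A marked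
    corner asks either for an entry to send back to the row below, or for a first entry that
    displaced the diagonal; the latter is impossible if the row begins with a repeated entry. The
    prefix condition guarantees that in such a row an entry can be sent back ([not_tight_head]).
    Rows are sorted multisets, compared only through the counting function [below]. Replacing an
    entry changes a count by at most one, columns never have to be written down, and all conditions
    on shapes become linear inequalities. *)

Section RowInsertion.

Implicit Types (u v l w : seq nat) (x y z t e k : nat) (Q R : seq (seq nat)) (st : nat * bool).

Definition below (u : seq nat) (k : nat) := count (fun e => e < k) u.
#[global] Arguments below : simpl never.

Definition occ (k : nat) (u : seq nat) : nat := count_mem k u.
#[global] Arguments occ : simpl never.

Lemma occ_cons k x u : occ k (x :: u) = (x == k) + occ k u.
Proof. by []. Qed.

Lemma occ_cat k u v : occ k (u ++ v) = occ k u + occ k v.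
Proof. exact: count_cat. Qed.

Lemma occ_perm k u v : perm_eq u v -> occ k u = occ k v.
Proof. by move/permP; apply. Qed.

Lemma occ_gt0 k u : (0 < occ k u) = (k \in u).
Proof. by rewrite -has_count has_pred1. Qed.

Lemma occ_nil k : occ k [::] = 0.
Proof. by []. Qed.

Lemma occ0 k u : k \notin u -> occ k u = 0.
Proof. by rewrite -occ_gt0 lt0n negbK => /eqP. Qed.

Lemma occ_rcons k u x : occ k (rcons u x) = occ k u + (x == k).
Proof. by rewrite -cats1 occ_cat occ_cons occ_nil addn0. Qed.

Lemma below_cons x u k : below (x :: u) k = (x < k) + below u k.
Proof. by []. Qed.

Lemma below_cat u v k : below (u ++ v) k = below u k + below v k.
Proof. exact: count_cat. Qed.

Lemma below_perm u v k : perm_eq u v -> below u k = below v k.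
Proof. by move/permP; apply. Qed.

Lemma below_leq u j k : j <= k -> below u j <= below u k.
Proof. by move=> jk; apply: sub_count => e /= /leq_trans; apply. Qed.

Lemma belowS u k : below u k.+1 = below u k + occ k u.
Proof. by elim: u => [|e u IHu] //=; rewrite !below_cons occ_cons IHu; lia. Qed.

Lemma below_mem u k : (k \in u) = (below u k < below u k.+1).
Proof. by rewrite belowS -occ_gt0; lia. Qed.

Lemma below_size u k : below u k <= size u.
Proof. exact: count_size. Qed.

Lemma below_eq u j k : j <= k -> (forall e, e \in u -> e < j \/ k <= e) ->
  below u j = below u k.
Proof.
move=> jk h.
have H e : e < j \/ k <= e -> (e < j) = (e < k) by lia.
by apply: eq_in_count => e /h /H.
Qed.

Lemma below_gt0 u k : (0 < below u k) = has (fun e => e < k) u.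
Proof. by rewrite has_count. Qed.

Lemma below_perm_eq u v : (forall k, below u k = below v k) -> perm_eq u v.
Proof.
move=> h; apply/allP => e _ /=; apply/eqP.
by have := h e.+1; rewrite !belowS h => /addnI.
Qed.

(** The witness is the largest entry not exceeding [k]; it lets a condition on all [k] be tested at
    entries only. *)
Lemma below_top u k : 0 < below u k.+1 ->
  exists2 e, e \in u & e <= k /\ below u e.+1 = below u k.+1.
Proof.
elim: k => [|k IHk] h.
  by exists 0 => //; rewrite below_mem; apply: leq_ltn_trans h;
    rewrite leqn0 -leqn0 leqNgt below_gt0 -all_predC; apply/allP.
case: (boolP (k.+1 \in u)) => ku; first by exists k.+1.
have e : below u k.+2 = below u k.+1.
  by move: ku; rewrite below_mem -leqNgt; have := below_leq u (leqnSn k.+1); lia.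
rewrite e in h *; have [x xu [xk eq]] := IHk h.
by exists x => //; split=> //; lia.
Qed.

(* Row [l] fits under row [u] of a shifted tableau; see [dom_nthP]. *)
Definition dom (u l : seq nat) :=
  forall k, below l k.+1 = 0 \/ below l k.+1 < below u k.

Lemma dom_size u l : dom u l -> l != [::] -> size l < size u.
Proof.
move=> /(_ (\max_(e <- l) e)); have e : below l (\max_(e <- l) e).+1 = size l.
  by apply/eqP; rewrite -all_count; apply/allP => e el; rewrite ltnS leq_bigmax_seq.
rewrite e => [[/size0nil ->//|h _]]; exact: leq_trans h (below_size _ _).
Qed.

Lemma dom_criterion u l k :
  (forall e, e \in l -> e <= k -> below l e.+1 < below u e) ->
  below l k.+1 = 0 \/ below l k.+1 < below u k.
Proof.
move=> h; case: (posnP (below l k.+1)) => [|/below_top[e el [ek <-]]]; first by left.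
by right; apply: leq_trans (h _ el ek) (below_leq _ ek).
Qed.

Definition srt := sort leq.

Lemma below_srt u k : below (srt u) k = below u k.
Proof. exact/below_perm/permEl/perm_sort. Qed.

Lemma below_rem y u k : y \in u -> (y < k) + below (rem y u) k = below u k.
Proof. by move=> /perm_to_rem /below_perm ->. Qed.

Lemma sorted_leq_perm_inj u v : sorted leq u -> sorted leq v -> perm_eq u v -> u = v.
Proof. exact: (sorted_eq leq_trans anti_leq). Qed.

(* Rows are handled as sorted multisets: this is [u + x - y]. *)
Definition repl x y u := srt (x :: rem y u).

Lemma below_repl x y u k : y \in u ->
  (y < k) + below (repl x y u) k = (x < k) + below u k.
Proof. by move=> yu; rewrite below_srt below_cons -(below_rem k yu); lia. Qed.

(** The first clause says that [y] is not the diagonal entry, so that insertion stays in its row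
    phase. *)
Definition bumps x u y :=
  [/\ 0 < below u x.+1, y \in u, x < y & forall e, e \in u -> e <= x \/ y <= e].

(** The least entry of [l] at which [dom u l] fails; the column phase moves it to the row above. *)
Definition first_viol u l z :=
  [/\ z \in l, below u z <= below l z.+1
    & forall e, e \in l -> e < z -> below l e.+1 < below u e].

(* [ins_spec x Q R st t]: inserting [x] into the rows [Q] gives [R] with a new cell in row [st.1];
   [st.2] tells whether a diagonal entry has been displaced, so that insertion has switched to
   columns. In terms of rows, the column phase moves one entry from each row to the row above,
   starting from the bottom; if it reaches the first row, [t] is the entry moved last. *)
Inductive ins_spec (x : nat) : seq (seq nat) -> seq (seq nat) -> nat * bool -> nat -> Prop :=
| InsNew : ins_spec x [::] [:: [:: x]] (0, false) x
| InsApp u rest : all (leq^~ x) u ->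
    ins_spec x (u :: rest) (rcons u x :: rest) (0, false) x
| InsDiag y u rest : all (ltn x) (y :: u) ->
    ins_spec x ((y :: u) :: rest) ((x :: y :: u) :: rest) (0, true) y
| InsStop u y rest R st t : bumps x u y -> ins_spec y rest R st t ->
    dom (repl x y u) (head [::] R) ->
    ins_spec x (u :: rest) (repl x y u :: R) (st.1.+1, st.2) 0
| InsPass u y rest l tl z st t : bumps x u y -> ins_spec y rest (l :: tl) st t ->
    first_viol (repl x y u) l z ->
    ins_spec x (u :: rest) (srt (z :: repl x y u) :: rem z l :: tl) (0, true) z.

(** The function provides existence and determinism; proofs by cases use [ins_spec], which agrees
    with it on valid tableaux. When nothing leaves the lower rows for the first one, as in
    [InsStop], the returned 0 is a default value. *)
Fixpoint ins (x : nat) (Q : seq (seq nat)) : seq (seq nat) * (nat * bool) * nat :=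
  if Q is u :: rest then
    if [seq e <- u | x < e] is y :: _ then
      if 0 < below u x.+1 then
        let: (R, st, t) := ins y rest in
        let u' := repl x y u in
        let l := head [::] R in
        if [seq z <- l | below u' z <= below l z.+1] is z :: _ then
          (srt (z :: u') :: rem z l :: behead R, (0, true), z)
        else (u' :: R, (st.1.+1, st.2), 0)
      else ((x :: u) :: rest, (0, true), y)
    else (rcons u x :: rest, (0, false), x)
  else ([:: [:: x]], (0, false), x).

Fixpoint valid (Q : seq (seq nat)) : Prop :=
  if Q is u :: rest then
    [/\ sorted leq u, u != [::], dom u (head [::] rest) & valid rest]
  else True.

Lemma sorted_filter_head (a : pred nat) u y s : sorted leq u ->
  [seq e <- u | a e] = y :: s ->
  [/\ y \in u, a y & forall e, e \in u -> a e -> y <= e].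
Proof.
move=> su eq; have /= := mem_filter a y u; rewrite eq mem_head => /esym /andP[ay yu].
split=> // e eu ae; have : e \in y :: s by rewrite -eq mem_filter ae.
have: sorted leq (y :: s) by rewrite -eq sorted_filter //; apply: leq_trans.
rewrite /= (path_sortedE leq_trans) => /andP[/allP h _].
by rewrite inE => /predU1P[->|/h].
Qed.

Lemma filter_nil_all (a : pred nat) u : [seq e <- u | a e] = [::] ->
  forall e, e \in u -> ~~ a e.
Proof. by move=> eq e eu; apply/negP => ae; have := mem_filter a e u; rewrite eq ae eu. Qed.

Lemma filter_bumps x u y s : sorted leq u -> 0 < below u x.+1 ->
  [seq e <- u | x < e] = y :: s -> bumps x u y.
Proof.
move=> su hu /(sorted_filter_head su) [yu xy h]; split=> // e eu.
by case: (leqP e x) => [|/(h e eu)]; [left | right].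
Qed.

(* Effect of inserting [y] in row [u] on the row itself, before an entry is passed to it from
   the row underneath. *)
Definition rowstep u y v :=
  (all (leq^~ y) u /\ perm_eq v (y :: u)) \/
  exists y2, [/\ y2 \in u, y < y2, forall e, e \in u -> e <= y \/ y2 <= e
               & perm_eq (y2 :: v) (y :: u)].

(** Where [v] counts one more than [l], from [y] up to the entry displaced next, the count of [l] is
    constant; the missing unit comes from [x] at index [y] and from [y] in [u] beyond it. If [l] has
    no entry there, the entry of [u] not exceeding [x] keeps the bound. *)
Lemma dom_rowstep x u y l v : dom u l -> bumps x u y -> rowstep l y v ->
  dom (repl x y u) v.
Proof.
move=> d [hx yu xy gap] rs k.
have B := below_repl x k yu.
have B1 := below_leq u xy.
have B2 : below u y < below u y.+1 by rewrite -below_mem.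
case: rs => [[/allP lt /below_perm p]|[y2 [y2l yy2 gap2 /below_perm p]]].
  have := p k.+1; rewrite !below_cons => P.
  case: (ltnP k y) => ky; first by have := d k; lia.
  have E : below l k.+1 = below l y.+1.
    by apply/esym/below_eq; [lia | move=> e /lt; lia].
  have := d y; rewrite E in P *.
  have := below_leq u ky.
  have : y < k -> below u y.+1 <= below u k by move=> ?; apply: below_leq; lia.
  lia.
have := p k.+1; rewrite !below_cons => P.
case: (leqP k.+1 y) => ky; first by have := d k; lia.
case: (leqP y2 k) => ky2; first by have := d k; lia.
have E : below l k.+1 = below l y.+1.
  by apply/esym/below_eq; [lia | move=> e /gap2; lia].
have := d y; rewrite E in P *.
have : y <= k by lia. move=> /(below_leq u).
have : y < k -> below u y.+1 <= below u k by move=> ?; apply: below_leq; lia.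
lia.
Qed.

Definition slack t u l :=
  forall k, t < k -> below l k.+1 = 0 \/ (below l k.+1).+1 < below u k.

(* The first row of the result is [v] or, when an entry [t] has been moved up into it, [t + v];
   in that case any entry from [t] on may be removed from it again. *)
Definition top_state x Q R (st : nat * bool) t :=
  exists v, rowstep (head [::] Q) x v /\
    if st == (0, true) then
      [/\ x < t, perm_eq (head [::] R) (t :: v)
        & slack t (head [::] R) (head [::] (behead R))]
    else head [::] R = v.

Lemma mem_repl x u y : x \in repl x y u.
Proof. by rewrite mem_sort mem_head. Qed.

Lemma sorted_srt u : sorted leq (srt u).
Proof. exact: (sort_sorted leq_total). Qed.

Lemma perm_srt u : perm_eq (srt u) u.
Proof. exact/permEl/perm_sort. Qed.

Lemma srt_cons_neq0 x u : srt (x :: u) != [::].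
Proof. by apply/eqP => e; have := mem_sort leq (x :: u) x; rewrite -/srt e mem_head. Qed.

Lemma perm_swap x y (u : seq nat) : perm_eq (x :: y :: u) (y :: x :: u).
Proof. exact/permEl/(perm_catCA [:: x] [:: y]). Qed.

Lemma perm_repl x y u : y \in u -> perm_eq (y :: repl x y u) (x :: u).
Proof.
move=> yu; apply: below_perm_eq => k; rewrite !below_cons.
by have := below_repl x k yu; lia.
Qed.

Lemma bumps_rowstep x u y : bumps x u y -> rowstep u x (repl x y u).
Proof. by case=> _ yu xy gap; right; exists y; split=> //; apply: perm_repl. Qed.

(** Before [t] the rows [l] and [v] have the same counts, and [v] fits under [u]. *)
Lemma first_viol_bound u l z v t : first_viol u l z -> dom u v ->
  perm_eq l (t :: v) -> t <= z.
Proof.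
case=> zl h _ d /below_perm p; rewrite leqNgt; apply/negP => zt.
have := below_mem l z; rewrite zl; have := d z; have := p z.+1; rewrite below_cons; lia.
Qed.

Lemma first_viol_below u l z k : first_viol u l z -> k < z ->
  below l k.+1 = 0 \/ below l k.+1 < below u k.
Proof.
by case=> _ _ h kz; apply: dom_criterion => e el ek; apply: h => //; apply: leq_ltn_trans kz.
Qed.

Lemma first_viol_not_dom u l z : first_viol u l z -> ~ dom u l.
Proof. by case=> zl h _ /(_ z); have := below_mem l z; rewrite zl; lia. Qed.

Lemma sorted_rem z l : sorted leq l -> sorted leq (rem z l).
Proof. by move=> s; apply: (subseq_sorted leq_trans (rem_subseq _ _)). Qed.

Lemma sorted_rcons_leq u x : sorted leq (rcons u x) = all (leq^~ x) u && sorted leq u.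
Proof. by rewrite !(sorted_pairwise leq_trans) pairwise_rcons. Qed.

(* The bound needed for row [l], into which [t] has moved up, to pass an entry on to row [u]. *)
Lemma dom_pass_bound x u l t v k : x \in u -> x < t -> dom u v -> perm_eq l (t :: v) ->
  t <= k -> below l k.+1 <= below u k.
Proof.
move=> xu xt d /below_perm p tk; rewrite p below_cons.
have := d k; have := below_mem u x; rewrite xu.
have : x < k by lia. move/(below_leq u); lia.
Qed.

Lemma rowstep_mem u y v : rowstep u y v -> y \in v.
Proof.
case=> [[_ /perm_mem ->]|[y2 [_ yy2 _ /perm_mem /(_ y)]]]; first exact: mem_head.
by rewrite !inE eqxx ltn_eqF.
Qed.

(** Validity is proved together with [top_state], because the row above has to know what happened to
    the first of the lower rows and how much room was left under it. *)
Lemma ins_spec_valid x Q R st t : ins_spec x Q R st t -> valid Q ->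
  [/\ valid R, perm_eq (flatten R) (x :: flatten Q) & top_state x Q R st t].
Proof.
elim=> {x Q R st t}.
- move=> x _; split=> //; first by split=> //; left.
  by exists [:: x]; split=> //=; left.
- move=> x u rest lt [su un du vr].
  have px : perm_eq (rcons u x) (x :: u) by rewrite perm_rcons.
  split=> //.
  + split=> //.
    * by rewrite sorted_rcons_leq lt.
    * by case: (u).
    * by move=> k; have := du k; rewrite (below_perm _ px) below_cons; lia.
  + by rewrite /= -cat_cons perm_cat2r.
  + by exists (rcons u x); split=> //=; left.
- move=> x y u rest /= /andP[xy /allP lt] [su _ du vr].
  have lt' : forall k, k <= x -> below (head [::] rest) k.+1 = 0.
    move=> k kx; case: (du k) => // h; suff : below (y :: u) k = 0 by lia.
    apply/eqP; rewrite -leqn0 leqNgt below_gt0 -all_predC /= -leqNgt (leq_trans kx (ltnW xy)) /=.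
    by apply/allP => e /lt /= xe; rewrite -leqNgt; lia.
  split=> //.
  + split=> //; first by rewrite /= (ltnW xy).
    move=> k; case: (leqP k x) => [/lt'|kx]; first by left.
    by have := du k; rewrite (below_cons x); lia.
  + exists (x :: u); split; last first.
      split=> //=; first exact: perm_swap.
      by move=> k yk; have := du k; rewrite (below_cons x); lia.
    right; exists y; split=> //=; first by rewrite mem_head.
      move=> e; rewrite inE => /predU1P[->|eu]; first by right.
      by right; move: su; rewrite /= (path_sortedE leq_trans) => /andP[/allP /(_ e eu)].
    exact: perm_swap.
- move=> x u y rest R st t bu _ IH du' [su un du vr]; have [vR pR _] := IH vr.
  have yu : y \in u by case: bu.
  split.
  + by split=> //; [exact: sorted_srt | exact: srt_cons_neq0].
  + apply: below_perm_eq => k; have := below_perm k pR.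
    rewrite /= !(below_cons, below_cat).
    by have := below_repl x k yu; lia.
  + by exists (repl x y u); split=> //=; apply: bumps_rowstep.
- move=> x u y rest l tl z st t bu _ IH fv [su un du vr].
  have [[sl ln dl vtl] pR [v [rs]]] := IH vr.
  have yu : y \in u by case: bu.
  have xy : x < y by case: bu.
  have dv := dom_rowstep du bu rs.
  case: ifP => [_ /= [yt pl sk]|_ /= lv]; last by case: (first_viol_not_dom fv); rewrite lv.
  have tz := first_viol_bound fv dv pl.
  (* [K] only gives a weak inequality from [t] on. Moving [z] up lowers the counts of the lower row
     and raises those of the upper one: this restores [dom] and even leaves [slack] beyond [z]. *)
  have K := dom_pass_bound (mem_repl x u y) (ltn_trans xy yt) dv pl.
  have N := first_viol_below fv.
  have [zl hz _] := fv.
  have Bz : forall k, (z < k) + below (rem z l) k = below l k by move=> k; apply: below_rem.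
  split.
  + split; [exact: sorted_srt | exact: srt_cons_neq0 | | split=> //].
    * move=> k /=; rewrite below_srt below_cons.
      have := Bz k.+1; case: (ltngtP k z) => kz; first by have := N k kz; lia.
      - by have := K k; lia.
      - by have := K k; rewrite kz; lia.
    * exact: sorted_rem.
    * apply/eqP => e; have := below_perm y.+1 pl; rewrite below_cons.
      have := Bz y.+1; rewrite e (_ : below [::] _ = 0) //.
      by have := below_mem v y; rewrite (rowstep_mem rs); lia.
    * move=> k; have := Bz k; case: (ltnP z k) => zk; last by have := dl k; lia.
      by have := sk k; lia.
  + apply: below_perm_eq => k; have := below_perm k pR.
    rewrite /= !(below_cons, below_cat) below_srt below_cons.
    by have := below_repl x k yu; have := Bz k; lia.
  + exists (repl x y u); split; first exact: bumps_rowstep.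
    rewrite eqxx; split; [lia | exact: perm_srt |].
    move=> k zk /=; rewrite below_srt below_cons; have := K k; have := Bz k.+1; lia.
Qed.

Lemma ins_specP x Q : valid Q -> ins_spec x Q (ins x Q).1.1 (ins x Q).1.2 (ins x Q).2.
Proof.
elim: Q x => [|u rest IH] x; first by constructor.
case=> su un du vr /=; case E: [seq e <- u | x < e] => [|y s].
  by apply: InsApp; apply/allP => e /(filter_nil_all E); rewrite -leqNgt.
case: (posnP (below u x.+1)) => [h0|h0] /=.
  have lt (e : nat) : e \in u -> x < e.
    move=> eu; rewrite ltnNge; apply/negP => ex.
    have := below_leq u (ltac:(lia) : e.+1 <= x.+1); have := below_mem u e; rewrite eu; lia.
  have Eu : u = y :: s by rewrite -E; apply/esym/all_filterP/allP.
  by rewrite Eu; apply: InsDiag; rewrite -Eu; apply/allP.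
have bu := filter_bumps su h0 E.
have := IH y vr; case: (ins y rest) => [[R st] t] /= sp.
have [vR _ [v [rs sv]]] := ins_spec_valid sp vr.
have dv := dom_rowstep du bu rs.
case F: [seq z <- _ | _] => [|z s'] /=.
  apply: InsStop sp _ => // k; apply: dom_criterion => e el ek.
  by have := filter_nil_all F el; rewrite -ltnNge.
case: R vR sp sv F => [//|l tl] /= [sl _ _ _] sp sv F.
have [zl hz hmin] := sorted_filter_head sl F.
apply: InsPass sp _ => //; split=> // e el ez.
by rewrite ltnNge; apply/negP => /(hmin e el); lia.
Qed.

Lemma bumps_uniq x u y1 y2 : bumps x u y1 -> bumps x u y2 -> y1 = y2.
Proof. by move=> [_ u1 l1 h1] [_ u2 l2 h2]; have := h1 _ u2; have := h2 _ u1; lia. Qed.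

Lemma ins_spec_eq x Q R st t : ins_spec x Q R st t -> valid Q -> ins x Q = (R, st, t).
Proof.
have bumped u' y' x' : bumps x' u' y' -> sorted leq u' ->
    exists s, [seq e <- u' | x' < e] = y' :: s.
  move=> bu su; case E: [seq e <- u' | x' < e] => [|y2 s].
    by case: bu => _ yu xy _; have := filter_nil_all E yu; rewrite xy.
  have [hx _ _ _] := bu.
  by exists s; rewrite (bumps_uniq (filter_bumps su hx E) bu).
elim=> {x Q R st t} //=.
- move=> x u rest /allP lt _; case E: [seq _ <- _ | _] => [//|y s].
  have := mem_filter (ltn x) y u; rewrite E mem_head => /esym /andP[/= xy /lt /=]; lia.
- move=> x y u rest /andP[xy /allP lt] _; rewrite xy ifF //.
  rewrite below_cons (_ : below u x.+1 = 0); first by lia.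
  by apply/eqP; rewrite -leqn0 leqNgt below_gt0 -all_predC; apply/allP => e /lt /=; lia.
- move=> x u y rest R st t bu _ IH d [su _ _ vr].
  have [s ->] := bumped _ _ _ bu su; have [-> _ _ _] := bu.
  rewrite IH //; case E: [seq _ <- _ | _] => [//|z s'].
  have := mem_filter (fun z => below (repl x y u) z <= below (head [::] R) z.+1) z (head [::] R).
  rewrite E mem_head => /esym /andP[h zR]; have := d z; have := below_mem (head [::] R) z.
  by rewrite zR; lia.
- move=> x u y rest l tl z st t bu sp IH fv [su _ _ vr].
  have [s ->] := bumped _ _ _ bu su; have [-> _ _ _] := bu.
  rewrite IH //=; have [zl hz hmin] := fv.
  have [[sl _ _ _] _ _] := ins_spec_valid sp vr.
  case E: [seq _ <- _ | _] => [|z2 s'].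
    by have := filter_nil_all E zl; rewrite hz.
  have [z2l hz2 hmin2] := sorted_filter_head sl E.
  suff -> : z2 = z by [].
  by have := hmin2 z zl hz; have := hmin z2 z2l; lia.
Qed.

(** Row insertion alone preserves [dom], so a violation can only come from an entry that the column
    phase has moved up into [l]. *)
Lemma ins_pass_state x u y rest l tl z st t : valid (u :: rest) -> bumps x u y ->
  ins_spec y rest (l :: tl) st t -> first_viol (repl x y u) l z ->
  st = (0, true) /\ exists v, [/\ rowstep (head [::] rest) y v, dom (repl x y u) v,
    y < t <= z, perm_eq l (t :: v) & slack t l (head [::] tl)].
Proof.
case=> _ _ du vr bu sp fv; have [_ _ [v [rs]]] := ins_spec_valid sp vr.
have dv := dom_rowstep du bu rs.
case: eqP => [-> [yt pl sk]|_ /= lv]; last by case: (first_viol_not_dom fv); rewrite lv.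
by split=> //; exists v; split=> //; rewrite yt (first_viol_bound fv dv pl).
Qed.

(** In [InsPass] the row that grew hands [z] on, which transfers the growth to the first row. The
    second part keeps marks off the main diagonal. *)
Lemma ins_spec_shape x Q R st t : ins_spec x Q R st t -> valid Q ->
  (forall i, size (nth [::] R i) = size (nth [::] Q i) + (i == st.1)) /\
  (st.2 -> 0 < size (nth [::] Q st.1)).
Proof.
have srepl x' y u : y \in u -> size (repl x' y u) = size u.
  by move=> yu; rewrite size_sort /= size_rem // prednK // -has_predT; apply/hasP; exists y.
elim=> {x Q R st t} /=.
- by move=> x _; split=> // -[|i] //=; rewrite nth_nil.
- by move=> x u rest _ _; split=> // -[|i] /=; rewrite ?size_rcons ?addn0 ?addn1.
- by move=> x y u rest _ _; split=> // -[|i] /=; rewrite ?addn0 ?addn1.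
- move=> x u y rest R st t [_ yu _ _] _ IH _ [_ _ _ vr]; have [h1 h2] := IH vr.
  by split=> // -[|i] /=; rewrite ?srepl ?addn0.
- move=> x u y rest l tl z st t bu sp IH fv vQ.
  have [est _] := ins_pass_state vQ bu sp fv; rewrite {}est in sp IH *.
  have [zl _ _] := fv; have [_ yu _ _] := bu.
  have [_ un _ vr] := vQ; have [h1 h2] := IH vr.
  split; last by move=> _; rewrite lt0n size_eq0.
  case=> [|[|i]] /=; rewrite ?size_sort /= ?srepl ?addn1 //.
  + by have /= := h1 0; rewrite size_rem // => ->; rewrite addn1 addn0.
  + by have /= := h1 i.+1.
Qed.

(** * The prefix condition under insertion *)

Definition lattice (w : seq nat) := forall m k, occ k (take m w) <= (occ k.+1 (take m w)).+1.

Lemma lattice_occ w k : lattice w -> occ k w <= (occ k.+1 w).+1.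
Proof. by move=> h; have := h (size w) k; rewrite take_size. Qed.

Lemma lattice_rcons w x : lattice (rcons w x) <-> lattice w /\ occ x w <= occ x.+1 w.
Proof.
split=> [h|[h hx] m k].
  split=> [m k|].
    case: (leqP m (size w)) => mw; last first.
      by have := h (size w) k; rewrite -cats1 take_size_cat // take_oversize // ltnW.
    by have := h m k; rewrite -cats1 takel_cat.
  have := lattice_occ x h; rewrite !occ_rcons eqxx (ltn_eqF (ltnSn x)); lia.
case: (leqP m (size w)) => mw; first by rewrite -cats1 takel_cat.
rewrite take_oversize ?size_rcons // !occ_rcons.
have := lattice_occ k h; case: (eqVneq x k) => [<-|_]; first by rewrite (ltn_eqF (ltnSn x)); lia.
lia.
Qed.

(** In a sorted row every [k] is read before the first [k + 1], so the letters [k + 1] of the row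
    itself cannot help. *)
Lemma lattice_row w u : sorted leq u ->
  lattice (w ++ u) <-> lattice w /\ forall k, occ k w + occ k u <= (occ k.+1 w).+1.
Proof.
elim/last_ind: u => [_|u x IH].
  rewrite cats0; split=> [h|[]//]; split=> // k.
  by have := h (size w) k; rewrite take_size /occ /= addn0.
rewrite sorted_rcons_leq => /andP[/allP lt su].
have x1 : occ x.+1 u = 0.
  by apply/eqP; rewrite -leqn0 leqNgt occ_gt0; apply/negP => /lt /=; lia.
rewrite -rcons_cat lattice_rcons (IH su) !occ_cat x1 addn0.
have E k := occ_rcons k u x.
split=> [[[h1 h2] h3]|[h1 h2]].
  split=> // k; rewrite E; have := h2 k; case: eqP => [<-|_]; lia.
split; last by have := h2 x; rewrite E eqxx; lia.
split=> // k; have := h2 k; rewrite E; lia.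
Qed.

Definition row_word (Q : seq (seq nat)) := flatten (rev Q).

Lemma row_word_cons u Q : row_word (u :: Q) = row_word Q ++ u.
Proof. by rewrite /row_word rev_cons flatten_rcons. Qed.

Lemma perm_row_word Q : perm_eq (row_word Q) (flatten Q).
Proof. by rewrite perm_sym; apply/perm_flatten; rewrite perm_sym perm_rev. Qed.

Lemma occ_repl x y u k : y \in u -> (y == k) + occ k (repl x y u) = (x == k) + occ k u.
Proof. by move=> yu; have := occ_perm k (perm_repl x yu); rewrite !occ_cons. Qed.

(* All entries under the first row exceed its second entry. *)
Lemma occ_row_word0 u rest k : valid (u :: rest) -> below u k <= 1 -> occ k (row_word rest) = 0.
Proof.
elim: rest u k => [//|l rest IH] u k [_ _ d v] hk.
have hl : below l k.+1 = 0 by have := d k => /=; lia.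
rewrite row_word_cons occ_cat (IH l) //; last by have := below_leq l (leqnSn k); lia.
by have := belowS l k; lia.
Qed.

(** The words [u x] and [y u'], with [u'] the new row, are related by Knuth moves. Only the content
    of [w'] enters, so [w'] can be the reading word of the lower rows after [y] has been inserted
    into them. *)
Lemma lattice_bump w w' x y u : lattice w -> (forall k, occ k w' = (y == k) + occ k w) ->
  bumps x u y ->
  (forall k, occ k w + occ k u <= (occ k.+1 w).+1) /\
    occ x w + occ x u <= occ x.+1 w + occ x.+1 u <->
  occ y w <= occ y.+1 w /\ forall k, occ k w' + occ k (repl x y u) <= (occ k.+1 w').+1.
Proof.
move=> Lw O [hx yu xy gap].
have Y : 0 < occ y u by rewrite occ_gt0.
have Oy : occ y w' = (occ y w).+1 by rewrite O eqxx.
have On k : k <> y -> occ k w' = occ k w by move=> ky; rewrite O; case: eqP => // /esym.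
have Py : (occ y (repl x y u)).+1 = occ y u.
  by have := occ_repl x y yu; rewrite eqxx (ltn_eqF xy).
have Px : occ x (repl x y u) = (occ x u).+1.
  by have := occ_repl x x yu; rewrite eqxx (gtn_eqF xy).
have Pn k : k <> x -> k <> y -> occ k (repl x y u) = occ k u.
  by move=> kx ky; have := occ_repl x k yu; do 2 (case: eqP => [/esym//|_]).
have G k : x < k -> k < y -> occ k u = 0.
  by move=> xk ky; apply: occ0; apply/negP => /gap; lia.
have ny : y.+1 <> y by lia.
have nx : x <> y by lia.
split=> [[h1 h2]|[h2 h1]].
- split; first by have := h1 y; lia.
  move=> k; have := h1 k; case: (eqVneq k y) => [->|/eqP ky].
    rewrite Oy (On _ ny); lia.
  rewrite (On _ ky); case: (eqVneq k.+1 y) => [ky1|/eqP ky1].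
    rewrite ky1 Oy; case: (eqVneq k x) => [->|/eqP kx]; first by rewrite Px; lia.
    rewrite Pn //; lia.
  rewrite (On _ ky1); case: (eqVneq k x) => [kx|/eqP kx]; last by rewrite Pn.
  subst k; rewrite Px; have := G x.+1; lia.
- split; last first.
    have := h1 x; rewrite (On _ nx) Px; case: (eqVneq x.+1 y) => [->|/eqP xy1].
      rewrite Oy; lia.
    rewrite (On _ xy1); have := G x.+1; lia.
  move=> k; have := h1 k; case: (eqVneq k y) => [->|/eqP ky].
    rewrite Oy (On _ ny); lia.
  rewrite (On _ ky); case: (eqVneq k.+1 y) => [ky1|/eqP ky1].
    rewrite ky1 Oy; case: (eqVneq k x) => [->|/eqP kx]; first by rewrite Px; lia.
    rewrite Pn // => h; have := lattice_occ k Lw; rewrite ky1.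
    case: (ltnP x k) => xk; first by rewrite G //; lia.
    lia.
  rewrite (On _ ky1); case: (eqVneq k x) => [kx|/eqP kx]; last by rewrite Pn.
  subst k; rewrite Px; lia.
Qed.

Lemma occ_rem z l k : z \in l -> (z == k) + occ k (rem z l) = occ k l.
Proof. by move=> zl; rewrite (occ_perm k (perm_to_rem zl)) occ_cons. Qed.

Lemma occ_srt k u : occ k (srt u) = occ k u.
Proof. exact/occ_perm/perm_srt. Qed.

(* Moving [z] from row [l] to row [u]; this is not a Knuth move, and it respects the lattice
   condition because [z] is the first violation. *)
Lemma lattice_pass w l u z : first_viol u l z -> below l z.+2 <= below u z.+1 ->
  let A := (forall k, occ k w + occ k l <= (occ k.+1 w).+1) /\
    (forall k, occ k (w ++ l) + occ k u <= (occ k.+1 (w ++ l)).+1) in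
  let B := (forall k, occ k w + occ k (rem z l) <= (occ k.+1 w).+1) /\
    (forall k, occ k (w ++ rem z l) + occ k (srt (z :: u)) <= (occ k.+1 (w ++ rem z l)).+1) in
  (0 < below l z -> A -> B) /\ (B -> A).
Proof.
move=> fv K A B; rewrite {}/A {}/B; have [zl hz _] := fv.
have Rz : (occ z (rem z l)).+1 = occ z l by have := occ_rem z zl; rewrite eqxx.
have Rn k : k <> z -> occ k (rem z l) = occ k l.
  by move=> kz; have := occ_rem k zl; case: eqP => // /esym.
have Sz : occ z (srt (z :: u)) = (occ z u).+1 by rewrite occ_srt occ_cons eqxx.
have Sn k : k <> z -> occ k (srt (z :: u)) = occ k u.
  by move=> kz; rewrite occ_srt occ_cons; case: eqP => // /esym.
have nz : z.+1 <> z by lia.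
split=> [lz|] [a b]; split=> k.
- have := a k; case: (eqVneq k z) => [->|/eqP kz]; [lia | by rewrite Rn].
- have := b k; rewrite !occ_cat; case: (eqVneq k z) => [->|/eqP kz].
    rewrite Sz (Rn _ nz); lia.
  rewrite Sn // (Rn k) //; case: (eqVneq k.+1 z) => [kz1|/eqP kz1]; last by rewrite Rn.
  subst z; have := first_viol_below fv (ltnSn k); have := belowS l k.+1; have := belowS u k.
  have := a k; lia.
- have := a k; case: (eqVneq k z) => [->|/eqP kz]; last by rewrite Rn.
  have := b z; rewrite !occ_cat Sz (Rn _ nz).
  have := belowS l z.+1; have := belowS u z; lia.
- have := b k; rewrite !occ_cat; case: (eqVneq k z) => [->|/eqP kz].
    rewrite Sz (Rn _ nz); lia.
  rewrite Sn // (Rn k) //; case: (eqVneq k.+1 z) => [->|/eqP kz1]; [lia | by rewrite Rn].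
Qed.

Lemma lattice_ins x Q R st t : valid Q -> ins_spec x Q R st t ->
  lattice (rcons (row_word Q) x) <-> lattice (row_word R).
Proof.
move=> vQ H; elim: H vQ => {x Q R st t}.
- by [].
- by move=> x u rest _ _; rewrite !row_word_cons rcons_cat.
(* Here [x] does not occur in the tableau, and the slack 1 makes its first occurrence harmless
   wherever it is read. *)
- move=> x y u rest /= /andP[xy /allP lt] vQ; have [su _ _ vr] := vQ.
  have sx : sorted leq (x :: y :: u) by rewrite /= (ltnW xy).
  have u0 k : k <= x -> occ k (y :: u) = 0.
    move=> kx; apply: occ0; rewrite inE; apply/negP => /predU1P[|/lt /=]; lia.
  have r0 : occ x (row_word rest) = 0.
    apply: (@occ_row_word0 (y :: u)) => //; rewrite (_ : below _ _ = 0) //.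
    apply/eqP; rewrite -leqn0 leqNgt below_gt0; apply/hasPn => e.
    by rewrite inE => /predU1P[->|/lt /=]; lia.
  have X := u0 x (leqnn x).
  rewrite !row_word_cons lattice_rcons !lattice_row // !occ_cat r0 X.
  split=> [[[h1 h2] h3]|[h1 h2]]; split=> //.
  + move=> k; rewrite occ_cons; have := h2 k; case: eqP => [<-|_]; [lia | by []].
  + split=> // k; have := h2 k; rewrite occ_cons; lia.
- move=> x u y rest R st t bu sp IH d' [su un du vr].
  have [vR pR _] := ins_spec_valid sp vr.
  rewrite !row_word_cons lattice_rcons !lattice_row ?sorted_srt // !occ_cat -IH // lattice_rcons.
  have O k : occ k (row_word R) = (y == k) + occ k (row_word rest).
    by rewrite (occ_perm k (perm_row_word R)) (occ_perm k pR) occ_cons (occ_perm k (perm_row_word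
      rest)).
  have B (h : lattice (row_word rest)) := lattice_bump h O bu; tauto.
- move=> x u y rest l tl z st t bu sp IH fv vQ; have [su un du vr] := vQ.
  have [vR pR _] := ins_spec_valid sp vr; have [sl ln dl vtl] := vR.
  have [est [v [rs dv /andP[yt tz] pl sk]]] := ins_pass_state vQ bu sp fv.
  have [_ _ xy _] := bu.
  rewrite !row_word_cons lattice_rcons !lattice_row ?sorted_srt ?sorted_rem // !occ_cat.
  have O k : occ k (row_word tl ++ l) = (y == k) + occ k (row_word rest).
    by rewrite -row_word_cons (occ_perm k (perm_row_word _)) (occ_perm k pR) occ_cons
      (occ_perm k (perm_row_word rest)).
  have B (h : lattice (row_word rest)) := lattice_bump h O bu.
  have K := dom_pass_bound (mem_repl x u y) (ltn_trans xy yt) dv pl (leqW tz).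
  have lz : 0 < below l z.
    have yl : y \in l by rewrite (perm_mem pl) inE (rowstep_mem rs) orbT.
    by have := below_mem l y; rewrite yl; have := below_leq l (leq_trans yt tz); lia.
  have [/(_ lz) P P'] := lattice_pass (row_word tl) fv K.
  move: (IH vr); rewrite lattice_rcons row_word_cons lattice_row //; tauto.
Qed.

(** * Inverse insertion *)

Lemma below0 u k : (forall e : nat, e \in u -> k <= e) -> below u k = 0.
Proof.
move=> h; apply/eqP; rewrite -leqn0 leqNgt below_gt0; apply/hasPn => e /h.
by rewrite /= -leqNgt.
Qed.

Lemma sorted_below_inj u v : sorted leq u -> sorted leq v ->
  (forall k, below u k = below v k) -> u = v.
Proof. by move=> su sv h; apply: sorted_leq_perm_inj => //; apply: below_perm_eq. Qed.

(** Since [y] lies in [v] and [v] fits under [u'], at least two entries of [u'] are smaller than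
    [y]: the largest is the letter to extract, and another one keeps [y] from being diagonal. *)
Lemma unbump u' l y v : sorted leq u' -> rowstep l y v -> dom u' v ->
  exists x u, [/\ sorted leq u, bumps x u y, repl x y u = u' & dom u l].
Proof.
move=> su rs d; have yv := rowstep_mem rs.
have y2 : 1 < below u' y by have := d y; have := below_mem v y; rewrite yv; lia.
have y0 : 0 < y by case: y y2 {rs d yv} => //; rewrite ltnNge -[X in _ <= X]add0n;
  case: below (below_gt0 u' 0) => // n; rewrite /= => /esym/hasP[].
have [x xu [xy ex]] : exists2 x, x \in u' & x <= y.-1 /\ below u' x.+1 = below u' y.
  by have := @below_top u' y.-1; rewrite prednK // => /(_ (ltnW y2)).
have {}xy : x < y by lia.
have R k := below_rem k xu.
have yu : y \in srt (y :: rem x u') by rewrite mem_sort mem_head.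
have U k : (x < k) + below (srt (y :: rem x u')) k = (y < k) + below u' k.
  by rewrite below_srt below_cons; have := R k; lia.
have gap (e : nat) : e \in u' -> e <= x \/ y <= e.
  move=> eu; case: (leqP e x) => [|xe]; [by left | right].
  rewrite leqNgt; apply/negP => ey; have := below_mem u' e; rewrite eu.
  by have := below_leq u' xe; have := below_leq u' ey; lia.
exists x, (srt (y :: rem x u')); split.
- exact: sorted_srt.
- split=> //.
  + by have := U x.+1; lia.
  + move=> e; rewrite mem_sort inE => /predU1P[->|/mem_rem/gap//]; by right.
- apply: sorted_below_inj => //; first exact: sorted_srt.
  by move=> k; have := below_repl x k yu; have := U k; lia.
- have F k : x < k -> k <= y -> below u' k = below u' y.
    by move=> xk ky; apply: below_eq => // e /gap; lia.
  have V := belowS v y; have yv1 : 0 < occ y v by rewrite occ_gt0.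
  have Vk k := below_leq v (_ : k < y).
  move=> k; have Dy := d y; have Dk := d k; have Uk := U k.
  case: rs => [[/allP lt /below_perm p]|[y3 [y3l yy3 gap3 /below_perm p]]].
    have := p k.+1; rewrite below_cons => P.
    case: (ltngtP k y) => ky; last by subst k; lia.
      case: (ltnP x k) => xk; last lia.
      have := below_leq v ky; have := F k xk (ltnW ky); lia.
    lia.
  have := p k.+1; rewrite !below_cons => P.
  case: (ltngtP k y) => ky; last by subst k; lia.
    case: (ltnP x k) => xk; last lia.
    have := below_leq v ky; have := F k xk (ltnW ky); lia.
  lia.
Qed.

(** Corners of the shape; a marked corner must leave its row nonempty, as marks are not allowed on
    the diagonal. *)
Definition removable (R : seq (seq nat)) (st : nat * bool) :=
  let a := size (nth [::] R st.1) in let b := size (nth [::] R st.1.+1) in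
  if st.2 then b.+1 < a else (b.+1 < a) || (a == 1) && (b == 0).

(* Removing from [u] an entry smaller than [k] breaks [dom u l] at [k]. *)
Definition tight u l k := (0 < below l k.+1) && ((below l k.+1).+1 == below u k).

(** Beyond the largest entry of [u] its count is [size u], which is too large for tightness; hence
    the tight indices are bounded. *)
Lemma tight_dec u l : (size l).+1 < size u ->
  (exists2 z, tight u l z & forall k, tight u l k -> k <= z) \/ (forall k, ~~ tight u l k).
Proof.
move=> h; have bnd k : tight u l k -> k <= \max_(e <- u) e.
  case/andP=> _ /eqP E; rewrite leqNgt; apply/negP => uk.
  suff U : below u k = size u by have := below_size l k.+1; lia.
  apply/eqP; rewrite -all_count; apply/allP => e eu.
  by apply: leq_ltn_trans uk; rewrite leq_bigmax_seq.
case: (boolP (has (tight u l) (iota 0 (\max_(e <- u) e).+1))) => [/hasP[k0 _ t0]|/hasPn hn].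
  left; have ex : exists k, tight u l k by exists k0.
  by case: (ex_maxnP ex bnd) => z tz hz; exists z.
right=> k; apply/negP => tk; have := hn k; rewrite mem_iota add0n /= ltnS (bnd k tk) tk.
by move/(_ isT).
Qed.

Lemma sorted_head x u : sorted leq (x :: u) -> forall e, e \in u -> x <= e.
Proof. by rewrite /= (path_sortedE leq_trans) => /andP[/allP]. Qed.

(** If the first entry [x] were repeated, the prefix condition would ask for letters [x + 1] in the
    lower rows. They all lie in the row just below, and there are enough of them to make [x + 1] a
    tight index. *)
Lemma not_tight_head x u R : valid ((x :: u) :: R) -> lattice (row_word ((x :: u) :: R)) ->
  (forall k, ~~ tight (x :: u) (head [::] R) k) -> all (ltn x) u.
Proof.
move=> vR LR nt; have [su _ d vr] := vR.
apply/allP => e eu; rewrite /= ltn_neqAle (sorted_head su eu) andbT; apply/eqP => ex; subst e.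
move: LR; rewrite row_word_cons lattice_row // => -[_ /(_ x)].
have X0 : below (x :: u) x = 0.
  by apply: below0 => e; rewrite inE => /predU1P[->|/(sorted_head su)].
have w0 : occ x (row_word R) = 0 by apply: (@occ_row_word0 (x :: u)) => //; rewrite X0.
have x2 : 1 < occ x (x :: u) by rewrite occ_cons eqxx; have := occ_gt0 x u; rewrite eu; lia.
rewrite w0; case: R vR d vr nt w0 => [|l R] /= vR d vr nt w0; first by rewrite occ_nil; lia.
have lx : below l x.+1 = 0 by have := d x; rewrite X0; lia.
rewrite row_word_cons occ_cat (@occ_row_word0 l) ?lx //.
have := belowS l x.+1; have := belowS (x :: u) x; have := d x.+1; have := nt x.+1.
by rewrite /tight; lia.
Qed.

(** The last clause, a minimality property of [t], is needed by the induction: it shows that the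
    entry [z] which the row above sends down does not precede [t]. *)
Lemma ins_rev R st : valid R -> lattice (row_word R) -> removable R st ->
  exists x Q t, [/\ valid Q, ins_spec x Q R st t & st = (0, true) ->
    forall z l, perm_eq (head [::] R) (z :: l) -> dom l (head [::] (behead R)) ->
      0 < below l z.+1 -> t <= z].
Proof.
move: {2}(size R) (leqnn (size R)) => n.
elim: n R st => [|n IH] [|u' R] [i m] // sR vR LR rm; try by case: m rm;
  rewrite /removable /= !nth_nil.
have [su un d vr] := vR; have LR' : lattice (row_word R).
  by move: LR; rewrite row_word_cons lattice_row // => -[].
(* The new cell is in a lower row: undo the insertion there, then the bump in the first row. *)
case: i rm => [|i] rm; last first.
  have [y [Q [t [vQ sp _]]]] := IH R (i, m) sR vr LR' rm.
  have [_ _ [v [rs hv]]] := ins_spec_valid sp vQ.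
  have dv : dom u' v.
    case: ifP hv => [_ [_ /below_perm p _]|_ <- //] k.
    by have := d k; have := p k.+1; rewrite below_cons; lia.
  have [x [u [su2 bu ru dl]]] := unbump su rs dv.
  exists x, (u :: Q), 0; split=> //.
    by split=> //; case: bu => _ + _ _; case: (u).
  by rewrite -ru; apply: (InsStop bu sp); rewrite ru.
(* An unmarked cell in the first row: its last entry was appended. *)
case: m rm => rm; last first.
  case/lastP: u' sR su un d vR LR rm => [//|u x] sR su _ d vR LR;
    rewrite /removable /= size_rcons => rm.
  have [lt su2] : all (leq^~ x) u /\ sorted leq u by apply/andP; rewrite -sorted_rcons_leq.
  case: (eqVneq u [::]) => [u0|u0].
    suff -> : R = [::] by exists x, [::], x; subst u; split=> //; apply: InsNew.
    case: R vr d rm {IH LR LR' vR sR} => // l R [_ ln _ _] /dom_size /(_ ln).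
    by rewrite size_rcons u0; case: (l) ln.
  exists x, (u :: R), x; split=> //; last exact: InsApp.
  split=> // k; have := d k.
  have -> : below (rcons u x) k = below u k + (x < k).
    by rewrite -cats1 below_cat below_cons addn0.
  case: (ltnP x k) => xk; last lia.
  have -> : below u k = size u.
    by apply/eqP; rewrite -all_count; apply: sub_all lt => e /= /leq_ltn_trans; apply.
  have us : 0 < size u by rewrite lt0n size_eq0.
  have := below_size (head [::] R) k.+1; move: rm; rewrite nth0; lia.
rewrite /removable /= nth0 in rm.
(* A marked cell in the first row. An entry smaller than a tight index cannot leave the row, so the
   largest tight index is the entry to send back down; if there is none, the first entry is the
   inserted letter. *)
have [[z tz zmax]|nt] := tight_dec rm; last first.
  case: u' sR su un d vR LR rm nt => [//|x u] sR su _ d vR LR rm nt.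
  have lt := not_tight_head vR LR nt.
  case: u sR su d vR LR rm nt lt => [|y u] sR su d vR LR rm nt lt; first by move: rm => /=; lia.
  have X k : k <= x -> below (x :: y :: u) k = 0.
    move=> kx; apply: below0 => e; rewrite inE => /predU1P[->//|eu].
    by have /= := allP lt e eu; lia.
  exists x, ((y :: u) :: R), y; split=> //; last first.
  - move=> _ z l /= /below_perm p _ lz; rewrite leqNgt; apply/negP => zy.
    have syu : sorted leq (y :: u) by case/andP: su.
    have u0 : below u z.+1 = 0.
      by apply: below0 => e /(sorted_head syu); apply: leq_trans.
    by have := p z.+1; rewrite !below_cons u0; lia.
  - exact: InsDiag.
  split=> //; first by case/andP: su.
  move=> k; have := d k; have := nt k; rewrite /tight below_cons.
  by have := X k; case: (leqP k x) => kx; rewrite ?below_cons; lia.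
case: R sR vr LR LR' vR d rm tz zmax => [|l'' tl] sR vr LR LR' vR d rm tz zmax.
  by case/andP: tz.
have [sl ln dl vtl] := vr; rewrite /= in d rm tz zmax.
have [l0 /eqP ltz] := andP tz.
have nt k : z < k -> below l'' k.+1 = 0 \/ (below l'' k.+1).+1 < below u' k.
  move=> zk; have := d k; case: (posnP (below l'' k.+1)) => [|p]; first by left.
  by have := zmax k; rewrite /tight p /=; lia.
(* Tightness at [z] and the strict margin at [z + 1] force the count of [u'] to jump at [z]. *)
have zu : z \in u'.
  have := nt z.+1 (ltnSn z); have := below_leq l'' (leqnSn z.+1).
  by have := below_mem u' z; case: (z \in u') => //; lia.
have U k := below_rem k zu.
have L k : below (srt (z :: l'')) k = (z < k) + below l'' k by rewrite below_srt below_cons.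
have zl : z \in srt (z :: l'') by rewrite mem_sort mem_head.
have Eu : srt (z :: rem z u') = u'.
  by apply: sorted_below_inj => //; [exact: sorted_srt | move=> k; rewrite below_srt below_cons].
have El : rem z (srt (z :: l'')) = l''.
  apply: sorted_below_inj => //; first exact/sorted_rem/sorted_srt.
  by move=> k; have := below_rem k zl; rewrite L; lia.
have fv : first_viol (rem z u') (srt (z :: l'')) z.
  split=> //; first by rewrite L; have := U z; lia.
  move=> e el ez; rewrite L; have := U e; have := d e.
  have : e \in l'' by move: el; rewrite mem_sort inE (ltn_eqF ez).
  by rewrite below_mem; lia.
have vl : valid (srt (z :: l'') :: tl).
  split=> //; [exact: sorted_srt | exact: srt_cons_neq0 |].
  by move=> k; have := dl k; rewrite L; lia.
have Ll : lattice (row_word (srt (z :: l'') :: tl)).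
  have K : below (srt (z :: l'')) z.+2 <= below (rem z u') z.+1.
    have := nt z.+1 (ltnSn z); have := below_leq l'' (leqnSn z.+1).
    by have := U z.+1; rewrite L; lia.
  have [_ P] := lattice_pass (row_word tl) fv K.
  move: LR LR'; rewrite El Eu in P; rewrite !row_word_cons !lattice_row ?sorted_srt //; tauto.
have [] := IH (srt (z :: l'') :: tl) (0, true) sR vl Ll.
  rewrite /removable /= size_sort nth0 ltnS.
  case: (tl) dl vtl => [|g s] /=; first by rewrite lt0n size_eq0.
  by move=> dg [_ gn _ _]; apply: dom_size.
move=> y [Q [t [vQ sp bnd]]].
(* The minimality clause applies with [l''], the row left when [z] is removed again. *)
have tz2 : t <= z.
  by apply: (bnd erefl) l0 => //; apply: perm_srt.
have [_ _ [v [rs /= [yt pl sk]]]] := ins_spec_valid sp vQ.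
have dv : dom (rem z u') v.
  move=> k; have := below_perm k.+1 pl; rewrite L below_cons; have := U k; have := d k.
  by have := nt k; case: (ltngtP z k) => zk; [lia | lia | subst k; lia].
have [x [u [su2 bu ru du]]] := unbump (sorted_rem z su) rs dv.
exists x, (u :: Q), z; split.
- by split=> //; case: bu => _ + _ _; case: (u).
- have -> : [:: u', l'' & tl] = srt (z :: repl x y u) :: rem z (srt (z :: l'')) :: tl.
    by rewrite ru Eu El.
  by apply: (InsPass bu sp); rewrite ru.
(* Removing a smaller entry would break [dom] at the tight index [z]. *)
- move=> _ z2 l2 /= /below_perm p d2 l2z; rewrite leqNgt; apply/negP => z2z.
  have := p z; rewrite below_cons z2z; have := d2 z; lia.
Qed.

End RowInsertion.

(** * Injectivity of insertion and comparison of successive insertions *)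

Section InsertionPairs.

Implicit Types (u v l w r : seq nat) (x y z t e k i : nat) (Q R : seq (seq nat)) (st : nat * bool).

(** The displacing letter is the largest entry of the new row that is smaller than [y]. *)
Lemma bumps_inj x1 x2 u1 u2 y : sorted leq u1 -> sorted leq u2 ->
  bumps x1 u1 y -> bumps x2 u2 y -> repl x1 y u1 = repl x2 y u2 -> x1 = x2 /\ u1 = u2.
Proof.
have mem_other x u x' : y \in u -> x < x' -> x' \in repl x y u -> x' \in u.
  by move=> yu xx'; rewrite mem_sort inE => /predU1P[ex|/mem_rem//]; lia.
move=> s1 s2 [_ yu1 xy1 g1] [_ yu2 xy2 g2] E.
have E12 : x1 = x2.
  case: (ltngtP x1 x2) => // h.
  - by have := mem_other _ _ _ yu1 h; rewrite E mem_repl => /(_ isT) /g1; lia.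
  - by have := mem_other _ _ _ yu2 h; rewrite -E mem_repl => /(_ isT) /g2; lia.
subst x2; split=> //; apply: sorted_below_inj => // k.
by have := below_repl x1 k yu1; have := below_repl x1 k yu2; rewrite E; lia.
Qed.

(** For a marked cell in the first row, tightness in the result tells the two possible origins
    apart, and [tight] with [slack] identifies [z] as the largest tight index. Thus the result alone
    determines the case. *)
Lemma ins_spec_inv x Q r R i m t : ins_spec x Q (r :: R) (i, m) t -> valid Q ->
  if i is i'.+1 then
    exists u y Q' t', [/\ Q = u :: Q', bumps x u y, ins_spec y Q' R (i', m) t'
                       & r = repl x y u]
  else if m then
    (exists u, [/\ Q = u :: R, r = x :: u & forall k, ~~ tight r (head [::] R) k]) \/
    exists u y Q' l tl z t', [/\ [/\ Q = u :: Q', bumps x u y, ins_spec y Q' (l :: tl) (0, true) t'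
                       & r = srt (z :: repl x y u)],
        [/\ R = rem z l :: tl, sorted leq l & z \in l],
        tight r (head [::] R) z & slack z r (head [::] R)]
  else (Q = [::] /\ r :: R = [:: [:: x]]) \/
    exists u, [/\ Q = u :: R, r = rcons u x & u != [::]].
Proof.
move E : (r :: R) => R0; move F : (i, m) => st H vQ.
have [_ _ T] := ins_spec_valid H vQ.
case: H E F vQ T => {Q R0 st t}.
- by move=> [-> ->] [-> ->] _ _; left.
- by move=> u rest _ [-> ->] [-> ->] [_ ? _ _] _; right; exists u.
- move=> y u rest /= /andP[xy lt] [-> ->] [-> ->] [su _ d _] _; left; exists (y :: u); split=> // k.
  rewrite /tight negb_and -eqn0Ngt; case: (d k) => [->//|h].
  have : y < k.
    rewrite ltnNge; apply/negP => ky; suff : below (y :: u) k = 0 by lia.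
    apply: below0 => e; rewrite inE => /predU1P[->//|/(sorted_head su)]; exact: leq_trans.
  rewrite [below (x :: _) _]below_cons; lia.
- move=> u y rest R0 [i' m'] t bu sp d [-> ->] [-> ->] _ _.
  by exists u, y, rest, t.
- move=> u y rest l tl z st t bu sp fv [-> ->] [-> ->] vQ T; right.
  have [est [v [rs dv /andP[yt tz] pl sk]]] := ins_pass_state vQ bu sp fv.
  have [su un du vr] := vQ; have [vR pR _] := ins_spec_valid sp vr; have [sl ln dl vtl] := vR.
  have [zl hz _] := fv; have [_ yu xy _] := bu.
  exists u, y, rest, l, tl, z, t; rewrite {}est in sp; split=> //=; last first.
    by case: T => v' [_ /= []].
  rewrite /tight below_srt below_cons ltnn add0n.
  have yl : y \in l by rewrite (perm_mem pl) inE (rowstep_mem rs) orbT.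
  have K := dom_pass_bound (mem_repl x u y) (ltn_trans xy yt) dv pl tz.
  have := below_rem z.+1 zl; rewrite ltnSn => B.
  have := below_rem z zl; rewrite ltnn => B0.
  have := below_mem l y; rewrite yl; have := below_leq l (leq_trans yt tz).
  have := below_leq (rem z l) (leqnSn z); lia.
Qed.

Lemma ins_inj x1 x2 Q1 Q2 R st t1 t2 : ins_spec x1 Q1 R st t1 -> ins_spec x2 Q2 R st t2 ->
  valid Q1 -> valid Q2 -> x1 = x2 /\ Q1 = Q2.
Proof.
have [n] := ubnP (size R); elim: n R st x1 x2 Q1 Q2 t1 t2 => // n IH.
case=> [|r R] [i m] x1 x2 Q1 Q2 t1 t2 sR H1 H2 v1 v2; first by inversion H1.
have := ins_spec_inv H1 v1; have := ins_spec_inv H2 v2; case: i {H1 H2} => [|i]; last first.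
  move=> [u2 [y2 [Q2' [t2' [E2 bu2 H2 r2]]]]] [u1 [y1 [Q1' [t1' [E1 bu1 H1 r1]]]]].
  subst Q1 Q2; have [su1 _ _ vr1] := v1; have [su2 _ _ vr2] := v2.
  have [Ey EQ] := IH R _ _ _ _ _ _ _ sR H1 H2 vr1 vr2; subst y2 Q2'.
  by have [-> ->] := bumps_inj su1 su2 bu1 bu2 (etrans (esym r1) r2).
case: m.
  case=> [[u2 [E2 r2 nt2]]|[u2 [y2 [Q2' [l2 [tl2 [z2 [t2' [[E2 bu2 H2 r2] [R2 sl2 zl2] tz2
    sk2]]]]]]]]].
    case=> [[u1 [E1 r1 nt1]]|[u1 [y1 [Q1' [l1 [tl1 [z1 [t1' [_ _ tz1 _]]]]]]]]].
      by move: r2; rewrite E1 E2 r1 => -[-> ->].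
    by have := nt2 z1; rewrite tz1.
  case=> [[u1 [E1 r1 nt1]]|[u1 [y1 [Q1' [l1 [tl1 [z1 [t1' [[E1 bu1 H1 r1] [R1 sl1 zl1] tz1
    sk1]]]]]]]]].
    by have := nt1 z2; rewrite tz2.
  have Ez : z1 = z2.
    have aux z z' : tight r (head [::] R) z -> slack z' r (head [::] R) -> z <= z'.
      by move=> /andP[p /eqP q] s; rewrite leqNgt; apply/negP => /s; lia.
    by have := aux _ _ tz1 sk2; have := aux _ _ tz2 sk1; lia.
  subst z2; move: R2; rewrite R1 => -[El Etl]; subst tl2.
  have {}El : l1 = l2.
    apply: sorted_below_inj => // k; have := below_rem k zl1; rewrite El.
    by have := below_rem k zl2; lia.
  subst l2 Q1 Q2; have [su1 _ _ vr1] := v1; have [su2 _ _ vr2] := v2.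
  have s12 : size (l1 :: tl1) < n by move: sR; rewrite R1.
  have [Ey EQ] := IH _ _ _ _ _ _ _ _ s12 H1 H2 vr1 vr2; subst y2 Q2'.
  have Er : repl x1 y1 u1 = repl x2 y1 u2.
    apply: sorted_below_inj; try exact: sorted_srt.
    by move=> k; have := congr1 (below^~ k) (etrans (esym r1) r2);
      rewrite /= !below_srt !(below_cons z1) !below_srt; lia.
  by have [-> ->] := bumps_inj su1 su2 bu1 bu2 Er.
case=> [[E2 [r2 R2]]|[u2 [E2 r2 n2]]]; case=> [[E1 [r1 R1]]|[u1 [E1 r1 n1]]].
- by rewrite E1 E2; move: r2; rewrite r1 => -[->].
- by move: n1 r1; rewrite r2; case: (u1) => [//|a [|b s]].
- by move: n2 r2; rewrite r1; case: (u2) => [//|a [|b s]].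
- by rewrite E1 E2; move: r2; rewrite r1 => /rcons_inj[-> ->].
Qed.

Variant ins_cases x u Q R st t : Prop :=
| CaseApp of all (leq^~ x) u & R = rcons u x :: Q & st = (0, false)
| CaseDiag of all (ltn x) u & u <> [::] & R = (x :: u) :: Q & st = (0, true) & t = head 0 u
| CaseStop y R' st' t' of bumps x u y & ins_spec y Q R' st' t' & dom (repl x y u) (head [::] R') &
    R = repl x y u :: R' & st = (st'.1.+1, st'.2)
| CasePass y l tl t' v of bumps x u y & ins_spec y Q (l :: tl) (0, true) t' &
    first_viol (repl x y u) l t & R = srt (t :: repl x y u) :: rem t l :: tl & st = (0, true) &
    rowstep (head [::] Q) y v & dom (repl x y u) v & perm_eq l (t' :: v) & y < t' <= t.

Lemma ins_casesP x u Q R st t : ins_spec x (u :: Q) R st t -> valid (u :: Q) ->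
  ins_cases x u Q R st t.
Proof.
move E : (u :: Q) => Q0 H vQ; case: H E vQ => {Q0 R st t} //.
- by move=> u' rest lt [-> ->] _; apply: CaseApp.
- by move=> y u' rest lt [-> ->] _; apply: CaseDiag.
- by move=> u' y rest R st t bu sp d [-> ->] _; exact: (CaseStop 0 bu sp d (erefl _) (erefl _)).
- move=> u' y rest l tl z st t bu sp fv [-> ->] vQ.
  have [est [v [rs dv yt pl sk]]] := ins_pass_state vQ bu sp fv; rewrite est in sp.
  exact: (CasePass bu sp fv (erefl _) (erefl _) rs dv pl yt).
Qed.

(** The order in which the cells of one label are filled in a marked tableau: marked cells first,
    going strictly down, then unmarked cells, going weakly up. *)
Definition le_step st st' :=
  if st.2 then ~~ st'.2 || (st.1 < st'.1) else ~~ st'.2 && (st'.1 <= st.1).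

Lemma ins_bumped_le x Q R t : ins_spec x Q R (0, true) t -> valid Q ->
  exists2 y, y \in head [::] Q & x < y <= t.
Proof.
case: Q => [|u Q] H vQ; first by inversion H.
case: (ins_casesP H vQ) => //.
- move=> lt un _ _ ->; case: u un lt {H vQ} => // y u _ /= /andP[xy _].
  by exists y; rewrite ?mem_head ?xy /=.
- move=> y l tl t' v [_ yu xy _] _ _ _ _ _ _ _ h; exists y => //=; lia.
Qed.

(** From [t] on, [v] counts as many entries as [l0], because the entry bumped out of [l0] is at most
    [e]; the slack then absorbs [t]. So the column phase stops below [u]. *)
Lemma slack_dom s u l0 x y v l t e : slack s u l0 -> bumps x u y -> rowstep l0 y v ->
  dom (repl x y u) v -> s < t -> e \in l0 -> y < e <= t -> perm_eq l (t :: v) ->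
  dom (repl x y u) l.
Proof.
move=> sk [_ yu xy _] rs d st el /andP[ye et] /below_perm p k.
have := d k; have := p k.+1; rewrite below_cons; have := sk k.
have B := below_repl x k yu; case: (ltnP k t) => kt; first lia.
have : 0 < below l0 k.+1.
  by have := below_mem l0 e; rewrite el; have := @below_leq l0 e.+1 k.+1; lia.
suff : below v k.+1 = below l0 k.+1 by lia.
case: rs => [[/allP /(_ e el) /=]|[y2 [y2l yy2 gap /below_perm q]]]; first lia.
by have := q k.+1; rewrite !below_cons; have := gap e el; lia.
Qed.

(** This transfers information from [l] to [l'], the row left after [z] has moved up. The two rows
    have the same counts up to [z], so a row phase displaces the same entry from both and meets a
    violation in both. *)
Lemma ins_desc_pass x y l l' tl z R2 st2 t2 R3 t3 :
  valid (l :: tl) -> valid (l' :: tl) -> perm_eq l (z :: l') -> y \in l' -> x < y -> y < z ->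
  ins_spec x (l :: tl) R3 (0, true) t3 -> t3 <= z -> ins_spec x (l' :: tl) R2 st2 t2 ->
  below l' z.+1 < below (head [::] R2) z.+1.
Proof.
move=> vl vl' p yl' xy yz H3 t3z H2.
have B k : below l k = (z < k) + below l' k by rewrite (below_perm _ p) below_cons.
have yl : y \in l by rewrite (perm_mem p) inE yl' orbT.
have [_ _ _ vtl] := vl.
case: (ins_casesP H2 vl') => [/allP /(_ y yl') /=|_ _ -> _ _|y2 R' st' t' bu sp d -> _|y2 l2 tl2
  t' v bu sp fv -> _ _ _ _ yt'].
- lia.
- by rewrite below_cons /=; lia.
- case: (ins_casesP H3 vl) => // [lt _ _ _ _|y3 l3 tl3 t3' v bu3 sp3 fv3 _ _ _ _ _ yt3].
    case: bu => h _ _ _; have [e el [ex _]] := below_top h.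
    by have /= := allP lt e; rewrite (perm_mem p) inE el orbT => /(_ isT); lia.
  have E : y2 = y3.
    have [_ y2l xy2 g2] := bu; have [_ y3l xy3 g3] := bu3.
    have := g3 y2; rewrite (perm_mem p) inE y2l orbT => /(_ isT).
    have := g3 y yl; move: y3l; rewrite (perm_mem p) inE => /predU1P[|/g2]; lia.
  subst y3; have [ER _ _] : (R', st', t') = (l3 :: tl3, (0, true), t3').
    by rewrite -(ins_spec_eq sp vtl) -(ins_spec_eq sp3 vtl).
  subst R'; have [z3l h3 _] := fv3; have := d t3; have := below_mem l3 t3; rewrite z3l /=.
  have [_ y2l _ _] := bu; have [_ y2l' _ _] := bu3.
  by have := below_repl x t3 y2l; have := below_repl x t3 y2l'; have := B t3; lia.
- case: (ins_casesP H3 vl) => // [lt _ _ _ _|y3 l3 tl3 t3' v3 bu3 sp3 fv3 _ _ _ _ _ yt3].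
    case: bu => h _ _ _; have [e el [ex _]] := below_top h.
    by have /= := allP lt e; rewrite (perm_mem p) inE el orbT => /(_ isT); lia.
  have E : y2 = y3.
    have [_ y2l xy2 g2] := bu; have [_ y3l xy3 g3] := bu3.
    have := g3 y2; rewrite (perm_mem p) inE y2l orbT => /(_ isT).
    have := g3 y yl; move: y3l; rewrite (perm_mem p) inE => /predU1P[|/g2]; lia.
  subst y3; have [El _ _] : (l2 :: tl2, (0, true), t') = (l3 :: tl3, (0, true), t3').
    by rewrite -(ins_spec_eq sp vtl) -(ins_spec_eq sp3 vtl).
  subst l3; have [z3l h3 _] := fv3; have [_ y2l xy2 g2] := bu; have [_ y2l' _ _] := bu3.
  have tz : t2 <= t3.
    rewrite leqNgt; apply/negP => h; have := first_viol_below fv h.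
    have := below_mem l2 t3; rewrite z3l.
    by have := below_repl x t3 y2l; have := below_repl x t3 y2l'; have := B t3; lia.
  rewrite /= below_srt below_cons; have := below_repl x z.+1 y2l.
  by have := g2 y yl'; lia.
Qed.

Lemma bumps_not_app x u y : bumps x u y -> ~ all (leq^~ x) u.
Proof. by case=> _ yu xy _ /allP /(_ y yu) /=; lia. Qed.

Lemma bumps_not_diag x u y : bumps x u y -> ~ all (ltn x) u.
Proof.
by case=> h _ _ _ /allP lt; have [e eu [ex _]] := below_top h; have /= := lt e eu; lia.
Qed.

(* [le_step] compares the cells added by two successive insertions the way the standardization
   order of marked tableaux does. *)
Definition desc_ok x x' st t st' t' :=
  (x <= x') = le_step st st' /\ (x' < x -> st = (0, true) -> st' = (0, true) /\ t' <= t).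

Lemma ins_desc_app x x' u Q R' st' t' : valid (rcons u x :: Q) ->
  ins_spec x' (rcons u x :: Q) R' st' t' -> desc_ok x x' (0, false) x st' t'.
Proof.
move=> vQ H; rewrite /desc_ok /le_step; split; last by [].
have xu : x \in rcons u x by rewrite mem_rcons mem_head.
have [su _ _ _] := vQ; move: su; rewrite sorted_rcons_leq => /andP[/allP lt _].
have nx y : bumps x' (rcons u x) y -> (x <= x') = false.
  move=> bu; apply/negbTE/negP => xx'; apply: (bumps_not_app bu); apply/allP => e.
  by rewrite mem_rcons inE => /predU1P[->//|/lt /=]; lia.
case: (ins_casesP H vQ) => /= [/allP /(_ x xu) /= -> _ -> //|/allP /(_ x xu) /= h _ _ -> _|
  y R0 st0 t0 /nx -> _ _ _ ->|y l tl t0 v /nx -> _ _ _ -> _ _ _ _] //=.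
- by rewrite leqNgt h.
- by rewrite andbF.
Qed.

(** Induction on the rows: when both insertions displace an entry, the displaced entries are
    compared in place of the letters. The second clause of [desc_ok] follows the column phase
    through the rows. *)
Lemma ins_desc x x' Q R st t R' st' t' : valid Q -> ins_spec x Q R st t ->
  ins_spec x' R R' st' t' -> desc_ok x x' st t st' t'.
Proof.
elim: Q x x' R st t R' st' t' => [|u Q IH] x x' R st t R' st' t' vQ H1 H2.
  have vR : valid [:: [:: x]] by split=> //; left.
  by inversion H1; subst; apply: (@ins_desc_app t x' [::] [::] R' st' t').
have [vR _ T] := ins_spec_valid H1 vQ.
have [su un du vr] := vQ.
case: (ins_casesP H1 vQ) => [lt ER Est|lt un' ER Est Et|y R1 st1 t1 bu sp1 d1 ER Est|
    y l tl t1 v bu sp1 fv ER Est rs dv pl /andP[yt tz]]; subst R st.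
- rewrite (_ : t = x); last by inversion H1; subst => //; case: (bumps_not_app H3).
  exact: ins_desc_app vR H2.
(* After a diagonal displacement the first row has slack beyond [x], so the second insertion cannot
   end by moving an entry up into it. *)
- have sk : slack x (x :: u) (head [::] Q).
    by move=> k xk; have := du k; rewrite below_cons; lia.
  rewrite /desc_ok /le_step /=;
    case: (ins_casesP H2 vR) => [lt' _ -> | lt' _ _ -> -> | y' R0 st0 t0 bu' _ _ _ -> |
      y' l tl t0 v bu' sp' fv' _ -> rs dv pl /andP[yt' tz']] /=.
  + by move/andP: lt' => [/= xx' _]; rewrite xx'; split=> //; lia.
  + move/andP: lt' => [/= x'x lt']; split; first by rewrite leqNgt x'x.
    move=> _ _; split=> //; rewrite Et; case: (u) un' lt => //= a s _ /andP[/ltnW].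
    by [].
  + have xx' : x <= x' by rewrite leqNgt; apply/negP => h; apply: (bumps_not_diag bu');
    apply/andP; split=> //; apply/allP => e /(allP lt) /=; lia.
    by rewrite xx'; split=> //; lia.
  + case: (first_viol_not_dom fv').
    have [e el yet] := ins_bumped_le sp' vr.
    have xx' : x <= x'.
      rewrite leqNgt; apply/negP => h; apply: (bumps_not_diag bu'); apply/andP; split=> //.
      by apply/allP => e' /(allP lt) /=; lia.
    by apply: (slack_dom sk bu' rs dv _ el yet pl); case: bu' => _ _ + _; lia.
- have [sr _ dr vR1] := vR;
  have xr := mem_repl x u y; have [_ yu xy gap] := bu.
  have rmem e : e \in repl x y u -> e = x \/ e \in u.
    by rewrite mem_sort inE => /predU1P[|/mem_rem]; [left|right].
  rewrite /desc_ok /=; split=> //.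
  case: (ins_casesP H2 vR) => [/allP lt' _ -> | /allP lt' _ _ -> _ | y' R0 st0 t0 bu' sp2 _ _ -> |
      y' l tl t0 v bu' sp2 fv' _ -> rs dv pl yt'].
  + by rewrite /le_step /= leq0n; case: (st1.2); rewrite (lt' x xr).
  + by have /= := lt' x xr; rewrite ltnNge => /negbTE ->; rewrite /le_step /=; case: (st1.2).
  + have [E _] := IH _ _ _ _ _ _ _ _ vr sp1 sp2; rewrite /le_step /= !ltnS -/(le_step st1 st0) -E.
    have [_ y'r x'y' gap'] := bu'.
    by have := rmem y' y'r; have := gap y'; have := gap' x xr; lia.
  + have [E _] := IH _ _ _ _ _ _ _ _ vr sp1 sp2.
    have -> : (x <= x') = (y <= y').
      have [_ y'r x'y' gap'] := bu'.
      by have := rmem y' y'r; have := gap y'; have := gap' x xr; lia.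
    by rewrite E /le_step /= !ltn0; case: (st1.2).
(* The hard case: the second insertion meets the rows [rem t l :: tl], whereas the induction
   hypothesis speaks of [l :: tl]. *)
- have [sr _ dr vR1] := vR; have [_ pR1 T1] := ins_spec_valid sp1 vr.
  have [vl _ _] := ins_spec_valid sp1 vr.
  have [yu xy gap] : [/\ y \in u, x < y & forall e, e \in u -> e <= x \/ y <= e] by case: bu.
  have xr : x \in srt (t :: repl x y u) by rewrite mem_sort inE mem_repl orbT.
  have rmem (e : nat) : e \in srt (t :: repl x y u) -> e = x \/ e = t \/ e \in u.
    rewrite mem_sort inE => /predU1P[->|]; first by right; left.
    by rewrite mem_sort inE => /predU1P[|/mem_rem]; [left|right; right].
  have [v1 [_ /= [_ _ sk]]] := T.
  have [tl1 _ _] := fv.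
  have yl : y \in rem t l.
    have : y \in l by rewrite (perm_mem pl) inE (rowstep_mem rs) orbT.
    by rewrite (perm_mem (perm_to_rem tl1)) inE => /predU1P[E|//]; move: yt tz; rewrite E; clear;
      lia.
  have ymon y' : bumps x' (srt (t :: repl x y u)) y' -> (x <= x') = (y <= y') /\ (x' < x -> y' <=
    x).
    move=> [_ y'r x'y' gap']; have yt1 : y < t := leq_trans yt tz.
    case: (leqP x x') => h; last first.
      have y'x : y' <= x by case: (gap' x xr) => //; rewrite leqNgt h.
      by split=> //; apply/esym/negbTE; rewrite -ltnNge (leq_ltn_trans y'x).
    split; last by [].
    case: (rmem y' y'r) => [E|[->|/gap [E|->//]]]; last 2 first.
    - by rewrite (ltnW yt1).
    - by have := leq_ltn_trans h x'y'; rewrite ltnNge E.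
    by have := leq_ltn_trans h x'y'; rewrite E ltnn.
  have tight_t : below (srt (t :: repl x y u)) t <= (below (rem t l) t.+1).+1.
    by move: (below_rem t.+1 tl1); case: fv => _ + _; rewrite below_srt below_cons; clear; lia.
  have pl' := perm_to_rem tl1.
  rewrite /desc_ok /le_step /=.
  case: (ins_casesP H2 vR) => [/allP lt' _ -> | /allP lt' _ _ -> Et' | y' R0 st0 t0 bu' sp2 d2 _
    -> |
      y' l2 tl2 t2 v2 bu' sp2 fv' _ -> rs2 dv2 pl2 /andP[yt2 tz2]] /=.
  + by have /= xx' := lt' x xr; rewrite xx'; split=> // x'x; move: xx'; rewrite leqNgt x'x.
  + have /= x'x := lt' x xr; rewrite leqNgt x'x; split=> // _ _; split=> //.
    have tr : t \in srt (t :: repl x y u) by rewrite mem_sort mem_head.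
    rewrite Et'; case: (srt _) sr tr => //= a s;
      rewrite (path_sortedE leq_trans) => /andP[/allP h _].
    by rewrite inE => /predU1P[->|/h].
  + have [E1 E2] := ymon _ bu'; have xx' : x <= x'.
      rewrite leqNgt; apply/negP => x'x; have y'y : y' < y := leq_ltn_trans (E2 x'x) xy.
      have [_ D] := IH _ _ _ _ _ _ _ _ vr sp1 (ins_specP y' vl).
      have [e3 t3] := D y'y erefl.
      have := ins_specP y' vl; rewrite e3 => sp3.
      have := ins_desc_pass vl vR1 pl' yl y'y (leq_trans yt tz) sp3 (leq_trans t3 tz) sp2.
      have [_ y'r x'y' _] := bu'; move: (d2 t) (below_repl x' t y'r) tight_t => /=.
      have y't : y' < t := ltn_trans y'y (leq_trans yt tz).
      by rewrite y't (ltn_trans x'y' y't); clear; lia.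
    by rewrite xx' ltn0Sn orbT; split=> // x'x; move: xx'; rewrite leqNgt x'x.
  + have [E1 E2] := ymon _ bu'; rewrite E1; case: (leqP y y') => yy'.
      case: (first_viol_not_dom fv').
      have [e el yet] := ins_bumped_le sp2 vR1.
      apply: (slack_dom sk bu' rs2 dv2 _ el yet pl2).
      (* If [t2 <= t], inserting [y'] into [l :: tl] would also pass [t2] up. Two marked cells in
         the same row are not in order for [le_step], so the induction hypothesis contradicts
         [y <= y']. *)
      rewrite ltnNge; apply/negP => t2t.
      case: (ins_casesP sp2 vR1) => // [/allP /(_ y yl) /=|y2 l3 tl3 t3 v3 bu3 sp3 fv3 _ _ rs3 dv3
        pl3 yt3];
        first by rewrite ltnNge yy'.
      have [h3 y2l y'y2 gap2] := bu3.
      have inl (e' : nat) : e' \in rem t l -> e' \in l by move/mem_rem.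
      have bu4 : bumps y' l y2.
        split=> //; [|exact: inl|].
          have : below l y < below l y.+1 by rewrite -below_mem inl.
          by have := @below_leq l y.+1 y'.+1 yy'; clear; lia.
        move=> e'; rewrite (perm_mem pl') inE => /predU1P[->|/gap2 //]; right.
          by case/andP: yt3 t2t; clear; lia.
      have B k := below_rem k tl1.
      have P k := below_repl y' k y2l.
      have P' k := below_repl y' k (inl _ y2l).
      have fv4 : first_viol (repl y' y2 l) l3 t2.
        have [m1 m2 m3] := fv3; split=> //.
          by move: (B t2) (P t2) (P' t2) m2 t2t; clear; lia.
        by move=> e' e'l e't; move: (m3 _ e'l e't) (B e') (P e') (P' e'); clear; lia.
      have [E3 _] := IH _ _ _ _ _ _ _ _ vr sp1 (InsPass bu4 sp3 fv4).
      by move: E3; rewrite yy'.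
    split=> // x'x _; split=> //.
    have [_ D] := IH _ _ _ _ _ _ _ _ vr sp1 (ins_specP y' vl).
    have [e3 t3] := D yy' erefl.
    have := ins_specP y' vl; rewrite e3 => sp3.
    have h := ins_desc_pass vl vR1 pl' yl yy' (leq_trans yt tz) sp3 (leq_trans t3 tz) sp2.
    rewrite leqNgt; apply/negP => tt'; have := first_viol_below fv' tt'.
    have [_ y'r x'y' _] := bu'; move: (below_repl x' t y'r) h tight_t => /=.
    have y't : y' < t := ltn_trans yy' (leq_trans yt tz).
    by rewrite y't (ltn_trans x'y' y't); clear; lia.
Qed.

End InsertionPairs.

(** * Shifted insertion of a word *)

Section InsertWord.

Variables (B : eqType) (ltb : rel B).
Implicit Types (w : seq (B * nat)) (s : seq ((B * bool) * nat)) (i k m : nat).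

Definition word_le (p q : B * nat) := ltb p.1 q.1 || (p.1 == q.1) && (p.2 <= q.2).

Definition step_le (p q : (B * bool) * nat) :=
  ltb p.1.1 q.1.1 || (p.1.1 == q.1.1) && le_step (p.2, p.1.2) (q.2, q.1.2).

Definition row_count i (T : Type) (s : seq (T * nat)) := count (fun p => p.2 == i) s.

(* Steps carry row numbers starting from 1. *)
Definition step_path s :=
  [/\ forall p, p \in s -> 0 < p.2,
      forall m i, 0 < i -> row_count i.+1 (take m s) = 0 \/
                     row_count i.+1 (take m s) < row_count i (take m s)
    & forall m b i, m < size s -> ohead (drop m s) = Some (b, true, i) ->
        0 < row_count i (take m s)].

Definition ins_step (S : seq (seq nat) * seq ((B * bool) * nat)) (p : B * nat) :=
  let r := ins p.2 S.1 in (r.1.1, rcons S.2 (p.1, r.1.2.2, r.1.2.1.+1)).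

Definition ins_word w := foldl ins_step ([::], [::]) w.

Lemma ins_word_rcons w p : ins_word (rcons w p) = ins_step (ins_word w) p.
Proof. by rewrite /ins_word foldl_rcons. Qed.

Lemma row_count_rcons i (T : Type) (s : seq (T * nat)) p :
  row_count i (rcons s p) = row_count i s + (p.2 == i).
Proof. by rewrite /row_count -cats1 count_cat /= addn0. Qed.

Lemma step_path_rcons s b (m : bool) i : step_path s -> 0 < i -> (m -> 0 < row_count i s) ->
  (forall j, 0 < j -> row_count j.+1 (rcons s (b, m, i)) = 0 \/
    row_count j.+1 (rcons s (b, m, i)) < row_count j (rcons s (b, m, i))) ->
  step_path (rcons s (b, m, i)).
Proof.
move=> [h1 h2 h3] i0 hm hr; split.
- by move=> p; rewrite mem_rcons inE => /predU1P[->|/h1].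
- move=> k j j0; case: (leqP k (size s)) => ks; first by rewrite -cats1 takel_cat //; apply: h2.
  by rewrite take_oversize ?size_rcons //; apply: hr.
- move=> k c j; rewrite size_rcons ltnS leq_eqVlt => /predU1P[->|ks].
    by rewrite -cats1 drop_size_cat // take_size_cat //= => -[_ em <-]; apply: hm; rewrite em.
  rewrite -cats1 drop_cat ks (takel_cat _ (ltnW ks)); move: (h3 k c j ks).
  have : drop k s != [::] by rewrite -size_eq0 size_drop subn_eq0 -ltnNge.
  by case: (drop k s) => //= a l _; apply.
Qed.

Definition state_ok (S : seq (seq nat) * seq ((B * bool) * nat)) :=
  [/\ valid S.1, lattice (row_word S.1), step_path S.2 &
      forall i, row_count i.+1 S.2 = size (nth [::] S.1 i)].

Lemma valid_sizes R i : valid R -> size (nth [::] R i.+1) = 0 \/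
  size (nth [::] R i.+1) < size (nth [::] R i).
Proof.
elim: R i => [|u R IH] i; first by left; rewrite nth_nil.
case=> _ _ d v; case: i => [|i] /=; last exact: IH.
rewrite nth0; case: (eqVneq (head [::] R) [::]) => [->|h]; first by left.
by right; apply: dom_size.
Qed.

Lemma state_ok_nil : state_ok ([::], [::]).
Proof.
split=> //=; last by move=> i; rewrite nth_nil.
by split=> // m i _; left.
Qed.

Lemma state_ok_ins S p : state_ok S -> lattice (rcons (row_word S.1) p.2) -> state_ok (ins_step S
  p).
Proof.
case: S p => [Q s] [b x] [/= vQ LQ ps cs] Lx.
have sp := ins_specP x vQ; move: sp; rewrite /ins_step /=.
case: (ins x Q) => [[R [i m]] t] /= sp.
have [vR pR _] := ins_spec_valid sp vQ; have [hs hm] := ins_spec_shape sp vQ.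
have cR j : row_count j.+1 (rcons s (b, m, i.+1)) = size (nth [::] R j).
  by rewrite row_count_rcons /= hs cs eqSS eq_sym.
split=> //=; first exact/(lattice_ins vQ sp).
apply: step_path_rcons => //; first by rewrite cs.
by case=> // j _; rewrite !cR; apply: valid_sizes.
Qed.

(** The inequality for the last letter depends only on the content of what precedes, so a word may
    be replaced by the reading word of its insertion tableau. *)
Lemma lattice_perm (w v : seq nat) x : perm_eq w v -> lattice v -> lattice (rcons w x) -> lattice
  (rcons v x).
Proof.
by move=> p Lv /lattice_rcons[_ h]; apply/lattice_rcons; rewrite -!(occ_perm _ p).
Qed.

Lemma ins_word_ok w : lattice (map snd w) ->
  [/\ state_ok (ins_word w), perm_eq (flatten (ins_word w).1) (map snd w) &
      map (fun p => p.1.1) (ins_word w).2 = map fst w].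
Proof.
elim/last_ind: w => [|w p IH]; first by split=> //; exact: state_ok_nil.
rewrite map_rcons => Lw; have [h1 h2 h3] := IH (proj1 (proj1 (lattice_rcons _ _) Lw)).
rewrite ins_word_rcons; have [vQ LQ _ _] := h1.
have pw : perm_eq (map snd w) (row_word (ins_word w).1).
  by rewrite perm_sym (perm_trans (perm_row_word _)).
split.
- by apply: state_ok_ins => //; apply: lattice_perm Lw.
- have [_ pR _] := ins_spec_valid (ins_specP p.2 vQ) vQ.
  by rewrite /ins_step /= (perm_trans pR) // perm_sym perm_rcons perm_cons perm_sym.
- by rewrite /ins_step /= !map_rcons h3.
Qed.

(** Sortedness only concerns consecutive steps, which [ins_desc] compares. *)
Lemma ins_word_sorted w : lattice (map snd w) ->
  sorted word_le w = sorted step_le (ins_word w).2.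
Proof.
have sorted2 (T : eqType) (e : rel T) (s : seq T) p q :
    sorted e (rcons (rcons s p) q) = sorted e (rcons s p) && e p q.
  by case: s => [|a s] /=; rewrite ?andbT // rcons_path last_rcons.
elim/last_ind: w => [//|w q IH]; case/lastP: w IH => [//|w p] IH.
rewrite map_rcons => Lw; have Lwp := proj1 (proj1 (lattice_rcons _ _) Lw).
have := IH Lwp; rewrite !ins_word_rcons /ins_step /= !sorted2 => ->; congr (_ && _).
move: Lwp; rewrite map_rcons => /lattice_rcons[/ins_word_ok[[vQ _ _ _] _ _] _].
set Q := (ins_word w).1 in vQ *; have sp := ins_specP p.2 vQ.
have [vR _ _] := ins_spec_valid sp vQ; have sq := ins_specP q.2 vR.
have [E _] := ins_desc vQ sp sq; rewrite /word_le E /step_le /= /le_step /=.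
by rewrite ltnS.
Qed.

Lemma ins_word_inj w w' : lattice (map snd w) -> lattice (map snd w') -> ins_word w = ins_word w'
  -> w = w'.
Proof.
elim/last_ind: w w' => [|w p IH] w' Lw Lw' E.
  have [_ _ h'] := ins_word_ok Lw'; move: h'; rewrite -E /=.
  by case: w' {Lw' E}.
case/lastP: w' Lw' E => [|w' p'] Lw' E.
  have [_ _ h'] := ins_word_ok Lw; move: h'; rewrite E /= map_rcons.
  by case: (map fst w).
move: Lw Lw' E; rewrite !map_rcons => /lattice_rcons[Lw _] /lattice_rcons[Lw' _].
rewrite !ins_word_rcons /ins_step => -[ER /rcons_inj[Es Eb Em Ei]].
have [[vQ _ _ _] _ _] := ins_word_ok Lw; have [[vQ' _ _ _] _ _] := ins_word_ok Lw'.
have sp := ins_specP p.2 vQ; have sp' := ins_specP p'.2 vQ'.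
have Est : (ins p.2 (ins_word w).1).1.2 = (ins p'.2 (ins_word w').1).1.2.
  by case: (_.1.2) (_.1.2) Em Ei => [? ?] [? ?] /= -> ->.
rewrite -ER -Est in sp'; have [Ex EQ] := ins_inj sp sp' vQ vQ'.
rewrite (IH w' Lw Lw'); last by apply: injective_projections.
by congr rcons; apply: injective_projections.
Qed.

Lemma ins_word_surj S : state_ok S -> exists2 w, lattice (map snd w) & ins_word w = S.
Proof.
case: S => R s; elim/last_ind: s R => [|s [[b m] i] IH] R [/= vR LR ps cs].
  exists [::] => //; congr pair; case: R vR cs {LR} => // u R [_ un _ _] /(_ 0) /= /esym.
  by move/size0nil => u0; rewrite u0 in un.
have [ps1 ps2 ps3] := ps.
have i0 : 0 < i by apply: (ps1 (b, m, i)); rewrite mem_rcons mem_head.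
case: i i0 cs ps ps1 ps2 ps3 => // i _ cs ps ps1 ps2 ps3.
(* The shape is strict before and after the last step, and a marked step does not open a row. *)
have rm : removable R (i, m).
  rewrite /removable /= -!cs !row_count_rcons /= eqxx (ltn_eqF (ltnSn _)) addn0 addn1.
  have := ps2 (size s) i.+1 isT; rewrite -cats1 take_size_cat // ltnS eqSS.
  have := ps3 (size s) b i.+1; rewrite size_rcons -cats1 take_size_cat // drop_size_cat //=.
  case: m {ps ps1 ps2 ps3 cs IH} => h3 h2.
    have := h3 (ltnSn _) erefl; lia.
  lia.
have [x [Q [t [vQ sp _]]]] := ins_rev vR LR rm.
have [hs hm] := ins_spec_shape sp vQ.
have LQx := proj2 (lattice_ins vQ sp) LR; have LQ := proj1 (proj1 (lattice_rcons _ _) LQx).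
have okQ : state_ok (Q, s).
  split=> //=; last first.
    by move=> j; have := cs j; rewrite row_count_rcons /= hs eqSS eq_sym => /addIn.
  split.
  - by move=> p hp; apply: ps1; rewrite mem_rcons inE hp orbT.
  - move=> k j j0; case: (leqP k (size s)) => ks.
      by have := ps2 k j j0; rewrite -cats1 takel_cat.
    have := ps2 (size s) j j0; rewrite -cats1 take_size_cat //.
    by rewrite take_oversize // ltnW.
  - move=> k c j ks; have := ps3 k c j;
    rewrite size_rcons -cats1 drop_cat ks (takel_cat _ (ltnW ks)).
    move=> h; have := h (ltnW ks).
    have : drop k s != [::] by rewrite -size_eq0 size_drop subn_eq0 -ltnNge.
    by case: (drop k s) => //= a l _; apply.
have [w Lw Ew] := IH Q okQ; have [_ pw _] := ins_word_ok Lw.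
exists (rcons w (b, x)).
  rewrite map_rcons; apply: lattice_perm Lw LQx; rewrite (perm_trans (perm_row_word _)) //.
  by rewrite Ew in pw.
by rewrite ins_word_rcons Ew /ins_step /= (ins_spec_eq sp vQ).
Qed.

End InsertWord.

(** * Fillings and words *)

Section FillingWords.

Variables (L : finType) (l0 : L) (lab_le : rel (L * nat)) (rep : pred (L * nat)).
Hypotheses (lab_le_total : total lab_le) (lab_le_trans : transitive lab_le).
Hypothesis lab_le_anti : antisymmetric lab_le.

(* Fillings are encoded by the sorted word of the pairs (label, row) of their cells; [rep]
   singles out the pairs that may be repeated, that is, the labels allowed to repeat in a row. *)
Definition cell_le : rel (L * nat) := fun x y => lab_le x y && ((x != y) || rep x).
Local Notation le := cell_le.

Lemma cell_le_trans : transitive le.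
Proof.
move=> y x z /andP[xy rxy] /andP[yz ryz]; rewrite /le (lab_le_trans xy yz) /=.
case: (eqVneq x z) => //= exz; move: rxy; rewrite -exz in yz *.
by rewrite (lab_le_anti (introT andP (conj xy yz))) eqxx.
Qed.

Lemma cell_le_anti : antisymmetric le.
Proof. by move=> x y /andP[/andP[xy _] /andP[yx _]]; apply: lab_le_anti; rewrite xy. Qed.

Variables (h : nat) (a n : nat -> nat).

Definition rows_diagram := [seq (i, j) | i <- iota 1 h, j <- iota (a i) (n i)].
Local Notation D := rows_diagram.

Lemma mem_rows_diagram i j : ((i, j) \in D) = (0 < i <= h) && (a i <= j < a i + n i).
Proof.
apply/allpairsPdep/idP => [[i' [j' [hi hj [-> ->]]]]|/andP[hi hj]].
  by move: hi hj; rewrite !mem_iota; lia.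
by exists i, j; rewrite !mem_iota; split=> //; lia.
Qed.

Lemma rows_diagram_uniq : uniq D.
Proof.
apply: allpairs_uniq_dep; [exact: iota_uniq | by move=> *; exact: iota_uniq |].
by move=> [i j] [i' j'] _ _ /= [-> ->].
Qed.

Definition proper_filling (T : filling D L) :=
  forall c d : seq_sub D, left_of c d || above c d -> le (T c, (val c).1) (T d, (val d).1).

Definition row_labels i (ws : seq (L * nat)) := [seq p.1 | p <- ws & p.2 == i].

(* The cells met by each prefix of the word leave no gap in any column. *)
Definition linear_ext (ws : seq (L * nat)) := forall m l i i', m < size ws ->
  ohead (drop m ws) = Some (l, i) -> 0 < i' < i ->
  let j := a i + row_count i (take m ws) in
  a i' <= j < a i' + n i' -> j < a i' + row_count i' (take m ws).

Definition proper_word (ws : seq (L * nat)) :=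
  [/\ sorted le ws, forall p, p \in ws -> 0 < p.2 <= h,
      forall i, 0 < i <= h -> row_count i ws = n i & linear_ext ws].

Definition filling_of_word (ws : seq (L * nat)) : filling D L :=
  [ffun c : seq_sub D => nth l0 (row_labels (val c).1 ws) ((val c).2 - a (val c).1)].

Definition pairs (T : filling D L) := [seq (T c, (val c).1) | c <- enum {: seq_sub D}].

Definition word_of_filling (T : filling D L) := sort lab_le (pairs T).

Lemma size_row_labels i ws : size (row_labels i ws) = row_count i ws.
Proof. by rewrite size_map size_filter. Qed.

Lemma perm_enum_sub : perm_eq [seq val c | c <- enum {: seq_sub D}] D.
Proof.
apply: uniq_perm; [by rewrite map_inj_uniq ?enum_uniq //;
  apply: val_inj | exact: rows_diagram_uniq |].
move=> c; apply/mapP/idP => [[c' _ ->]|cD]; first exact: valP.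
by exists (SeqSub cD); rewrite ?mem_enum.
Qed.

Lemma perm_rows (ws : seq (L * nat)) : (forall p, p \in ws -> 0 < p.2 <= h) ->
  perm_eq (flatten [seq [seq p <- ws | p.2 == i] | i <- iota 1 h]) ws.
Proof.
move=> hr; apply/permP => P; rewrite count_flatten -map_comp sumnE big_map.
elim: ws hr => [|p ws IH] hr /=; first by rewrite big1.
rewrite -IH; last by move=> q qw; apply: hr; rewrite inE qw orbT.
have /= -> : \sum_(i <- iota 1 h) count P (if p.2 == i then p :: [seq p0 <- ws | p0.2 == i]
    else [seq p0 <- ws | p0.2 == i]) =
  \sum_(i <- iota 1 h) ((P p && (i == p.2)) + count P [seq p0 <- ws | p0.2 == i]).
  by apply: eq_bigr => i _; rewrite eq_sym; case: ifP => _ /=; rewrite ?andbT ?andbF.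
rewrite big_split /=; congr (_ + _).
case: (P p) => /=; last by rewrite big1.
rewrite (eq_bigr (fun i => if i == p.2 then 1 else 0)); last by move=> i _; case: eqP.
rewrite -big_mkcond sum1_count -[count _ _]/(count_mem p.2 _) count_uniq_mem ?iota_uniq //.
by rewrite mem_iota add1n ltnS hr ?mem_head.
Qed.

(* Total extension of a filling, with the junk value [l0] outside the diagram. *)
Definition ext_filling (T : filling D L) (c : nat * nat) : L :=
  if insub c is Some c' then T c' else l0.

Lemma ext_filling_val T (c : seq_sub D) : ext_filling T (val c) = T c.
Proof. by rewrite /ext_filling valK. Qed.

Lemma perm_pairs T : perm_eq (pairs T) [seq (ext_filling T c, c.1) | c <- D].
Proof.
rewrite /pairs (eq_map (g := (fun c => (ext_filling T c, c.1)) \o val)); last first.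
  by move=> c; rewrite /= ext_filling_val.
by rewrite map_comp; apply/perm_map/perm_enum_sub.
Qed.

Lemma pairs_filling_of_word ws : proper_word ws -> perm_eq (pairs (filling_of_word ws)) ws.
Proof.
case=> _ hr hc _; apply: perm_trans (perm_pairs _) _; apply: perm_trans (perm_rows hr).
rewrite map_flatten -map_comp.
set g := map _ _; set g' := map _ _; suff -> : g = g' by [].
apply/eq_in_map => i; rewrite mem_iota /= -map_comp => hi.
have hi' : 0 < i <= h by lia.
have -> : [seq p <- ws | p.2 == i] = [seq (l, i) | l <- row_labels i ws].
  rewrite /row_labels -map_comp -[LHS]map_id; apply/eq_in_map => -[l k] /=.
  by rewrite mem_filter => /andP[/eqP /= <-].
apply: (@eq_from_nth _ (l0, 0)).
  by rewrite !size_map size_iota size_filter -hc.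
rewrite size_map size_iota => k kn.
have kr : k < size (row_labels i ws) by rewrite size_row_labels hc.
rewrite (nth_map 0) ?size_iota // nth_iota // (nth_map l0) //; congr pair.
have cD : (i, a i + k) \in D by rewrite mem_rows_diagram hi' leq_addr ltn_add2l kn.
by rewrite -[(i, a i + k)]/(val (SeqSub cD)) ext_filling_val ffunE /= addKn.
Qed.

(** Here [m] is the position in the word at which the cell number [k] of row [i], counted from 0, is
    filled. *)
Lemma row_labels_pos ws i k : k < row_count i ws ->
  exists m, [/\ m < size ws, ohead (drop m ws) = Some (nth l0 (row_labels i ws) k, i)
              & row_count i (take m ws) = k].
Proof.
elim: ws k => [//|[l i'] ws IH] k; rewrite /row_count /row_labels /=.
case: eqP => [->|ne] /=; last first.
  by move=> /IH[m [h1 h2 h3]]; exists m.+1; split=> //=; rewrite (introF eqP ne).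
case: k => [|k]; first by exists 0.
rewrite add1n ltnS => /IH[m [h1 h2 h3]]; exists m.+1; split=> //=.
by rewrite eqxx add1n -/(row_count _ _) h3.
Qed.

Lemma row_labels_take ws i k m : k < row_count i (take m ws) ->
  (nth l0 (row_labels i ws) k, i) \in take m ws.
Proof.
move=> kt; have -> : nth l0 (row_labels i ws) k = nth l0 (row_labels i (take m ws)) k.
  rewrite -{1}(cat_take_drop m ws) /row_labels filter_cat map_cat nth_cat size_map size_filter.
  by rewrite -/(row_count _ _) kt.
have := mem_nth l0 (s := row_labels i (take m ws)) (n := k); rewrite size_row_labels => /(_ kt).
by case/mapP => -[l i'] /=; rewrite mem_filter => /andP[/eqP /= -> ?] ->.
Qed.

Lemma ohead_drop_cat (ws : seq (L * nat)) m p : ohead (drop m ws) = Some p ->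
  ws = take m ws ++ p :: drop m.+1 ws.
Proof.
move=> hp; rewrite -[LHS](cat_take_drop m); congr (_ ++ _).
by case E : (drop m ws) hp => [//|q s] [<-]; rewrite -add1n -drop_drop E /= drop0.
Qed.

Lemma row_count_takeS (ws : seq (L * nat)) m l i i' : ohead (drop m ws) = Some (l, i) ->
  row_count i' (take m.+1 ws) = row_count i' (take m ws) + (i == i').
Proof.
move=> hm; have ms : m < size ws.
  by rewrite ltnNge; apply/negP => /drop_oversize e; rewrite e in hm.
rewrite {1}(ohead_drop_cat hm) -cat_rcons take_size_cat ?row_count_rcons //.
by rewrite size_rcons size_takel // ltnW.
Qed.

Lemma sorted_before ws m p : sorted le ws -> ohead (drop m ws) = Some p ->
  (forall q, q \in take m ws -> le q p) /\ (forall q, q \in drop m.+1 ws -> le p q).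
Proof.
move=> sw /ohead_drop_cat e; move: sw; rewrite e (sorted_pairwise cell_le_trans).
rewrite pairwise_cat /= => /and3P[/allrelP h1 _ /andP[/allP h2 _]].
rewrite -e; split=> q hq; last exact: h2.
by apply: h1 => //; rewrite mem_head.
Qed.

(** The labels of a row form a sorted subsequence of the word; in a column, [linear_ext] says that
    the upper cell is filled earlier. *)
Lemma proper_filling_of_word ws : proper_word ws -> proper_filling (filling_of_word ws).
Proof.
move=> [sw hr hc lin] [[i j] cD] [[i' j'] dD]; rewrite !ffunE /left_of /above /=.
move: cD dD; rewrite !mem_rows_diagram => /andP[hi hj] /andP[hi' hj'].
have k' : j' - a i' < row_count i' ws by rewrite hc //; lia.
case/orP => /= /andP[/eqP e lt]; last first.
  subst j'.
  have [m [ms hm hk]] := row_labels_pos k'.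
  have ii' : 0 < i < i' by rewrite lt andbT; case/andP: hi.
  have := lin m _ i' i ms hm ii'; rewrite hk subnKC; last lia.
  move=> /(_ hj) jk; have [h1 _] := sorted_before sw hm.
  by apply: h1; apply: row_labels_take; lia.
subst i'; set f := [seq p <- ws | p.2 == i].
have sf : sorted le f by apply: sorted_filter sw; apply: cell_le_trans.
have E k : k < row_count i ws -> (nth l0 (row_labels i ws) k, i) = nth (l0, 0) f k.
  rewrite /row_count -size_filter => ks; rewrite (nth_map (l0, 0)) //.
  have := mem_nth (l0, 0) ks; rewrite mem_filter => /andP[/eqP e _].
  by apply: injective_projections.
rewrite !E //; last by rewrite hc //; lia.
apply: (sorted_ltn_nth cell_le_trans) => //.
- by rewrite inE size_filter; rewrite -/(row_count i ws) hc //; lia.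
- by rewrite inE size_filter.
- by lia.
Qed.

Lemma row_labels_perm (ws ws' : seq (L * nat)) i : perm_eq ws ws' -> perm_eq (row_labels i ws)
  (row_labels i ws').
Proof. by move=> p; apply/perm_map/perm_filter. Qed.

Lemma row_labels_pairs T i : 0 < i <= h ->
  perm_eq (row_labels i (pairs T)) [seq ext_filling T (i, j) | j <- iota (a i) (n i)].
Proof.
move=> hi; apply: perm_trans (row_labels_perm i (perm_pairs T)) _.
rewrite /row_labels /rows_diagram filter_map -map_comp.
suff -> : [seq c <- D | c.1 == i] = [seq (i, j) | j <- iota (a i) (n i)].
  by rewrite -map_comp.
rewrite filter_flatten -map_comp.
have -> : iota 1 h = iota 1 i.-1 ++ i :: iota i.+1 (h - i).
  have := iotaD 1 i.-1 (h - i).+1; have -> : i.-1 + (h - i).+1 = h by lia.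
  by have -> : 1 + i.-1 = i by lia.
have N s : i \notin s -> flatten [seq [seq c <- [seq (i', j) | j <- iota (a i') (n i')] | c.1 ==
  i] | i' <- s] = [::].
  elim: s => //= i' s IH; rewrite inE negb_or => /andP[ne /IH ->]; rewrite cats0 filter_map.
  by rewrite (eq_filter (a2 := pred0)) ?filter_pred0 // => j /=; rewrite eq_sym (negbTE ne).
rewrite map_cat flatten_cat /= N ?N ?cats0 /=; try by rewrite mem_iota; lia.
by rewrite filter_map (eq_filter (a2 := predT)) ?filter_predT // => j /=; rewrite eqxx.
Qed.

Lemma row_labels_head ws m l i : ohead (drop m ws) = Some (l, i) ->
  nth l0 (row_labels i ws) (row_count i (take m ws)) = l.
Proof.
move=> hm; rewrite {1}(ohead_drop_cat hm) /row_labels filter_cat map_cat nth_cat size_map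
  size_filter.
by rewrite ltnn subnn /= eqxx.
Qed.

(** Beyond sorting by [lab_le], only repeated pairs matter. They come from two cells of one row with
    the same label, which a proper filling allows only when [rep] does. *)
Lemma sorted_word_of_filling T : proper_filling T -> sorted le (word_of_filling T).
Proof.
move=> gT; have sl : sorted lab_le (word_of_filling T) by apply: sort_sorted.
have un : uniq (filter (predC rep) (pairs T)).
  rewrite filter_map map_inj_in_uniq ?filter_uniq -?enumT ?enum_uniq //.
  move=> c d; rewrite !mem_filter /= => /andP[rc _] _ [e1 e2].
  case: (ltngtP (val c).2 (val d).2) => cd.
  - have : le (T c, (val c).1) (T d, (val d).1) by apply: gT; rewrite /left_of e2 eqxx cd.
    by rewrite /le -e1 -e2 eqxx (negbTE rc) andbF.
  - have : le (T d, (val d).1) (T c, (val c).1) by apply: gT; rewrite /left_of e2 eqxx cd.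
    by rewrite /le -e1 -e2 eqxx (negbTE rc) andbF.
  - by apply: val_inj; apply: injective_projections.
have {}un : uniq (filter (predC rep) (word_of_filling T)).
  by rewrite (perm_uniq (perm_filter _ (permEl (perm_sort _ _)))).
elim: (word_of_filling T) sl un => [//|x [//|y s] IH] /= /andP[xy sl] un.
apply/andP; split; last first.
  by apply: IH => //; move: un; rewrite /=; case: (rep x) => //= /andP[].
rewrite /le xy /=; case: eqP => //= exy; subst y.
by case E : (rep x) un => //=; rewrite mem_head.
Qed.

Lemma proper_word_of_filling T : proper_filling T -> proper_word (word_of_filling T) /\
  filling_of_word (word_of_filling T) = T.
Proof.
move=> gT; have sw := sorted_word_of_filling gT.
have pw : perm_eq (word_of_filling T) (pairs T) by apply/permEl/perm_sort.
have hc i : 0 < i <= h -> row_count i (word_of_filling T) = n i.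
  by move=> hi;
    rewrite -size_row_labels (perm_size (row_labels_perm i pw)) (perm_size (row_labels_pairs T
      hi)) size_map size_iota.
have E (c : seq_sub D) : nth l0 (row_labels (val c).1 (word_of_filling T)) ((val c).2 - a (val
  c).1) = T c.
  have := valP c; case Ec : (val c) => [i j]; rewrite mem_rows_diagram => /andP[hi hj] /=.
  have p := perm_trans (row_labels_perm i pw) (row_labels_pairs T hi).
  suff -> : row_labels i (word_of_filling T) = [seq ext_filling T (i, j) | j <- iota (a i) (n i)].
    by rewrite (nth_map 0) ?size_iota ?nth_iota ?subnKC -?Ec ?ext_filling_val //; lia.
  have tr : transitive (fun l l' => le (l, i) (l', i)) by move=> ? ? ?; apply: cell_le_trans.
  apply: (sorted_eq tr) => //.
  - by move=> l l' /cell_le_anti [].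
  - rewrite sorted_map; have := sorted_filter cell_le_trans (fun p => p.2 == i) sw.
    apply: (@sub_in_sorted _ (fun p => p.2 == i) le); last exact: filter_all.
    by move=> [l k] [l' k'] /eqP /= -> /eqP /= ->.
  - rewrite (sorted_pairwise tr) pairwise_map; apply/(pairwiseP 0) => x y.
    rewrite !inE size_iota => hx hy xy; rewrite !nth_iota //=.
    have cx : (i, a i + x) \in D by rewrite mem_rows_diagram hi; lia.
    have cy : (i, a i + y) \in D by rewrite mem_rows_diagram hi; lia.
    rewrite -[(i, a i + x)]/(val (SeqSub cx)) -[(i, a i + y)]/(val (SeqSub cy)) !ext_filling_val.
    by have := gT (SeqSub cx) (SeqSub cy); apply; rewrite /left_of /= eqxx ltn_add2l xy.
split; last by apply/ffunP => c; rewrite ffunE E.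
split=> //.
- by move=> p; rewrite (perm_mem pw) => /mapP[c _ ->]; have := valP c; case: (val c) => i j;
  rewrite mem_rows_diagram => /andP[].
(* If the upper cell were filled later, its pair would be both before and after that of the lower
   cell, and antisymmetry would identify their rows. *)
- move=> m l i i' ms hm ii' j hj; rewrite ltnNge; apply/negP => jk.
  have hi : 0 < i <= h.
    have : (l, i) \in word_of_filling T by rewrite (ohead_drop_cat hm) mem_cat mem_head orbT.
    rewrite (perm_mem pw) => /mapP[[[i1 j1] cD] _ [_ ->]].
    by move: cD; rewrite mem_rows_diagram => /andP[].
  have hi' : 0 < i' <= h by lia.
  have hl := row_labels_head hm.
  have hk : row_count i (take m (word_of_filling T)) < n i.
    rewrite -(hc i hi) {2}(ohead_drop_cat hm) /row_count count_cat /= eqxx.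
    by rewrite addnCA add1n ltnS leq_addr.
  have dD : (i, j) \in D by rewrite mem_rows_diagram hi /j; lia.
  have cD : (i', j) \in D by rewrite mem_rows_diagram hi' hj.
  have k' : j - a i' < row_count i' (word_of_filling T) by rewrite hc //; lia.
  have [m' [ms' hm' hk']] := row_labels_pos k'.
  have mm' : m < m'.
    rewrite ltn_neqAle; apply/andP; split.
      apply/eqP => e; move: hm'; rewrite -e hm => -[_ e']; move: ii'; rewrite e' ltnn andbF.
      by [].
    rewrite leqNgt; apply/negP => m'm.
    have : row_count i' (take m'.+1 (word_of_filling T)) <= row_count i' (take m (word_of_filling
      T)).
      by rewrite -(subnKC m'm) takeD /row_count count_cat leq_addr.
    by rewrite (row_count_takeS _ hm') eqxx hk'; lia.
  have [_ lt] := sorted_before sw hm.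
  have := lt (nth l0 (row_labels i' (word_of_filling T)) (j - a i'), i').
  have -> : (nth l0 (row_labels i' (word_of_filling T)) (j - a i'), i') \in drop m.+1
    (word_of_filling T).
    have : drop m' (word_of_filling T) = drop (m' - m.+1) (drop m.+1 (word_of_filling T)) by
      rewrite drop_drop subnK.
    move=> e; apply: (mem_drop (n0 := m' - m.+1)); rewrite -e.
    by case: (drop m' _) hm' => //= q s [->]; rewrite mem_head.
  have := E (SeqSub cD) => /= ->; have := E (SeqSub dD) => /=.
  rewrite /j addKn hl => -> /(_ isT) l1.
  have l2 : le (T (SeqSub cD), i') (T (SeqSub dD), i).
    by have := gT (SeqSub cD) (SeqSub dD); apply; rewrite /above /= eqxx; case/andP: ii' => _ ->;
      rewrite orbT.
  have [_ e] := cell_le_anti (introT andP (conj l1 l2)).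
  by move: ii'; rewrite e ltnn andbF.
Qed.

End FillingWords.

Lemma take_ohead (T : Type) (s : seq T) m : m < size s -> exists p, ohead (drop m s) = Some p.
Proof.
case E : (drop m s) => [|p t]; last by exists p.
by move/(congr1 size)/eqP: E; rewrite size_drop subn_eq0 leqNgt => /negbTE ->.
Qed.

Lemma row_count_take_le (T : Type) (s : seq (T * nat)) i m :
  row_count i (take m s) <= row_count i s.
Proof. by rewrite -{2}(cat_take_drop m s) /row_count count_cat leq_addr. Qed.

(** * Column conditions as prefix conditions *)

Section SkewPath.

Variables (L : finType) (R h : nat) (la : nat -> nat) (ws : seq (L * nat)).
Hypotheses (la_mono : forall i, 0 < i -> la i.+1 <= la i) (la1 : la 1 <= R).
Hypothesis la_ge : forall i, 0 < i <= R -> R - i <= la i.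
Hypotheses (hR : h <= R) (ws_rows : forall p, p \in ws -> 0 < p.2 <= h).

Let a i := (R - i).+1.
Let n i := la i - (R - i).

Hypothesis ws_count : forall i, 0 < i <= h -> row_count i ws = n i.

Lemma row_count_out i : ~~ (0 < i <= h) -> row_count i ws = 0.
Proof.
move=> hi; apply/eqP; rewrite -leqn0 leqNgt -has_count; apply/hasPn => p /ws_rows.
by apply: contraL => /eqP ->.
Qed.

Lemma occ_rows i m : 0 < i <= R ->
  occ (R - i) (take m [seq R - p.2 | p <- ws]) = row_count i (take m ws).
Proof.
clear la_mono la1 la_ge ws_count; move=> hi; rewrite -map_take /occ /row_count count_map;
  apply: eq_in_count => -[l j] /mem_take /ws_rows /= hj.
by apply/eqP/eqP; lia.
Qed.

Lemma occ_rows0 k m : R <= k -> occ k (take m [seq R - p.2 | p <- ws]) = 0.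
Proof.
clear la_mono la1 la_ge ws_count; move=> kR; apply: occ0;
  apply/negP => /mem_take /mapP[[l j] /ws_rows /= hj]; lia.
Qed.

Definition skew_path := forall m i, 0 < i <= R ->
  row_count i (take m ws) <= (if 1 < i then row_count i.-1 (take m ws) else 0).+1.

Lemma skew_path_lattice : skew_path <-> lattice [seq R - p.2 | p <- ws].
Proof.
clear la_mono la1 la_ge ws_count; split=> [hp m k|hL m i hi].
  case: (leqP R k) => kR; first by rewrite !occ_rows0 //; lia.
  have := hp m (R - k); rewrite -(occ_rows m (i := R - k)); last lia.
  have -> : R - (R - k) = k by lia.
  move=> /(_ _) h'; apply: leq_trans (h' _) _; first lia.
  case: ifP => h1; last by [].
  by rewrite -(occ_rows m); [have -> : R - (R - k).-1 = k.+1 by lia | lia].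
have := hL m (R - i); rewrite (occ_rows m hi); case: ifP => h1.
  by rewrite -(occ_rows m (i := i.-1)); [have -> : (R - i).+1 = R - i.-1 by lia | lia].
by rewrite occ_rows0 //; lia.
Qed.

(** Neighbouring rows suffice, as the inequalities between them add up. The first row has at most
    one cell because of the box, which gives the inequality for [i = 1]. *)
Lemma linear_ext_skew : linear_ext a n ws <-> skew_path.
Proof.
split=> [lin m i hi|hp m l i i' ms hm ii' j hj].
  case: ifP => h1; last first.
    have -> : i = 1 by lia.
    apply: leq_trans (row_count_take_le _ _ _) _; case: (posnP h) => h0.
      by rewrite row_count_out //; lia.
    by rewrite ws_count /n; lia.
  elim: m => [|m IH]; first by rewrite take0.
  case: (leqP (size ws) m) => ms; first by rewrite !take_oversize // in IH *; lia.
  have [[l i0] hm] := take_ohead ms.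
  have E := row_count_takeS _ hm; have := E i; have := E i.-1.
  case: (eqVneq i0 i) => [ei|_]; last lia.
  subst i0; rewrite (_ : i == i.-1 = false); last lia.
  (* The first cell of a row has no cell above it to wait for; for a later one, the monotonicity of
     [la] puts the cell above in the diagram. *)
  move=> E1 E2; case: (posnP (row_count i (take m ws))) => q0; first lia.
  have := row_count_take_le ws i m.+1; case: (boolP (0 < i <= h)) => hh; last first.
    by rewrite row_count_out //; lia.
  rewrite (ws_count hh) => hc.
  have := lin m l i i.-1 ms hm; rewrite /a /n.
  have := la_mono (i := i.-1); rewrite prednK; last lia.
  have := la_ge (i := i.-1); rewrite /n in hc; lia.
have chain k i1 : 0 < i1 -> i1 + k <= R ->
    row_count (i1 + k) (take m.+1 ws) <= row_count i1 (take m.+1 ws) + k.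
  elim: k => [|k IH] h1 h2; first by rewrite !addn0.
  have := hp m.+1 (i1 + k.+1); rewrite addnS ifT /=; last lia.
  have := IH h1; lia.
have hi : 0 < i <= h.
  by have := ws_rows (p := (l, i)); rewrite {1}(ohead_drop_cat hm) mem_cat mem_head orbT; apply.
have E := row_count_takeS _ hm; have := E i; have := E i'.
have := chain (i - i') i'; rewrite eqxx (_ : i == i' = false) ?subnKC; try lia.
by move: hj; rewrite /j /a /n; lia.
Qed.

End SkewPath.

Section ShiftedPath.

Variables (L : finType) (h : nat) (nu : nat -> nat) (ws : seq (L * nat)).
Hypotheses (nu_mono : forall i, 0 < i < h -> nu i.+1 < nu i).
Hypothesis ws_rows : forall p, p \in ws -> 0 < p.2 <= h.
Hypothesis ws_count : forall i, 0 < i <= h -> row_count i ws = nu i.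

(** Row [i + 1] starts one column to the right of row [i], so once it is nonempty it must remain
    strictly shorter. *)
Lemma linear_ext_shifted : linear_ext id nu ws <->
  forall m i, 0 < i -> row_count i.+1 (take m ws) = 0 \/
    row_count i.+1 (take m ws) < row_count i (take m ws).
Proof.
split=> [lin m i hi|hp m l i i' ms hm ii' j hj].
  elim: m => [|m IH]; first by rewrite take0; left.
  case: (leqP (size ws) m) => ms; first by rewrite !take_oversize // in IH *; lia.
  have [[l i0] hm] := take_ohead ms.
  have E := row_count_takeS _ hm; have := E i; have := E i.+1.
  case: (eqVneq i0 i.+1) => [ei|_]; last lia.
  subst i0; rewrite (_ : i.+1 == i = false); last lia.
  move=> E1 E2; have hh : 0 < i.+1 <= h.
    by have := ws_rows (p := (l, i.+1)); rewrite {1}(ohead_drop_cat hm) mem_cat mem_head orbT;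
      apply.
  have := row_count_take_le ws i.+1 m.+1; rewrite (ws_count hh) => hc.
  have := lin m l i.+1 i ms hm; have := nu_mono (i := i); lia.
have hi : 0 < i <= h.
  by have := ws_rows (p := (l, i)); rewrite {1}(ohead_drop_cat hm) mem_cat mem_head orbT; apply.
have chain k i1 : 0 < i1 -> row_count (i1 + k) (take m.+1 ws) = 0 \/
    row_count (i1 + k) (take m.+1 ws) + k <= row_count i1 (take m.+1 ws).
  elim: k => [|k IH] h1; first by rewrite !addn0; right.
  have := hp m.+1 (i1 + k); rewrite addnS.
  have := IH h1; lia.
have E := row_count_takeS _ hm; have := E i; have := E i'.
have := chain (i - i') i'; rewrite eqxx (_ : i == i' = false) ?subnKC; try lia.
Qed.

End ShiftedPath.

Lemma filling_of_wordK (L : finType) (l0 : L) lab_le rep (lt : total lab_le) (ltr : transitive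
  lab_le)
  (la : antisymmetric lab_le) h a n ws :
  proper_word lab_le rep h a n ws -> word_of_filling lab_le (filling_of_word l0 h a n ws) = ws.
Proof.
move=> gw; have gT := proper_filling_of_word l0 ltr la gw; have [sw _ _ _] := gw.
have [[sw' _ _ _] _] := proper_word_of_filling l0 lt ltr la gT.
apply: (sorted_eq (cell_le_trans ltr la) (cell_le_anti la)) sw' sw _.
by apply: perm_trans (permEl (perm_sort _ _)) (pairs_filling_of_word l0 gw).
Qed.

(** Insertion states live in an infinite type and are described by propositions, so their number is
    witnessed by a list. *)
Definition card_is (X : eqType) (P : X -> Prop) (N : nat) :=
  exists s : seq X, [/\ uniq s, forall x, x \in s <-> P x & size s = N].

Lemma card_is_pred (X : finType) (P : pred X) : card_is P #|P|.
Proof. by exists (enum P); rewrite enum_uniq cardE; split=> // x; rewrite mem_enum. Qed.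

Lemma card_is_bij (X Y : eqType) (P : X -> Prop) (Q : Y -> Prop) (f : X -> Y) N :
  (forall x, P x -> Q (f x)) -> (forall x y, P x -> P y -> f x = f y -> x = y) ->
  (forall y, Q y -> exists2 x, P x & f x = y) -> card_is P N -> card_is Q N.
Proof.
move=> PQ inj surj [s [us hs <-]]; exists (map f s); split; last by rewrite size_map.
  by rewrite map_inj_in_uniq // => x y /hs Px /hs Py; apply: inj.
move=> y; split=> [/mapP[x /hs Px ->]|/surj[x /hs xs <-]]; first exact: PQ.
exact: map_f.
Qed.

Lemma card_is_prod (X Y : eqType) (P : X -> Prop) (Q : Y -> Prop) N M :
  card_is P N -> card_is Q M -> card_is (fun z : X * Y => P z.1 /\ Q z.2) (N * M).
Proof.
move=> [s [us hs <-]] [t [ut ht <-]]; exists [seq (x, y) | x <- s, y <- t].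
split; last by rewrite size_allpairs.
  by apply: allpairs_uniq => // -[x y] [x' y'] _ _ [-> ->].
move=> [x y]; split=> [/allpairsP[[x' y'] /= [/hs ? /ht ? [-> ->]]]//|/= [/hs xs /ht yt]].
by apply/allpairsP; exists (x, y).
Qed.

Lemma card_is_inj (X : eqType) (P : X -> Prop) N M : card_is P N -> card_is P M -> N = M.
Proof.
move=> [s [us hs <-]] [t [ut ht <-]]; apply/perm_size/uniq_perm => // x.
by apply/idP/idP => [/hs/ht|/ht/hs].
Qed.

Lemma card_is_split (X I : eqType) (P : X -> Prop) (f : X -> I) (U : seq I) (M : I -> nat) N :
  uniq U -> (forall x, P x -> f x \in U) ->
  (forall i, i \in U -> card_is (fun x => P x /\ f x = i) (M i)) -> card_is P N ->
  N = \sum_(i <- U) M i.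
Proof.
move=> uU hU hM [s [us hs <-]]; have E : forall i, i \in U -> M i = count (fun x => f x == i) s.
  move=> i iU; rewrite -size_filter; apply: (card_is_inj (hM i iU)).
  exists [seq x <- s | f x == i]; rewrite filter_uniq //; split=> // x.
  by rewrite mem_filter; split=> [/andP[/eqP fx /hs]|[/hs xs <-]]; rewrite ?eqxx.
rewrite (eq_big_seq _ E) {hM E}.
have {hs}hU : forall x, x \in s -> f x \in U by move=> x /hs /hU.
elim: s us hU => [|x s IH] /=; first by rewrite big1.
move=> /andP[_ us] hU; rewrite big_split /= -IH //; last by move=> y ys; apply: hU;
  rewrite inE ys orbT.
rewrite (eq_bigr (fun i => if i == f x then 1 else 0)); last by move=> i _; rewrite eq_sym;
  case: eqP.
by rewrite -big_mkcond sum1_count -[count _ _]/(count_mem (f x) _) count_uniq_mem // hU // mem_head.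
Qed.

(** * The skew diagram and its semistandard fillings *)

Lemma mem_diagram la i j : ((i, j) \in diagram la) = (0 < i <= size la) && (0 < j <= part la i).
Proof. by rewrite [diagram la](_ : _ = rows_diagram (size la) (fun=> 1) (part la)) //
  mem_rows_diagram add1n ltnS. Qed.

Lemma part_staircase r i : 0 < i -> part (staircase r) i = r.+1 - i.
Proof.
rewrite /part /staircase => i0; case: (ltnP i.-1 r) => ir.
  by rewrite nth_rev size_iota // nth_iota //; lia.
by rewrite nth_default ?size_rev ?size_iota //; lia.
Qed.

Lemma mem_staircase r i j : ((i, j) \in diagram (staircase r)) = (0 < i) && (0 < j <= r.+1 - i).
Proof.
rewrite mem_diagram size_rev size_iota; case: (posnP i) => [->//|i0].
by rewrite part_staircase //=; lia.
Qed.

Lemma filter_iota_gt d m : [seq j <- iota 1 m | d < j] = iota d.+1 (m - d).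
Proof.
case: (leqP d m) => dm; last first.
  rewrite (_ : m - d = 0); last lia.
  by apply/eqP; rewrite -(negbK (_ == _)) -has_filter; apply/hasPn => j; rewrite mem_iota /=; lia.
rewrite -{1}(subnKC dm) iotaD filter_cat add1n.
rewrite (eq_in_filter (a2 := pred0)) ?filter_pred0; last by move=> j; rewrite mem_iota /=; lia.
by rewrite (eq_in_filter (a2 := predT)) ?filter_predT // => j; rewrite mem_iota /=; lia.
Qed.

Lemma skew_diagramE r la : skew_diagram la (staircase r) =
  rows_diagram (size la) (fun i => (r.+1 - i).+1) (fun i => part la i - (r.+1 - i)).
Proof.
rewrite /skew_diagram /diagram /rows_diagram filter_flatten -map_comp.
congr flatten; apply/eq_in_map => i; rewrite mem_iota => hi /=.
rewrite filter_map -filter_iota_gt; congr map; apply: eq_in_filter => j.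
by rewrite mem_iota /= mem_staircase; lia.
Qed.

Lemma partition_parts r la : is_partition la ->
  {subset diagram (staircase r) <= diagram la} ->
  {subset diagram la <= diagram (nseq r.+1 r.+1)} ->
  [/\ forall i, 0 < i -> part la i.+1 <= part la i, part la 1 <= r.+1,
      forall i, 0 < i <= r.+1 -> r.+1 - i <= part la i & size la <= r.+1].
Proof.
move=> /andP[sl l0] hd hb; have sb i j : (i, j) \in diagram la -> i <= r.+1 /\ j <= r.+1.
  by move/hb; rewrite mem_diagram size_nseq /part nth_nseq; case: ifP; lia.
have pos i : 0 < i <= size la -> 0 < part la i.
  move=> hi; rewrite lt0n; apply: contraNneq l0 => <-; apply: mem_nth; case: i hi => // i /andP[].
split.
- case=> // i _; rewrite /part /=; case: (ltnP i.+1 (size la)) => h; last by rewrite nth_default.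
  by have /sortedP := sl; apply.
- case: (posnP (size la)) => h; first by rewrite /part nth_default // h.
  by case: (sb 1 (part la 1)) => //; rewrite mem_diagram h pos ?h //=.
- move=> i hi; case: (posnP (r.+1 - i)) => [->//|h].
  have /hd : (i, r.+1 - i) \in diagram (staircase r) by rewrite mem_staircase h; lia.
  by rewrite mem_diagram => /andP[_ /andP[]].
- case: (posnP (size la)) => [->//|h].
  by case: (sb (size la) 1) => //; rewrite mem_diagram h leqnn pos ?h ?leqnn.
Qed.

Definition ord_ltb n : rel 'I_n := fun b b' => b < b'.

(** Here [alpha] is the content of the recording tableau and [cont] that of the insertion
    tableau. *)
Definition insertion_state n (alpha : 'I_n -> nat) (cont : nat -> nat)
    (S : seq (seq nat) * seq (('I_n * bool) * nat)) :=
  [/\ state_ok S, sorted (step_le (@ord_ltb n)) S.2,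
      forall b, count (fun p => p.1.1 == b) S.2 = alpha b &
      forall k, occ k (flatten S.1) = cont k].

(** Equal labels are read from the bottom row up, which is the order of increasing letters after
    [to_letters]. *)
Definition skew_lab_le n : rel ('I_n * nat) :=
  fun x y => (x.1 < y.1) || (x.1 == y.1) && (y.2 <= x.2).

Lemma skew_lab_le_total n : total (@skew_lab_le n).
Proof. by move=> [b i] [b' i']; rewrite /skew_lab_le /= -!val_eqE /=; lia. Qed.

Lemma skew_lab_le_trans n : transitive (@skew_lab_le n).
Proof. by move=> [b i] [b' i'] [b'' i'']; rewrite /skew_lab_le /= -!val_eqE /=; lia. Qed.

Lemma skew_lab_le_anti n : antisymmetric (@skew_lab_le n).
Proof.
move=> [b i] [b' i']; rewrite /skew_lab_le /= -!val_eqE /= => h.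
by congr pair; [apply: val_inj => /=|]; lia.
Qed.

Lemma count_pairs (L : finType) h a n (T : filling (rows_diagram h a n) L) (P : pred L) :
  count (fun p => P p.1) (pairs T) = #|[pred c | P (T c)]|.
Proof.
by rewrite /pairs count_map -sum1_count big_enum_cond -sum1_card.
Qed.

Section SkewCount.

Variables (n r : nat) (la : seq nat).
Hypotheses (la_part : is_partition la)
  (delta_la : {subset diagram (staircase r) <= diagram la})
  (la_box : {subset diagram la <= diagram (nseq r.+1 r.+1)}).

Let R := r.+1.
Let h := size la.
Let a i := (R - i).+1.
Let len i := part la i - (R - i).
Let lab_le := @skew_lab_le n.+1.
Let rep : pred ('I_n.+1 * nat) := predT.

(** The length of row [r + 1 - k] of [la / delta_r], whose cells are recorded by the letter [k]. *)
Definition skew_content k := if k < r.+1 then part la (r.+1 - k) - k else 0.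

(* Row [i] of [la] corresponds to the letter [r + 2 - i], here numbered from 0. *)
Definition to_letters (w : seq ('I_n.+1 * nat)) := [seq (p.1, r.+1 - p.2) | p <- w].

Lemma semistandard_proper_filling (T : filling (rows_diagram h a len) 'I_n.+1) :
  semistandard T <-> proper_filling lab_le rep T.
Proof.
split=> [/forallP hT c d lr|hT].
  have /forallP /(_ d) /andP[/implyP h1 /implyP h2] := hT c.
  rewrite /cell_le orbT andbT /lab_le /skew_lab_le /= -val_eqE /=.
  case/orP: lr => lr; last by rewrite h2.
  by have := h1 lr; case/andP: lr => /eqP -> _; rewrite leqnn andbT orbC -leq_eqVlt.
apply/forallP => c; apply/forallP => d; apply/andP; split; apply/implyP => lr.
  have := hT c d; rewrite lr => /(_ isT);
    rewrite /cell_le orbT andbT /lab_le /skew_lab_le -val_eqE /=.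
  by case/orP => [/ltnW|/andP[/eqP ->]].
have := hT c d; rewrite lr orbT => /(_ isT);
  rewrite /cell_le orbT andbT /lab_le /skew_lab_le -val_eqE /=.
by case/orP => // /andP[_ dc]; case/andP: lr => _; rewrite ltnNge dc.
Qed.

Lemma to_letters_sorted (ws : seq ('I_n.+1 * nat)) : (forall p, p \in ws -> p.2 <= R) ->
  sorted (word_le (@ord_ltb n.+1)) (to_letters ws) = sorted (cell_le lab_le rep) ws.
Proof.
move=> hr; rewrite sorted_map; apply: (eq_in_sorted (P := fun p => p.2 <= R)); last exact/allP.
move=> [b i] [b' i'] /= hi hi'; rewrite ?unfold_in /= in hi hi'.
rewrite /word_le /cell_le orbT andbT /lab_le /skew_lab_le /ord_ltb /=.
by congr (_ || (_ && _)); lia.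
Qed.

Lemma to_lettersK (w : seq ('I_n.+1 * nat)) : (forall p, p \in w -> p.2 <= R) -> to_letters
  (to_letters w) = w.
Proof.
move=> hw; rewrite /to_letters -map_comp map_id_in // => -[b k] /hw /= hk; congr pair; lia.
Qed.

Lemma proper_word_lattice (ws : seq ('I_n.+1 * nat)) : (forall p, p \in ws -> 0 < p.2 <= h) ->
  (forall i, 0 < i <= h -> row_count i ws = len i) ->
  linear_ext a len ws <-> lattice [seq R - p.2 | p <- ws].
Proof.
have [mono l1 lge hR] := partition_parts la_part delta_la la_box.
move=> hr hc; rewrite (linear_ext_skew mono l1 lge hR hr hc).
exact: (skew_path_lattice hR hr).
Qed.

Lemma to_letters_snd (ws : seq ('I_n.+1 * nat)) : map snd (to_letters ws) = [seq R - p.2 | p <- ws].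
Proof. by rewrite /to_letters -map_comp. Qed.

Lemma occ_to_letters (ws : seq ('I_n.+1 * nat)) k : (forall p, p \in ws -> 0 < p.2 <= h) ->
  (forall i, 0 < i <= h -> row_count i ws = len i) ->
  occ k [seq R - p.2 | p <- ws] = skew_content k.
Proof.
have [mono l1 lge hR] := partition_parts la_part delta_la la_box.
move=> hr hc; rewrite /skew_content; case: ltnP => kR; last first.
  have := occ_rows0 hR hr (size ws) kR; rewrite take_oversize ?size_map //.
have hi : 0 < R - k <= R by lia.
have := occ_rows hR hr (size ws) hi; rewrite !take_oversize ?size_map //.
have -> : R - (R - k) = k by lia.
move=> ->; case: (boolP (0 < R - k <= h)) => hh; first by rewrite hc // /len; congr (_ - _); lia.
rewrite (row_count_out hr hh) /part nth_default //.
by move: hh; rewrite /h; lia.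
Qed.

Lemma skew_card (alpha : 'I_n.+1 -> nat) :
  card_is (insertion_state alpha skew_content)
    #|[pred T : filling (rows_diagram h a len) 'I_n.+1 |
        semistandard T && [forall b, #|[pred c | T c == b]| == alpha b]]|.
Proof.
have [lt ltr lan] : [/\ total lab_le, transitive lab_le & antisymmetric lab_le].
  by split; [exact: skew_lab_le_total | exact: skew_lab_le_trans | exact: skew_lab_le_anti].
have [mono l1 lge hR] := partition_parts la_part delta_la la_box.
have rowsR (ws : seq ('I_n.+1 * nat)) : (forall p, p \in ws -> 0 < p.2 <= h) -> forall p, p \in ws
  -> p.2 <= R.
  by move=> hr p /hr /andP[_ ?]; apply: leq_trans hR.
have bcount (ws : seq ('I_n.+1 * nat)) b : lattice [seq R - p.2 | p <- ws] ->
    count (fun p => p.1.1 == b) (ins_word (to_letters ws)).2 = count (fun p => p.1 == b) ws.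
  rewrite -to_letters_snd => /ins_word_ok[_ _ e].
  have := congr1 (count (pred1 b)) e; rewrite /to_letters -map_comp !count_map => e'.
  exact: e'.
apply: (card_is_bij (f := fun T => ins_word (to_letters (word_of_filling lab_le T))) _ _ _
  (card_is_pred _)).
- move=> T /andP[/semistandard_proper_filling gT /forallP cT].
  have [gw _] := proper_word_of_filling ord0 lt ltr lan gT; have [sw hr hc lin] := gw.
  have LT := proj1 (proper_word_lattice hr hc) lin.
  have LT' : lattice (map snd (to_letters (word_of_filling lab_le T))) by rewrite to_letters_snd.
  have [ok pQ _] := ins_word_ok LT'.
  split=> //.
  + by rewrite -ins_word_sorted // to_letters_sorted //; apply: rowsR.
  + move=> b; rewrite bcount // (permP (permEl (perm_sort _ _))).
    by rewrite (count_pairs T (pred1 b)); apply/eqP/cT.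
  + by move=> k; rewrite (occ_perm _ pQ) to_letters_snd occ_to_letters.
- move=> T T' /andP[/semistandard_proper_filling gT _] /andP[/semistandard_proper_filling gT' _] E.
  have [gw eT] := proper_word_of_filling ord0 lt ltr lan gT; have [sw hr hc lin] := gw.
  have [gw' eT'] := proper_word_of_filling ord0 lt ltr lan gT'; have [sw' hr' hc' lin'] := gw'.
  rewrite -eT -eT'; congr filling_of_word.
  rewrite -(to_lettersK (rowsR _ hr)) -(to_lettersK (rowsR _ hr')); congr to_letters.
  by apply: ins_word_inj E; rewrite to_letters_snd; apply/proper_word_lattice.
(* Surjectivity: the content bounds the letters of [w], so they convert back to rows of the
   diagram. *)
move=> S [ok sS cS oS]; have [w Lw ew] := ins_word_surj ok.
have [_ pw _] := ins_word_ok Lw.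
have wk p : p \in w -> p.2 < R.
  move=> pin; rewrite ltnNge; apply/negP => Rp.
  have : 0 < occ p.2 (map snd w) by rewrite occ_gt0 map_f.
  by rewrite -(occ_perm _ pw) ew oS /skew_content ifF //; apply/negbTE; rewrite -leqNgt.
have cw : to_letters (to_letters w) = w by apply: to_lettersK => p /wk /ltnW.
have rw p : p \in to_letters w -> 0 < p.2 <= R.
  by case/mapP => -[b k] /wk /= hk -> /=; rewrite /R in hk *; lia.
have cc k : k < R -> row_count (R - k) (to_letters w) = skew_content k.
  move=> kR; rewrite -oS -ew (occ_perm _ pw) -{2}cw to_letters_snd.
  have := occ_rows (leqnn R) rw (size w) (i := R - k).
  rewrite !take_oversize ?size_map // => <-; last lia.
  by congr occ; lia.
have hc i : 0 < i <= h -> row_count i (to_letters w) = len i.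
  move=> hi; have := cc (R - i); rewrite /skew_content ifT; last lia.
  have -> : R - (R - i) = i by lia.
  by apply; lia.
have hr p : p \in to_letters w -> 0 < p.2 <= h.
  move=> pin; have hp := rw p pin; have [-> _] := andP hp; rewrite /= leqNgt; apply/negP => hp'.
  have := cc (R - p.2); rewrite /skew_content ifT; last lia.
  have -> : R - (R - p.2) = p.2 by lia.
  rewrite /part nth_default; last by move: hp hp'; rewrite /h; case: (p.2) => // j _ /=.
  have : 0 < row_count p.2 (to_letters w) by rewrite -has_count; apply/hasP; exists p.
  lia.
have LR : lattice [seq R - p.2 | p <- to_letters w] by rewrite -to_letters_snd cw.
have gw : proper_word lab_le rep h a len (to_letters w).
  split=> //; last exact/proper_word_lattice.
  by rewrite -to_letters_sorted ?cw ?ins_word_sorted ?ew //; apply: rowsR.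
have eW := filling_of_wordK ord0 lt ltr lan gw.
exists (filling_of_word ord0 h a len (to_letters w)); last by rewrite eW cw.
apply/andP; split; first exact/semistandard_proper_filling/proper_filling_of_word.
apply/forallP => b; rewrite -(count_pairs _ (pred1 b)) (permP (pairs_filling_of_word ord0 gw)).
by rewrite -bcount // cw ew cS.
Qed.

End SkewCount.

(** * Marked tableaux as recording words *)

Definition marked_lab_le n : rel (letter n * nat) := fun x y =>
  (letter_rank x.1 < letter_rank y.1) ||
  (letter_rank x.1 == letter_rank y.1) && (if primed x.1 then x.2 <= y.2 else y.2 <= x.2).

Definition marked_rep n : pred (letter n * nat) := fun x => ~~ primed x.1.

Lemma letter_rank_inj n : injective (@letter_rank n).
Proof.
move=> [b m] [b' m']; rewrite /letter_rank /primed /= => h.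
by congr pair; [apply: val_inj => /= |]; case: m m' h => [] []; lia.
Qed.

Lemma marked_lab_le_total n : total (@marked_lab_le n).
Proof.
move=> [l i] [l' i']; rewrite /marked_lab_le /=;
  case: (ltngtP (letter_rank l)) => //= /letter_rank_inj ->.
by case: (primed l'); lia.
Qed.

Lemma marked_lab_le_trans n : transitive (@marked_lab_le n).
Proof.
move=> [l i] [l' i'] [l'' i'']; rewrite /marked_lab_le /=.
case: (ltngtP (letter_rank l')) => // [h _|/letter_rank_inj-> /=].
  case: (ltngtP (letter_rank l)) => // [h' _|/letter_rank_inj<- _]; last by rewrite h.
  by rewrite (ltn_trans h h').
case: (ltngtP (letter_rank l)) => //= /letter_rank_inj->.
by case: (primed l''); lia.
Qed.

Lemma marked_lab_le_anti n : antisymmetric (@marked_lab_le n).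
Proof.
move=> [l i] [l' i']; rewrite /marked_lab_le /=;
  case: (ltngtP (letter_rank l)) => //= /letter_rank_inj -> h.
by congr pair; move: h; case: (primed l'); lia.
Qed.

(** A step is a marked letter together with its row. In both orders equal primed letters go down,
    equal unprimed ones go up, and only the latter may repeat in a row. *)
Lemma step_leE n (x y : letter n * nat) :
  cell_le (@marked_lab_le n) (@marked_rep n) x y = step_le (@ord_ltb n) x y.
Proof.
case: x y => [[b m] i] [[b' m'] i'].
rewrite /cell_le /marked_lab_le /marked_rep /step_le /le_step /letter_rank /primed /ord_ltb /=
  !xpair_eqE.
rewrite -!val_eqE /=; case: m m' => [] [] /=; rewrite ?andbT ?andbF ?orbT ?addn0 ?addn1 ?ltnS; lia.
Qed.

Lemma strict_parts_decr nu : is_strict_partition nu ->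
  (forall i, 0 < i < size nu -> part nu i.+1 < part nu i) /\
  (forall i, i < size nu -> 0 < nth 0 nu i).
Proof.
move=> /andP[sn n0]; split=> [[//|i] hi|i hi].
  by have /sortedP := sn; apply; lia.
by rewrite lt0n; apply: contraNneq n0 => <-; apply: mem_nth.
Qed.

Definition marked_word n (alpha : 'I_n -> nat) (nu : seq nat) (s : seq (letter n * nat)) :=
  [/\ sorted (step_le (@ord_ltb n)) s, step_path s,
      forall b, count (fun p => p.1.1 == b) s = alpha b &
      forall i, row_count i.+1 s = nth 0 nu i].

Section MarkedCount.

Variables (n : nat) (nu : seq nat) (alpha : 'I_n.+1 -> nat).
Hypothesis nu_strict : is_strict_partition nu.

Let h := size nu.
Let lab_le := @marked_lab_le n.+1.
Let rep := @marked_rep n.+1.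
Let l0 : letter n.+1 := (ord0, false).

Lemma marked_proper_filling (T : filling (shifted_diagram nu) (letter n.+1)) :
  marked_shifted_tableau T <->
  proper_filling (h := h) (a := id) (n := part nu) lab_le rep T /\
  forall c, (val c).1 == (val c).2 -> ~~ primed (T c).
Proof.
have E c d : cell_le lab_le rep (T c, (val c).1) (T d, (val d).1) =
    (letter_rank (T c) < letter_rank (T d)) || (letter_rank (T c) == letter_rank (T d)) &&
    if primed (T c) then (val c).1 < (val d).1 else (val d).1 <= (val c).1.
  rewrite /cell_le /lab_le /marked_lab_le /rep /marked_rep /= xpair_eqE.
  case: (ltngtP (letter_rank (T c))) => [e|e|/letter_rank_inj ->] //=.
    by case: eqP => // ee; rewrite ee ltnn in e.
  rewrite eqxx /=; case: (primed (T d)) => /=; last by rewrite orbT andbT.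
  by rewrite orbF ltn_neqAle andbC.
split=> [/andP[/forallP hT /forallP hd]|[hT hd]].
  split=> [c d lr|c ec]; last exact: (implyP (hd c)).
  have /forallP /(_ d) /and3P[/implyP h1 /implyP h2 /implyP h3] := hT c.
  rewrite E; have := h1 lr; rewrite /letter_le leq_eqVlt => /orP[/eqP e|->//].
  rewrite e eqxx ltnn /=; move: h2 h3; rewrite /letter_lt e ltnn (letter_rank_inj e).
  case/orP: lr => lr; rewrite lr; have [/eqP ec lt] := andP lr.
    by rewrite ec leqnn; case: (primed (T d)) => // _ /(_ isT).
  by case: (primed (T d)) => // /(_ isT).
apply/andP; split; last by apply/forallP => c; apply/implyP/hd.
apply/forallP => c; apply/forallP => d; apply/and3P; split; apply/implyP => lr.
- have := hT c d lr; rewrite E /letter_le => /orP[/ltnW //|/andP[/eqP -> //]].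
- case/and3P: lr => lr p1 p2; have := hT c d; rewrite lr orbT E (negbTE p1) /letter_lt => /(_ isT).
  by case/orP => // /andP[_]; case/andP: lr => _ lt; rewrite leqNgt lt.
- case/and3P: lr => lr p1 p2; have := hT c d; rewrite lr E p1 /letter_lt => /(_ isT).
  by case/orP => // /andP[_]; case/andP: lr => /eqP -> _; rewrite ltnn.
Qed.

Lemma sorted_step_le (s : seq (letter n.+1 * nat)) :
  sorted (cell_le lab_le rep) s = sorted (step_le (@ord_ltb n.+1)) s.
Proof. by apply: eq_sorted => x y; rewrite step_leE. Qed.

(** The step that opens a row fills its diagonal cell, so the condition on marks is the absence of
    primes on the diagonal. *)
Lemma step_path_proper_word (s : seq (letter n.+1 * nat)) :
  proper_word lab_le rep h id (part nu) s ->
  step_path s <-> forall i b, 0 < i <= h -> nth l0 (row_labels i s) 0 <> (b, true).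
Proof.
have [mono pos] := strict_parts_decr nu_strict.
move=> [ss hr hc lin]; split=> [[_ _ h3] i b hi e|hd].
  have [|m [ms hm hk]] := @row_labels_pos _ l0 s i 0.
    by rewrite hc // /part pos //; lia.
  by have := h3 m b i ms; rewrite hm e hk => /(_ erefl).
split.
- by move=> p /hr /andP[].
- exact/(linear_ext_shifted mono hr hc).
- move=> m b i ms hm; rewrite lt0n; apply/negP => /eqP k0.
  have := row_labels_head l0 hm; rewrite k0 => /hd; apply.
  by have := hr (b, true, i); apply; rewrite (ohead_drop_cat hm) mem_cat mem_head orbT.
Qed.

Lemma mem_shifted_diagram i j :
  ((i, j) \in shifted_diagram nu) = (0 < i <= h) && (i <= j < i + part nu i).
Proof. exact: (mem_rows_diagram h id (part nu)). Qed.

Lemma marked_card : card_is (marked_word alpha nu)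
    #|[pred T : filling (shifted_diagram nu) (letter n.+1) |
        marked_shifted_tableau T && [forall b, #|[pred c | (T c).1 == b]| == alpha b]]|.
Proof.
have [mono pos] := strict_parts_decr nu_strict.
have [lt ltr lan] : [/\ total lab_le, transitive lab_le & antisymmetric lab_le].
  by split; [exact: marked_lab_le_total | exact: marked_lab_le_trans | exact: marked_lab_le_anti].
have diag (ws : seq (letter n.+1 * nat)) : (forall i b, 0 < i <= h -> nth l0 (row_labels i ws) 0
  <> (b, true)) <->
    forall c : seq_sub (shifted_diagram nu), (val c).1 == (val c).2 ->
      ~~ primed (filling_of_word l0 h id (part nu) ws c).
  split=> [hd [[i j] cD] /= /eqP e|hd i b hi e].
    subst j; rewrite ffunE /= subnn; have := hd i; move: (cD);
      rewrite mem_shifted_diagram => /andP[hi _].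
    by case: (nth _ _ _) => b [] // /(_ b hi).
  have cD : (i, i) \in shifted_diagram nu.
    by rewrite mem_shifted_diagram hi leqnn -{1}[i]addn0 ltn_add2l /part pos //; lia.
  by have := hd (SeqSub cD); rewrite /= eqxx ffunE /= subnn e => /(_ isT).
apply: (card_is_bij (f := fun T => word_of_filling lab_le (h := h) (a := id) (n := part nu) T) _ _
  _ (card_is_pred _)).
- move=> T /andP[/marked_proper_filling[gT hd] /forallP cT].
  have [gw eT] := proper_word_of_filling l0 lt ltr lan gT; have [sw hr hc lin] := gw.
  split.
  + by rewrite -sorted_step_le.
  + by apply/(step_path_proper_word gw)/diag => c; rewrite eT; apply: hd.
  + move=> b; rewrite (permP (permEl (perm_sort _ _))).
    by rewrite (count_pairs T (fun l => l.1 == b)); apply/eqP/cT.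
  + move=> i; case: (ltnP i h) => ih; first by rewrite hc.
    by rewrite (row_count_out hr) ?nth_default //; lia.
- move=> T T' /andP[/marked_proper_filling[gT _] _] /andP[/marked_proper_filling[gT' _] _] E.
  have [_ eT] := proper_word_of_filling l0 lt ltr lan gT;
    have [_ eT'] := proper_word_of_filling l0 lt ltr lan gT'.
  by rewrite -eT -eT' E.
move=> s [ss ps cs rs].
have hr p : p \in s -> 0 < p.2 <= h.
  move=> pin; have [h1 _ _] := ps; have p0 := h1 p pin; rewrite p0 /= leqNgt; apply/negP => hp.
  have := rs p.2.-1; rewrite prednK // nth_default; last by move: p0 hp; rewrite /h; case: (p.2).
  have : 0 < row_count p.2 s by rewrite -has_count; apply/hasP; exists p.
  by move=> + e; rewrite e.
have hc i : 0 < i <= h -> row_count i s = part nu i by case: i => // i _; rewrite rs.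
have gw : proper_word lab_le rep h id (part nu) s.
  split=> //; first by rewrite sorted_step_le.
  by apply/(linear_ext_shifted mono hr hc); case: ps.
have eW := filling_of_wordK l0 lt ltr lan gw.
exists (filling_of_word l0 h id (part nu) s) => //.
apply/andP; split.
  by apply/marked_proper_filling; split;
    [exact: proper_filling_of_word | apply/diag/(step_path_proper_word gw)].
apply/forallP => b;
  rewrite -(count_pairs _ (fun l => l.1 == b)) (permP (pairs_filling_of_word l0 gw)).
by rewrite cs.
Qed.

End MarkedCount.

(** * The tableaux of the theorem as lists of rows *)

Lemma valid_nth (R : seq (seq nat)) : valid R <-> forall i, i < size R ->
  [/\ sorted leq (nth [::] R i), nth [::] R i != [::] & dom (nth [::] R i) (nth [::] R i.+1)].
Proof.
elim: R => [|u R IH] /=; first by split.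
split=> [[su un d v] [|i] h|hR] /=; first by rewrite nth0.
  exact: (proj1 IH v i h).
have [su un d] := hR 0 isT; rewrite /= nth0 in d; split=> //.
by apply/IH => i h; apply: (hR i.+1 h).
Qed.

Lemma below_nth u q k : sorted leq u -> q < size u -> (q < below u k) = (nth 0 u q < k).
Proof.
elim: u q => [//|x u IH] q su qu; rewrite below_cons; case: q qu => [|q] qu /=.
  case: (ltnP x k) => xk; first by rewrite ltn_addr.
  rewrite below0 // => e /(sorted_head su); exact: leq_trans.
have su' : sorted leq u by case: (u) su => //= a s /andP[].
case: (ltnP x k) => xk; first by rewrite add1n ltnS IH.
rewrite below0 => [|e /(sorted_head su)]; last exact: leq_trans.
apply/esym/negbTE; rewrite -leqNgt; apply: leq_trans xk _.
by apply: (sorted_head su); apply: mem_nth.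
Qed.

(** In a shifted diagram the entry [q] of a row lies under the entry [q + 1] of the row above, so
    this is column strictness. *)
Lemma dom_nthP u l : sorted leq u -> sorted leq l -> size l < size u ->
  dom u l <-> forall q, q < size l -> nth 0 u q.+1 < nth 0 l q.
Proof.
move=> su sl s; split=> [d q ql|h k].
  have qu : q.+1 < size u by lia.
  rewrite -(below_nth _ su qu); have := d (nth 0 l q).
  have : q < below l (nth 0 l q).+1 by rewrite (below_nth _ sl ql).
  lia.
case: (posnP (below l k.+1)) => [|b0]; [by left | right].
have hb := below_size l k.+1; have q : (below l k.+1).-1 < size l by lia.
have := h _ q; rewrite prednK // => hq.
rewrite (below_nth k su); last lia.
apply: leq_trans hq _; rewrite -ltnS -(below_nth _ sl q); lia.
Qed.

Definition lattice_rows r la nu (Q : seq (seq nat)) :=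
  [/\ valid Q, lattice (row_word Q), forall i, size (nth [::] Q i) = nth 0 nu i
    & forall k, occ k (flatten Q) = skew_content r la k].

Section TableauxA.

Variables (r : nat) (la nu : seq nat).
Hypothesis nu_strict : is_strict_partition nu.
Hypothesis la1 : part la 1 <= r.+1.

Local Notation D := (shifted_diagram nu).
Implicit Type Q : filling D 'I_r.+1.

Lemma entry_val Q (c : seq_sub D) : entry Q (val c) = (Q c).+1.
Proof. by rewrite /entry valK. Qed.

Lemma entry_prim Q i j : (i, j) \in D -> (entry Q (i, j)).-1.+1 = entry Q (i, j).
Proof. by move=> cD; rewrite -[(i, j)]/(val (SeqSub cD)) entry_val. Qed.

Definition tab_row Q i := [seq (entry Q (i, j)).-1 | j <- iota i (part nu i)].
Definition tab_rows Q := [seq tab_row Q i | i <- iota 1 (size nu)].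

Lemma size_tab_rows Q : size (tab_rows Q) = size nu.
Proof. by rewrite size_map size_iota. Qed.

Lemma nth_tab_rows Q i : i < size nu -> nth [::] (tab_rows Q) i = tab_row Q i.+1.
Proof. by move=> h; rewrite (nth_map 0) ?size_iota // nth_iota // add1n. Qed.

Lemma size_tab_row Q i : size (tab_row Q i) = part nu i.
Proof. by rewrite size_map size_iota. Qed.

Lemma nth_tab_row Q i q : q < part nu i -> nth 0 (tab_row Q i) q = (entry Q (i, i + q)).-1.
Proof. by move=> h; rewrite (nth_map 0) ?size_iota // nth_iota. Qed.

Lemma w_revE Q : w_rev Q = map succn (row_word (tab_rows Q)).
Proof.
rewrite /w_rev /row_word /tab_rows -map_rev map_flatten -map_comp.
congr flatten; apply/eq_in_map => i; rewrite mem_rev mem_iota => hi /=.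
rewrite /tab_row -map_comp; apply/eq_in_map => j; rewrite mem_iota => hj /=.
by rewrite entry_prim // mem_shifted_diagram; apply/andP; split => //; lia.
Qed.

Lemma occ_tab_rows Q k : occ k (flatten (tab_rows Q)) = #|[pred c | Q c == k :> nat]|.
Proof.
rewrite -(@count_pairs 'I_r.+1 (size nu) id (part nu) Q (fun x : 'I_r.+1 => x == k :> nat)).
rewrite (permP (perm_pairs ord0 _)) count_map /occ /rows_diagram /tab_rows.
rewrite !count_flatten -!map_comp; congr sumn; apply/eq_in_map => i.
rewrite mem_iota => hi /=; rewrite /tab_row !count_map; apply: eq_in_count => j.
rewrite mem_iota => hj /=; have cD : (i, j) \in D.
  by rewrite mem_shifted_diagram; apply/andP; split => //; lia.
by rewrite -[(i, j)]/(val (SeqSub cD)) entry_val (@ext_filling_val _ ord0 (size nu) id (part nu)).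
Qed.

Lemma semistandard_valid Q : semistandard Q <-> valid (tab_rows Q).
Proof.
have [mono pos] := strict_parts_decr nu_strict.
have szd i : i.+1 < size nu -> size (tab_row Q i.+2) < size (tab_row Q i.+1).
  by move=> h; rewrite !size_tab_row; apply: mono.
split=> [/forallP hT|/valid_nth hv].
  have srt i : 0 < i <= size nu -> sorted leq (tab_row Q i).
    move=> hi; apply/(sortedP 0) => q; rewrite size_tab_row => hq.
    rewrite !nth_tab_row //; last by rewrite ltnW.
    have c1 : (i, i + q) \in D by rewrite mem_shifted_diagram; apply/andP; split=> //; lia.
    have c2 : (i, i + q.+1) \in D by rewrite mem_shifted_diagram; apply/andP; split=> //; lia.
    rewrite -[(i, i + q)]/(val (SeqSub c1)) -[(i, i + q.+1)]/(val (SeqSub c2)) !entry_val /=.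
    have /forallP /(_ (SeqSub c2)) /andP[/implyP h _] := hT (SeqSub c1).
    by apply: h; rewrite /left_of /= eqxx ltn_add2l ltnS leqnn.
  apply/valid_nth => i; rewrite size_tab_rows => hi; rewrite nth_tab_rows //.
  split; first exact: srt.
    by rewrite -size_eq0 size_tab_row -lt0n pos.
  case: (ltnP i.+1 (size nu)) => hi2; last by rewrite nth_default ?size_tab_rows //; left.
  rewrite nth_tab_rows //; apply/dom_nthP; [exact: srt | by apply: srt; lia | exact: szd |].
  move=> q; rewrite size_tab_row => hq; have m := mono i.+1; rewrite /= in m.
  rewrite !nth_tab_row //; last by have := m hi2; lia.
  have c1 : (i.+1, i.+1 + q.+1) \in D.
    by rewrite mem_shifted_diagram; apply/andP; split=> //; have := m hi2; lia.
  have c2 : (i.+2, i.+2 + q) \in D by rewrite mem_shifted_diagram; apply/andP; split=> //; lia.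
  rewrite -[(i.+1, _)]/(val (SeqSub c1)) -[(i.+2, _)]/(val (SeqSub c2)) !entry_val /=.
  have /forallP /(_ (SeqSub c2)) /andP[_ /implyP h] := hT (SeqSub c1).
  by apply: h; rewrite /above /= ltnSn andbT; apply/eqP; lia.
have srt i : 0 < i <= size nu -> sorted leq (tab_row Q i).
  by case: i => // i hi; have := hv i; rewrite size_tab_rows nth_tab_rows // => /(_ hi) [].
have step i (j : nat) (cD : (i.+1, j) \in D) (dD : (i.+2, j) \in D) : Q (SeqSub cD) < Q (SeqSub dD).
  have := cD; have := dD; rewrite !mem_shifted_diagram => /andP[hi2 hj2] /andP[hi hj].
  have hi' : i < size nu by lia.
  have [] := hv i; rewrite ?size_tab_rows //.
  rewrite !nth_tab_rows //.
  move=> _ _ /dom_nthP; rewrite !srt ?szd //.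
  move=> /(_ isT isT isT (j - i.+2)); rewrite size_tab_row => h.
  have m : part nu i.+2 < part nu i.+1 by apply: mono; lia.
  have := h _; rewrite !nth_tab_row; [|lia|lia].
  have -> : i.+1 + (j - i.+2).+1 = j by lia.
  have -> : i.+2 + (j - i.+2) = j by lia.
  rewrite -[(i.+1, j)]/(val (SeqSub cD)) -[(i.+2, j)]/(val (SeqSub dD)) !entry_val /=.
  by apply; lia.
(* Columns have no gaps because [nu] is strict, so neighbouring rows suffice. *)
have chain k i (j : nat) (cD : (i.+1, j) \in D) (dD : (i.+1 + k.+1, j) \in D) :
    Q (SeqSub cD) < Q (SeqSub dD).
  elim: k i cD dD => [|k IH] i cD dD.
    have eD : (i.+2, j) \in D by rewrite -addn1.
    have -> : SeqSub dD = SeqSub eD by apply: val_inj; rewrite /= addn1.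
    exact: step.
  have eD : (i.+2, j) \in D.
    have := cD; have := dD; rewrite !mem_shifted_diagram => /andP[hi2 hj2] /andP[hi hj].
    have dec m : i.+2 + m <= size nu -> part nu (i.+2 + m) + m <= part nu i.+2.
      elim: m => [|m IHm] hm; first by rewrite !addn0.
      by rewrite !addnS in hm *; have := mono (i.+2 + m); have := IHm; lia.
    have := dec k.+1; have e : i.+2 + k.+1 = i.+1 + k.+2 by rewrite addSnnS.
    by rewrite e => d; apply/andP; split; lia.
  have d'D : (i.+2 + k.+1, j) \in D by rewrite addSnnS.
  apply: ltn_trans (step _ _ cD eD) _.
  have -> : SeqSub dD = SeqSub d'D by apply: val_inj; rewrite /= (addSnnS i.+1).
  exact: IH.
apply/forallP => -[[i j] cD]; apply/forallP => -[[i' j'] dD]; apply/andP; split; apply/implyP;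
  rewrite /left_of /above /= => /andP[/eqP e lt]; [subst i' | subst j'].
  have := cD; have := dD; rewrite !mem_shifted_diagram => /andP[hi2 hj2] /andP[hi hj].
  have := sorted_leq_nth leq_trans leqnn 0 (srt _ hi) (j - i) (j' - i).
  rewrite !inE size_tab_row => h; have := h _ _ _; rewrite !nth_tab_row; [|lia|lia].
  rewrite !subnKC; [|lia|lia].
  rewrite -[(i, j)]/(val (SeqSub cD)) -[(i, j')]/(val (SeqSub dD)) !entry_val /=.
  by apply; lia.
have := cD; rewrite mem_shifted_diagram => /andP[hi _]; case: i cD lt hi => // i cD lt _.
have e : i' = i.+1 + (i' - i.+2).+1 by lia.
have d'D : (i.+1 + (i' - i.+2).+1, j) \in D by rewrite -e.
have -> : SeqSub dD = SeqSub d'D by apply: val_inj; rewrite /= -e.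
exact: chain.
Qed.


Lemma map_size_tab_rows Q : map size (tab_rows Q) = nu.
Proof.
apply: (@eq_from_nth _ 0); first by rewrite size_map size_tab_rows.
move=> i; rewrite size_map size_tab_rows => hi.
by rewrite (nth_map [::]) ?size_tab_rows // nth_tab_rows // size_tab_row.
Qed.

Lemma size_row_word_tab Q : size (row_word (tab_rows Q)) = sumn nu.
Proof.
by rewrite (perm_size (perm_row_word _)) size_flatten /shape map_size_tab_rows.
Qed.

Lemma letter_countE Q k : letter_count Q k.+1 = occ k (flatten (tab_rows Q)).
Proof. by rewrite occ_tab_rows /letter_count cardsE; apply: eq_card => c; rewrite !inE. Qed.

Lemma content_tab Q :
  all (fun k => letter_count Q k == part la (r + 2 - k) + 1 - k) (iota 1 r.+1) <->
  forall k, occ k (flatten (tab_rows Q)) = skew_content r la k.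
Proof.
have E k : part la (r + 2 - k.+1) + 1 - k.+1 = part la (r.+1 - k) - k.
  by rewrite addn2 subSS addn1 subSS.
split=> [/allP h k|h].
  rewrite /skew_content; case: ltnP => kr.
    by have := h k.+1; rewrite mem_iota letter_countE E => /(_ _)/eqP; apply; lia.
  rewrite occ_tab_rows; apply: eq_card0 => c; rewrite inE; apply/negbTE/eqP => e.
  by have := ltn_ord (Q c); rewrite e; lia.
apply/allP => -[|k]; rewrite mem_iota // => hk.
by rewrite letter_countE E h /skew_content ifT //; lia.
Qed.

(** The content supplies the inequalities for [k >= r]: with letters numbered from 0, the letter [r]
    occurs at most once since the first part of [la] is at most [r + 1], and larger letters do not
    occur. *)
Lemma lattice_tab Q : (forall k, occ k (flatten (tab_rows Q)) = skew_content r la k) ->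
  all (fun k => all (fun i =>
      count_mem k (take i (w_rev Q)) <= count_mem k.+1 (take i (w_rev Q)) + 1)
    (iota 1 (sumn nu))) (iota 1 r) <-> lattice (row_word (tab_rows Q)).
Proof.
move=> hc; have C i k : count_mem k.+1 (take i (w_rev Q)) = occ k (take i (row_word (tab_rows Q))).
  by rewrite w_revE -map_take count_map; apply: eq_count => x; rewrite /= eqSS.
have O k m : occ k (take m (row_word (tab_rows Q))) <= skew_content r la k.
  rewrite -hc -(occ_perm _ (perm_row_word _)) -{2}(cat_take_drop m (row_word _)) occ_cat.
  exact: leq_addr.
split=> [/allP h m k|h]; last first.
  apply/allP => -[|k]; rewrite mem_iota // => _; apply/allP => i _.
  by rewrite !C addn1; apply: h.
case: (ltnP k r) => kr; last first.
  apply: leq_trans (O k m) _; rewrite /skew_content; case: ltnP => // kr'.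
  have -> : k = r by lia.
  by rewrite (_ : r.+1 - r = 1) ?subSnn //; lia.
have {}h i : 0 < i <= sumn nu -> occ k (take i (row_word (tab_rows Q))) <= (occ k.+1 (take i
  (row_word (tab_rows Q)))).+1.
  move=> hi; have := h k.+1; rewrite mem_iota => /(_ _)/allP => h'.
  have := h' _ i; rewrite mem_iota !C addn1; apply; lia.
case: (posnP m) => [->|m0]; first by rewrite take0.
case: (leqP m (sumn nu)) => mN; first by apply: h; rewrite m0.
have := h (sumn nu); rewrite !take_oversize ?size_row_word_tab //; last exact: ltnW.
case: (posnP (sumn nu)) => [N0|N0]; last by apply; rewrite leqnn.
have : size (row_word (tab_rows Q)) = 0 by rewrite size_row_word_tab.
by move/size0nil => ->.
Qed.

Lemma tableaux_A_rows Q : Q \in tableaux_A r la nu <-> lattice_rows r la nu (tab_rows Q).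
Proof.
have sz i : size (nth [::] (tab_rows Q) i) = nth 0 nu i.
  case: (ltnP i (size nu)) => hi; first by rewrite nth_tab_rows // size_tab_row.
  by rewrite !nth_default ?size_tab_rows.
rewrite inE; split=> [/and3P[/semistandard_valid v /content_tab c l]|[v l _ c]].
  by split=> //; apply/lattice_tab.
by apply/and3P; split; [exact/semistandard_valid | exact/content_tab | exact/lattice_tab].
Qed.

Lemma tableaux_A_card : card_is (lattice_rows r la nu) #|tableaux_A r la nu|.
Proof.
have [mono pos] := strict_parts_decr nu_strict.
have cardA : card_is (fun Q => Q \in tableaux_A r la nu) #|tableaux_A r la nu|.
  exact: card_is_pred.
apply: (card_is_bij (f := tab_rows) _ _ _ cardA).
- by move=> Q /tableaux_A_rows.
- move=> Q Q' _ _ E; apply/ffunP => -[[i j] cD].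
  have := cD; rewrite mem_shifted_diagram => /andP[hi hj].
  have := congr1 (fun s => nth 0 (nth [::] s i.-1) (j - i)) E.
  rewrite !nth_tab_rows; [|lia|lia]; rewrite prednK; last lia.
  rewrite !nth_tab_row; [|lia|lia]; rewrite subnKC; last lia.
  by rewrite -[(i, j)]/(val (SeqSub cD)) !entry_val => /= e; apply: val_inj.
move=> R hR; have [v l s c] := hR.
have sR : size R = size nu.
  have vn := proj1 (valid_nth R) v; apply/eqP; rewrite eqn_leq; apply/andP; split;
    rewrite leqNgt; apply/negP => h.
    by have [_ + _] := vn _ h; rewrite -size_eq0 s nth_default ?leqnn // eqxx.
  by have := pos _ h; rewrite -s nth_default.
have bnd i q : nth 0 (nth [::] R i) q < r.+1.
  case: (ltnP i (size R)) => iR; last by rewrite (nth_default [::]) // nth_nil.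
  case: (ltnP q (size (nth [::] R i))) => qR; last by rewrite (nth_default 0).
  have : 0 < occ (nth 0 (nth [::] R i) q) (flatten R).
    by rewrite occ_gt0; apply/flattenP; exists (nth [::] R i); apply: mem_nth.
  by rewrite c /skew_content; case: ifP.
pose Q : filling D 'I_r.+1 :=
  [ffun c : seq_sub D => inord (nth 0 (nth [::] R (val c).1.-1) ((val c).2 - (val c).1))].
suff E : tab_rows Q = R by exists Q => //; apply/tableaux_A_rows; rewrite E.
apply: (@eq_from_nth _ [::]); first by rewrite size_tab_rows.
move=> i; rewrite size_tab_rows => hi; rewrite nth_tab_rows //.
apply: (@eq_from_nth _ 0); first by rewrite size_tab_row s.
move=> q; rewrite size_tab_row => hq; rewrite nth_tab_row //.
have cD : (i.+1, i.+1 + q) \in D by rewrite mem_shifted_diagram; apply/andP; split; lia.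
by rewrite -[(i.+1, _)]/(val (SeqSub cD)) entry_val ffunE /= inordK // addKn.
Qed.

End TableauxA.

(** * Coefficients *)

Import GRing.Theory.

Definition skew_count n r la (alpha : 'I_n -> nat) :=
  #|[pred T : filling (skew_diagram la (staircase r)) 'I_n |
      semistandard T && [forall b, #|[pred c | T c == b]| == alpha b]]|.

Definition marked_count n nu (alpha : 'I_n -> nat) :=
  #|[pred T : filling (shifted_diagram nu) (letter n) |
      marked_shifted_tableau T && [forall b, #|[pred c | (T c).1 == b]| == alpha b]]|.

Lemma valid_shape_strict (Q : seq (seq nat)) : valid Q -> is_strict_partition (map size Q).
Proof.
move=> v; apply/andP; split.
  apply/(sortedP 0) => i; rewrite size_map => hi.
  rewrite !(nth_map [::]) //; last exact: ltnW.
  have [_ _ d] := proj1 (valid_nth Q) v i (ltnW hi).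
  by apply: dom_size => //; have [] := proj1 (valid_nth Q) v i.+1 hi.
apply/negP => /mapP[u uQ /esym/size0nil u0].
have [_ + _] := proj1 (valid_nth Q) v (index u Q) (etrans (index_mem u Q) uQ).
by rewrite nth_index // u0.
Qed.

Section CountIdentity.

Variables (n r : nat) (la : seq nat) (alpha : 'I_n.+1 -> nat).
Hypotheses (la_part : is_partition la)
  (delta_la : {subset diagram (staircase r) <= diagram la})
  (la_box : {subset diagram la <= diagram (nseq r.+1 r.+1)}).

(** Insertion states are split by shape, and those of shape [mu] are pairs of tableaux. Any larger
    list of shapes is allowed, because the support of the given expansion has to be adjoined
    later. *)
Lemma skew_count_sum : exists U0 : seq strict_partition, forall U, uniq U -> {subset U0 <= U} ->
  skew_count r la alpha = \sum_(mu <- U) #|tableaux_A r la mu| * marked_count mu alpha.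
Proof.
have [_ la1 _ _] := partition_parts la_part delta_la la_box.
have cS := skew_card la_part delta_la la_box alpha.
have {}cS : card_is (insertion_state alpha (skew_content r la)) (skew_count r la alpha).
  by rewrite /skew_count skew_diagramE.
have [s [us hs ss]] := cS.
exists (pmap insub [seq map size St.1 | St <- s]) => U uU hU.
rewrite -(big_map (@strict_parts) predT (fun mu => #|tableaux_A r la mu| * marked_count mu alpha)).
apply: (card_is_split (f := fun S => map size S.1)) cS.
- by rewrite map_inj_uniq //; apply: val_inj.
- move=> S hS; have [[v _ _ _] _ _ _] := hS.
  have sv := valid_shape_strict v.
  apply/mapP; exists (StrictPartition sv) => //; apply: hU.
  by rewrite mem_pmap_sub /=; apply: map_f; apply/hs.
- move=> _ /mapP[mu _ ->]; have mus : is_strict_partition mu := valP mu.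
  apply: (card_is_bij (f := id) _ _ _ (card_is_prod (tableaux_A_card mus la1) (marked_card alpha
    mus))) => //=.
  + move=> [Q t] [[/= v L sz c] [st ps ca rc]]; split.
      by split=> //; split=> // i; rewrite rc sz.
    apply: (@eq_from_nth _ 0) => [|i]; rewrite size_map.
      apply/eqP; rewrite eqn_leq; apply/andP; split; rewrite leqNgt; apply/negP => h.
        have [_ + _] := proj1 (valid_nth Q) v _ h; rewrite -size_eq0 sz nth_default ?leqnn //.
      by have [_ pos] := strict_parts_decr mus; have := pos _ h; rewrite -sz nth_default.
    by move=> iQ; rewrite (nth_map [::]).
  + move=> [Q t] [[[/= v L ps rc] st ca c] sh]; exists (Q, t) => //=.
    have sz i : size (nth [::] Q i) = nth 0 mu i.
      rewrite -sh; case: (ltnP i (size Q)) => iQ; first by rewrite (nth_map [::]).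
      by rewrite !nth_default ?size_map.
    by split; split=> // i; rewrite rc.
Qed.

End CountIdentity.

Local Open Scope ring_scope.

Lemma mcoeff_filling (n : nat) (D : seq (nat * nat)) (L : finType) (P : pred (filling D L))
    (g : L -> 'I_n) (m : 'X_{1..n}) :
  (\sum_(T : filling D L | P T) \prod_(c : seq_sub D) 'X_(g (T c)) : {mpoly rat[n]})@_m =
  #|[pred T | P T && [forall b, #|[pred c | g (T c) == b]| == m b]]|%:R.
Proof.
rewrite raddf_sum /= -sum1_card natr_sum big_mkcond [RHS]big_mkcond /=.
apply: eq_bigr => T _; rewrite inE; case: (P T) => //=.
rewrite mprodXE mcoeffX.
suff -> : (\sum_(c : seq_sub D) U_(g (T c)) == m)%MM =
    [forall b, #|[pred c | g (T c) == b]| == m b] by case: [forall b, _].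
have E b : (\sum_(c : seq_sub D) U_(g (T c)))%MM b = #|[pred c | g (T c) == b]|.
  rewrite mnm_sumE -sum1_card [RHS]big_mkcond /=.
  by apply: eq_bigr => c _; rewrite mnm1E inE; case: eqP.
apply/eqP/forallP => [<- b|h]; first by rewrite E.
by apply/mnmP => b; rewrite E; apply/eqP.
Qed.

Lemma mcoeff_skew_schur n r la (m : 'X_{1..n}) :
  (skew_schur n la (staircase r))@_m = (skew_count r la m)%:R.
Proof. exact: (mcoeff_filling _ id). Qed.

Lemma mcoeff_schurP n nu (m : 'X_{1..n}) : (schurP n nu)@_m = (marked_count nu m)%:R.
Proof. exact: (mcoeff_filling _ fst). Qed.

Local Close Scope ring_scope.

(* The statistic [n(nu)] of Macdonald. *)
Definition row_weight (nu : seq nat) := \sum_(i < size nu) i * nth 0 nu i.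

Lemma sum_cells h a len (F : nat * nat -> nat) :
  \sum_(c : seq_sub (rows_diagram h a len)) F (val c) =
  \sum_(i <- iota 1 h) \sum_(j <- iota (a i) (len i)) F (i, j).
Proof.
rewrite -(big_map (fun c => val c) predT F) /index_enum -enumT.
rewrite (perm_big _ (perm_enum_sub h a len)) /rows_diagram big_flatten big_map.
by apply: eq_bigr => i _; rewrite big_map.
Qed.

Lemma row_weight_cells (nu : seq nat) :
  \sum_(c : seq_sub (shifted_diagram nu)) (val c).1.-1 = row_weight nu.
Proof.
rewrite (sum_cells (size nu) id (part nu) (fun c => c.1.-1)) /row_weight.
rewrite -(big_mkord predT (fun i => i * nth 0 nu i)) -[1]addn0 iotaDl big_map /index_iota subn0.
apply: eq_bigr => i _; rewrite add1n /= big_const_seq iter_addn_0 count_predT size_iota.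
by rewrite mulnC.
Qed.

Lemma card_row nu b :
  #|[pred c : seq_sub (shifted_diagram nu) | (val c).1.-1 == b]| = nth 0 nu b.
Proof.
rewrite -sum1_card big_mkcond /=.
rewrite (sum_cells (size nu) id (part nu) (fun c => if c.1.-1 == b then 1 else 0)).
rewrite (iotaDl 1 0) big_map.
rewrite (eq_bigr (fun i => if i == b then nth 0 nu i else 0)); last first.
  move=> i _; rewrite add1n /= big_const_seq iter_addn_0 count_predT size_iota.
  by case: eqP => _; rewrite ?mul1n.
have -> : iota 0 (size nu) = index_iota 0 (size nu) by rewrite /index_iota subn0.
rewrite -big_mkcond big_nat1_eq /=; case: ltnP => // h; by rewrite nth_default.
Qed.

(** * Triangularity of the Schur P-functions *)

Section Dominance.

Variables (n : nat) (mu : seq nat) (T : filling (shifted_diagram mu) (letter n)).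
Hypotheses (mu_strict : is_strict_partition mu) (hT : marked_shifted_tableau T).

Lemma marked_le (c d : seq_sub (shifted_diagram mu)) : left_of c d || above c d ->
  letter_le (T c) (T d).
Proof.
by move=> h; case/andP: hT => /forallP /(_ c) /forallP /(_ d) /and3P[/implyP /(_ h)].
Qed.

(** The cell [(i, i + 1)] lies between the two diagonal cells, whose entries are unprimed. Equal
    labels would make its entry equal to both, against the strictness of unprimed letters in
    columns. *)
Lemma marked_diag_lt i (cD : (i, i) \in shifted_diagram mu)
    (dD : (i.+1, i.+1) \in shifted_diagram mu) : (T (SeqSub cD)).1 < (T (SeqSub dD)).1.
Proof.
have [mono pos] := strict_parts_decr mu_strict.
case/andP: hT => /forallP ht /forallP hd.
have pc : ~~ primed (T (SeqSub cD)) by apply: (implyP (hd _)) => /=.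
have pd : ~~ primed (T (SeqSub dD)) by apply: (implyP (hd _)) => /=.
have eD : (i, i.+1) \in shifted_diagram mu.
  have := cD; have := dD; rewrite !mem_shifted_diagram => /andP[hi2 hj2] /andP[hi hj].
  by have mi := mono i; apply/andP; split; lia.
have h1 : letter_le (T (SeqSub cD)) (T (SeqSub eD)).
  by apply: marked_le; rewrite /left_of /= eqxx ltnSn.
have h2 : above (SeqSub eD) (SeqSub dD) by rewrite /above /= eqxx ltnSn.
have h3 : letter_le (T (SeqSub eD)) (T (SeqSub dD)) by apply: marked_le; rewrite h2 orbT.
have /forallP /(_ (SeqSub dD)) /and3P[_ /implyP h4 _] := ht (SeqSub eD).
rewrite ltnNge; apply/negP => le; move: h1 h3 h4; rewrite h2 pd /= andbT.
move: pc pd; rewrite /letter_le /letter_lt /letter_rank => -> ->.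
move: le; move: (nat_of_ord _) (nat_of_ord _) (nat_of_ord _) => c d e.
by case: (primed _) => /= le h1 h3; [|move/(_ isT)]; lia.
Qed.

Lemma marked_diag_ge i (cD : (i.+1, i.+1) \in shifted_diagram mu) : i <= (T (SeqSub cD)).1.
Proof.
elim: i cD => // i IH cD; have [mono pos] := strict_parts_decr mu_strict.
have dD : (i.+1, i.+1) \in shifted_diagram mu.
  have := cD; rewrite !mem_shifted_diagram => /andP[hi hj].
  by have p := pos i; move: hj; rewrite /part /= => hj; apply/andP; split; lia.
exact: leq_ltn_trans (IH dD) (marked_diag_lt dD cD).
Qed.

Lemma marked_ge (c : seq_sub (shifted_diagram mu)) : (val c).1.-1 <= (T c).1.
Proof.
case: c => -[i j] cD /=; have [mono pos] := strict_parts_decr mu_strict.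
have := cD; rewrite mem_shifted_diagram => /andP[hi hj].
have dD : (i, i) \in shifted_diagram mu by rewrite mem_shifted_diagram; apply/andP; split; lia.
have : i.-1 <= (T (SeqSub dD)).1.
  by case: i {cD hj} hi dD => // i hi dD; exact: marked_diag_ge.
have : letter_le (T (SeqSub dD)) (T (SeqSub cD)).
  case: (eqVneq i j) => [e|ne]; first by subst j; rewrite (bool_irrelevance dD cD) /letter_le.
  by apply: marked_le; rewrite /left_of /= eqxx ltn_neqAle ne; case/andP: hj => ->.
rewrite /letter_le /letter_rank; move: (nat_of_ord _) (nat_of_ord _) => a b.
by case: (primed _) (primed _) => [] [] /=; lia.
Qed.

End Dominance.

Lemma content_weight n (D : seq (nat * nat)) (T : filling D (letter n)) :
  \sum_(c : seq_sub D) (T c).1 = \sum_(b < n) b * #|[pred c | (T c).1 == b]|.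
Proof.
rewrite (partition_big (fun c => (T c).1) predT) //=; apply: eq_bigr => b _.
rewrite (eq_bigr (fun=> b : nat)); last by move=> c /eqP ->.
by rewrite sum_nat_const mulnC.
Qed.

Lemma row_weight_ord nu : row_weight nu = \sum_(b < (size nu).+1) b * nth 0 nu b.
Proof. by rewrite big_ord_recr /= nth_default // muln0 addn0. Qed.

Lemma strict_partition_eq mu nu : is_strict_partition mu -> is_strict_partition nu ->
  (forall i, nth 0 mu i = nth 0 nu i) -> mu = nu.
Proof.
move=> /strict_parts_decr[_ pm] /strict_parts_decr[_ pn] E.
apply: (@eq_from_nth _ 0) => //; apply/eqP; rewrite eqn_leq.
apply/andP; split; rewrite leqNgt; apply/negP => h.
  by have := pm _ h; rewrite E nth_default.
by have := pn _ h; rewrite -E nth_default.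
Qed.

(** The sum of all entries, computed from the content, is compared with the sum of the row numbers;
    if these agree, then so do the terms in every cell. *)
Lemma marked_count_dominance mu nu :
  is_strict_partition mu -> is_strict_partition nu ->
  marked_count mu (fun b : 'I_(size nu).+1 => nth 0 nu b) != 0 ->
  row_weight mu <= row_weight nu /\ (row_weight mu = row_weight nu -> mu = nu).
Proof.
move=> sm sn; rewrite -lt0n => /card_gt0P[T]; rewrite inE => /andP[hT /forallP cT].
have W : \sum_(c : seq_sub (shifted_diagram mu)) (T c).1 = row_weight nu.
  by rewrite content_weight row_weight_ord; apply: eq_bigr => b _; rewrite (eqP (cT b)).
have ge := marked_ge sm hT.
rewrite -row_weight_cells -W; split; first by apply: leq_sum => c _.
move=> E; have {}E c : (T c).1 = (val c).1.-1 :> nat.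
  have L := leqif_sum (fun (c : seq_sub (shifted_diagram mu)) (_ : true) => leqif_eq (ge c)).
  by move: E => /eqP; rewrite L => /forallP /(_ c) /= /eqP.
apply: strict_partition_eq => // i; rewrite -card_row.
case: (ltnP i (size nu).+1) => hi.
  rewrite -[i]/(nat_of_ord (Ordinal hi)) -(eqP (cT (Ordinal hi))).
  by apply: eq_card => c; rewrite !inE -E.
rewrite nth_default ?(ltnW hi) //; apply: eq_card0 => c; rewrite inE -E.
by apply/negbTE/eqP => e; have := ltn_ord (T c).1; rewrite e ltnNge hi.
Qed.

(** The tableau with the unprimed letter [i] throughout row [i] has content [nu]. *)
Lemma marked_count_diag nu : is_strict_partition nu ->
  marked_count nu (fun b : 'I_(size nu).+1 => nth 0 nu b) != 0.
Proof.
move=> sn; rewrite -lt0n; apply/card_gt0P.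
have rowb (c : seq_sub (shifted_diagram nu)) : 0 < (val c).1 <= size nu.
  by case: c => -[i j] cD; have := cD; rewrite mem_shifted_diagram => /andP[].
have inK (c : seq_sub (shifted_diagram nu)) : (inord (val c).1.-1 : 'I_(size nu).+1) = (val
  c).1.-1 :> nat.
  by rewrite inordK //; case/andP: (rowb c) => _ h; rewrite ltnS (leq_trans (leq_pred _)).
exists [ffun c : seq_sub (shifted_diagram nu) => (inord (val c).1.-1, false) : letter (size nu).+1].
rewrite inE; apply/andP; split; last first.
  apply/forallP => b; rewrite -card_row; apply/eqP/eq_card => c; rewrite !inE ffunE /=.
  by rewrite -val_eqE /= inK.
apply/andP; split; last by apply/forallP => c; rewrite ffunE implybT.
apply/forallP => c; apply/forallP => d; rewrite !ffunE /letter_le /letter_lt /letter_rank /=.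
rewrite !inK /left_of /above; have := rowb c; have := rowb d.
by case: (val c) (val d) => [i j] [i' j'] /=; lia.
Qed.

(** * Comparison of the two expansions *)

Local Open Scope ring_scope.

(** The list [U] contains [nu], the support of [a] and the shapes from [skew_count_sum], so that
    both expansions become sums over the same list. *)
Lemma expansion_coeff (r : nat) (la : seq nat) (a : {fsfun strict_partition -> rat with 0%R})
    (n : nat) (m : 'X_{1..n.+1}) (nu : strict_partition) :
  is_partition la -> {subset diagram (staircase r) <= diagram la} ->
  {subset diagram la <= diagram (nseq r.+1 r.+1)} ->
  skew_schur n.+1 la (staircase r) = \sum_(mu <- finsupp a) a mu *: schurP n.+1 mu ->
  exists2 U : seq strict_partition, uniq U /\ nu \in U &
    \sum_(mu <- U) (a mu - #|tableaux_A r la mu|%:R) * (marked_count mu m)%:R = 0.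
Proof.
move=> h1 h2 h3 E; have [U0 hU0] := skew_count_sum m h1 h2 h3.
pose U := undup (nu :: U0 ++ finsupp a).
have uU : uniq U by apply: undup_uniq.
exists U; first by rewrite mem_undup mem_head.
have aU : \sum_(mu <- finsupp a) a mu * (marked_count mu m)%:R =
    \sum_(mu <- U) a mu * (marked_count mu m)%:R.
  rewrite [RHS](bigID (fun mu => mu \in finsupp a)) /= [X in _ = _ + X]big1 ?addr0; last first.
    by move=> mu; rewrite memNfinsupp => /eqP ->; rewrite mul0r.
  rewrite -[RHS]big_filter; apply: perm_big; apply: uniq_perm; rewrite ?filter_uniq ?fset_uniq //.
  by move=> mu; rewrite mem_filter mem_undup inE mem_cat; case: (mu \in finsupp a);
    rewrite ?orbT ?andbT ?andbF.
have := congr1 (mcoeff m) E; rewrite mcoeff_skew_schur raddf_sum /=.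
rewrite (eq_bigr (fun mu => a mu * (marked_count mu m)%:R)); last first.
  by move=> mu _; rewrite mcoeffZ mcoeff_schurP.
rewrite aU (hU0 U uU); last by move=> mu h; rewrite mem_undup inE mem_cat h orbT.
rewrite natr_sum => e; under eq_bigr => mu _ do rewrite mulrBl -natrM.
by rewrite sumrB -e subrr.
Qed.

Local Close Scope ring_scope.

Theorem theorem4p4 (r : nat) (la : seq nat) (nu : strict_partition)
    (a : {fsfun strict_partition -> rat with 0%R})
    (la_part : is_partition la)
    (delta_la : {subset diagram (staircase r) <= diagram la})
    (la_box : {subset diagram la <= diagram (nseq r.+1 r.+1)})
    (a_expansion : forall n : nat,
       (skew_schur n la (staircase r)
        = \sum_(mu <- finsupp a) a mu *: schurP n mu)%R) :
  a nu = (#|tableaux_A r la nu|%:R)%R.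
Proof.
have [k] := ubnP (row_weight nu); elim: k nu => // k IH nu hk.
have sn : is_strict_partition nu := valP nu.
(* The monomial with exponents [nu]; the extra variable keeps the number of variables positive when
   [nu] is empty. *)
pose m : 'X_{1..(size nu).+1} := [multinom nth 0%N nu b | b < (size nu).+1].
have mE mu : marked_count mu m = marked_count mu (fun b : 'I_(size nu).+1 => nth 0%N nu b).
  by apply: eq_card => T; rewrite !inE; congr (_ && _); apply: eq_forallb => b; rewrite mnmE.
have [U [uU nuU]] := expansion_coeff m nu la_part delta_la la_box (a_expansion _).
(* Any other shape either has no marked tableau of this content or has smaller weight, where the
   induction hypothesis makes its term vanish. *)
rewrite (bigD1_seq nu) //= big1 ?addr0; last first.
  move=> mu ne; rewrite mE;
    have [e|h] := eqVneq (marked_count mu (fun b : 'I_(size nu).+1 => nth 0%N nu b)) 0%N.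
    by rewrite e mulr0.
  have [le eqw] := marked_count_dominance (valP mu) sn h.
  rewrite IH ?subrr ?mul0r //; move: hk; rewrite ltnS; apply: leq_trans.
  rewrite ltn_neqAle le andbT.
  by apply/eqP => e; case/eqP: ne; apply: val_inj; exact: eqw.
move/eqP; rewrite mulf_eq0 subr_eq0 => /orP[/eqP //|].
by rewrite Num.Theory.pnatr_eq0 mE (negbTE (marked_count_diag sn)).
Qed.
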